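(* Let $x_1,\dots,x_N\in\mathbb S^2$ be points drawn from the spherical ensemble, and let $f\in L^2(\mathbb S^2)$. Then $$\lim_{N\to\infty}\operatorname{Var}\Big(\sum_{i=1}^N f(x_i)\Big)=\int_{\mathbb S^2}|\nabla f(x)|^2\,d\sigma(x).$$ In particular, the limit is finite if and only if $f\in H^1(\mathbb S^2)$.
   Context: Functions are real-valued. $\sigma$ is the normalized surface measure on $\mathbb S^2$. $H^1(\mathbb S^2)=W^{1,2}(\mathbb S^2)$, and $\int_{\mathbb S^2}|\nabla f|^2d\sigma$ is understood as $+\infty$ if $f\notin H^1(\mathbb S^2)$. Determinantal point process (DPP): a simple point process whose joint intensities with respect to a background measure $\mu$ are $\det(K(x_i,x_j))_{i,j=1}^\ell$, $\ell\ge1$, for a kernel $K$. Spherical ensemble: let $g$ be the stereographic projection of $\mathbb S^2$ from the North Pole onto $\mathbb C$. The spherical ensemble with $N$ points is the DPP on $\mathbb S^2$ with background measure $\sigma$ and kernel $$K_N(x,y)=N\frac{(1+z\bar w)^{N-1}}{(1+|z|^2)^{\frac{N-1}2}(1+|w|^2)^{\frac{N-1}2}},\qquad z=g(x),\ w=g(y).$$ It is of projection type and has exactly $N$ points almost surely; $|K_N(x,y)|^2=N^2\left(1-\frac{|x-y|^2}{4}\right)^{N-1}$. Equivalently, it is the image under $g^{-1}$ of the eigenvalues of $A^{-1}B$, with $A,B$ independent $N\times N$ matrices with i.i.d. standard complex Gaussian entries. *)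

(* Defs.v *)
From HB Require Import structures.
From mathcomp Require Import all_boot all_order all_algebra.
From mathcomp Require Import all_classical all_reals all_analysis.
From mathcomp Require Import measurable_realfun.
From mathcomp Require Import complex.

Set Implicit Arguments.
Unset Strict Implicit.
Unset Printing Implicit Defensive.

Import Order.TTheory GRing.Theory Num.Theory.
Import numFieldNormedType.Exports.

Local Open Scope classical_set_scope.
Local Open Scope ring_scope.

(* The library norm on ['rV[R]_3] is the sup norm; it matters below only
   through the topology and the derivatives it induces.  Euclidean quantities
   are expressed with [dot]. *)
Definition dot (R : realType) (u v : 'rV[R]_3) : R :=
  \sum_(i < 3) u 0 i * v 0 i.

Definition S2 (R : realType) := {x : 'rV[R]_3 | dot x x == 1}.

Definition vec3 (R : realType) (a b c : R) : 'rV[R]_3 :=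
  \row_(i < 3) [:: a; b; c]`_i.

Lemma dot_vec3 (R : realType) (a b c : R) :
  dot (vec3 a b c) (vec3 a b c) = a ^+ 2 + b ^+ 2 + c ^+ 2.
Proof. by rewrite /dot !big_ord_recl big_ord0 !mxE /= addr0 addrA !expr2. Qed.

Lemma spherical_coord_subproof (R : realType) (theta phi : R) :
  let v := vec3 (sin theta * cos phi) (sin theta * sin phi) (cos theta) in
  dot v v == 1.
Proof.
by rewrite /= dot_vec3 !exprMn -mulrDr cos2Dsin2 mulr1 addrC cos2Dsin2.
Qed.

(* [p.1] is the colatitude and [p.2] the longitude. *)
Definition spherical_coord (R : realType) (p : R * R) : S2 R :=
  exist (fun x : 'rV[R]_3 => dot x x == 1) _
    (spherical_coord_subproof p.1 p.2).

(* The Borel sigma-algebra of the sphere, as the sigma-algebra generated by the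
   three coordinate functions. *)
Definition S2_display : measure_display. Proof. exact. Qed.

Section S2_measurable.
Context (R : realType).

Let coord (i : 'I_3) (x : S2 R) : R := val x 0 i.

HB.instance Definition _ := Choice.on (S2 R).
HB.instance Definition _ := isPointed.Build (S2 R) (spherical_coord (0, 0)).

Let S2_set0 : g_sigma_preimage coord set0.
Proof. exact: sigma_algebra0. Qed.

Let S2_setC A : g_sigma_preimage coord A -> g_sigma_preimage coord (~` A).
Proof. exact: sigma_algebraC. Qed.

Let S2_bigcup (F : _^nat) : (forall i, g_sigma_preimage coord (F i)) ->
  g_sigma_preimage coord (\bigcup_i (F i)).
Proof. exact: sigma_algebra_bigcup. Qed.

HB.instance Definition _ := @isMeasurable.Build S2_display
  (S2 R) (g_sigma_preimage coord) S2_set0 S2_setC S2_bigcup.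

Lemma measurable_S2P d (T : measurableType d) (g : T -> S2 R) :
  (forall i, measurable_fun [set: T] (fun t => val (g t) 0 i : R)) ->
  measurable_fun [set: T] g.
Proof.
move=> mg _ A mA; rewrite setTI.
have : preimage_set_system [set: T] g (g_sigma_preimage coord) (g @^-1` A).
  by exists A => //; rewrite setTI.
rewrite -g_sigma_preimage_comp; apply: smallest_sub.
  exact: sigma_algebra_measurable.
rewrite -bigcup_mkord_ord; apply: bigcup_sub => i Ii.
by move=> B [C mC <-]; exact: mg.
Qed.

Lemma measurable_spherical_coord :
  measurable_fun [set: measurableTypeR R * measurableTypeR R]
    (@spherical_coord R).
Proof.
have msin : measurable_fun [set: R] (@sin R).
  by apply: continuous_measurable_fun; exact: continuous_sin.
have mcos : measurable_fun [set: R] (@cos R).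
  by apply: continuous_measurable_fun; exact: continuous_cos.
apply: measurable_S2P => -[[|[|[|//]]] lti] /=.
- under eq_fun do rewrite mxE /=.
  by apply: measurable_funM; [exact: measurableT_comp|exact: measurableT_comp].
- under eq_fun do rewrite mxE /=.
  by apply: measurable_funM; [exact: measurableT_comp|exact: measurableT_comp].
- under eq_fun do rewrite mxE /=.
  exact: measurableT_comp.
Qed.

End S2_measurable.

Section surface_measure.
Context (R : realType).

Let leb := @lebesgue_measure R.
Let box : set (measurableTypeR R * measurableTypeR R) :=
  `[0, pi]%classic `*` `[0, 2 * pi]%classic.

(* Area element [sin theta dtheta dphi]; the total area is [4 * pi]. *)
Definition sigma (A : set (S2 R)) : \bar R :=
  (((4 * pi)^-1)%:E *
   \int[leb \x leb]_(p in box `&` @spherical_coord R @^-1` A) (sin p.1)%:E)%E.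

Let mbox : measurable box.
Proof. by apply: measurableX; exact: measurable_itv. Qed.

Let sin_box_ge0 p : box p -> 0 <= sin p.1.
Proof. by move=> [/= p1 _]; apply: sin_ge0_pi; rewrite inE in p1 *. Qed.

Let msin_fst : measurable_fun [set: measurableTypeR R * measurableTypeR R]
  (fun p => (sin p.1)%:E).
Proof.
apply/measurable_EFinP; apply: measurableT_comp => //.
by apply: continuous_measurable_fun; exact: continuous_sin.
Qed.

Let sigma0 : sigma set0 = 0%E.
Proof. by rewrite /sigma preimage_set0 setI0 integral_set0 mule0. Qed.

Let c_ge0 : (0 <= ((4 * pi)^-1)%:E :> \bar R)%E.
Proof. by rewrite lee_fin invr_ge0 mulr_ge0// pi_ge0. Qed.

Let sigma_ge0 A : (0 <= sigma A)%E.
Proof.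
apply: mule_ge0 => //; apply: integral_ge0 => p [bp _].
by rewrite lee_fin sin_box_ge0.
Qed.

Let sigma_additive : semi_sigma_additive sigma.
Proof.
move=> F mF tF mUF.
have mS n : measurable (box `&` @spherical_coord R @^-1` F n).
  apply: measurableI => //; rewrite -[X in measurable X]setTI.
  exact: measurable_spherical_coord.
rewrite /sigma preimage_bigcup setI_bigcupr ge0_integral_bigcup//=; last 3 first.
- exact: measurable_funTS.
- by move=> p [n _ [bp _]]; rewrite lee_fin sin_box_ge0.
- apply/trivIsetP => i j _ _ ij; apply/seteqP; split => // p [[_ Fi] [_ Fj]].
  have /trivIsetP/(_ i j I I ij)/seteqP[+ _] := tF.
  by move=> /(_ (spherical_coord p)); apply; split.
rewrite -nneseriesZl//; last first.
  move=> n _; apply: integral_ge0 => p [bp _].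
  by rewrite lee_fin sin_box_ge0.
apply: is_cvg_ereal_nneg_natsum_cond => n _ _; apply: mule_ge0 => //.
by apply: integral_ge0 => p [bp _]; rewrite lee_fin sin_box_ge0.
Qed.

HB.instance Definition _ := isMeasure.Build _ (S2 R) R sigma
  sigma0 sigma_ge0 sigma_additive.

End surface_measure.

Fixpoint Ck (R : realType) (V W : normedModType R) (k : nat) (X : V -> W) :
    Prop :=
  if k is k'.+1 then
    (forall v, differentiable X v) /\ (forall h, Ck k' (fun v => 'D_h X v))
  else continuous X.

Definition smooth (R : realType) (V W : normedModType R) (X : V -> W) :=
  forall k, Ck k X.

Definition tangent (R : realType) (G : S2 R -> 'rV[R]_3) :=
  forall x, dot (G x) (val x) = 0.

(* The intrinsic divergence, at a point [x] of the sphere, of a vector field [X]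
   tangent to the sphere: the trace of the differential of [X] restricted to the
   tangent plane, i.e. its full trace minus its normal-normal entry. *)
Definition div_S2 (R : realType) (X : 'rV[R]_3 -> 'rV[R]_3) (x : 'rV[R]_3) :
    R :=
  \sum_(i < 3) ('D_(delta_mx 0 i) X x) 0 i - dot ('D_x X x) x.

(* [G] is a square-integrable weak gradient of [f].  Smooth vector fields on the
   sphere are the restrictions of smooth vector fields on the ambient space. *)
Definition weak_gradient (R : realType) (f : S2 R -> R)
    (G : S2 R -> 'rV[R]_3) : Prop :=
  [/\ forall i, (fun x => G x 0 i) \in Lfun (@sigma R) 2%:E,
      tangent G
    & forall X : 'rV[R]_3 -> 'rV[R]_3, smooth X ->
        tangent (fun x => X (val x)) ->
        (\int[@sigma R]_x (dot (G x) (X (val x)))%:E =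
         - \int[@sigma R]_x (f x * div_S2 X (val x))%:E)%E].

Definition H1 (R : realType) (f : S2 R -> R) : Prop :=
  f \in Lfun (@sigma R) 2%:E /\ exists G, weak_gradient f G.

(* The weak gradient, unique up to a [sigma]-negligible set when it exists. *)
Definition grad (R : realType) (f : S2 R -> R) : S2 R -> 'rV[R]_3 :=
  xget (fun=> 0) [set G | weak_gradient f G].

Definition dirichlet_energy (R : realType) (f : S2 R -> R) : \bar R :=
  (if `[< H1 f >] then \int[@sigma R]_x (dot (grad f x) (grad f x))%:E
   else +oo)%E.

(* Integral of a nonnegative function of [l] variables with respect to the
   [l]-fold product of [mu], as an iterated integral. *)
Fixpoint integral_tuple d (S : measurableType d) (R : realType)
    (mu : {measure set S -> \bar R}) (l : nat) :
    (l.-tuple S -> \bar R) -> \bar R :=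
  if l is l'.+1 then fun h =>
    (\int[mu]_s integral_tuple mu (fun t : l'.-tuple S => h [tuple of s :: t]))%E
  else fun h => h [tuple].

Section point_process.
Context d (S : measurableType d) (R : realType).
Context d' (Omega : measurableType d') (P : probability Omega R).
Variables (N : nat) (x : 'I_N -> {RV P >-> S}).

Definition count_points (B : set S) (w : Omega) : R :=
  \sum_(i < N) \1_B (x i w).

Definition simple_process : Prop :=
  {ae P, forall w, injective (fun i => x i w)}.

(* [rho] is the [l]-point joint intensity with respect to [mu] of the point
   process with points [x]. *)
Definition joint_intensity (mu : {measure set S -> \bar R}) (l : nat)
    (rho : l.-tuple S -> R) : Prop :=
  [/\ measurable_fun [set: l.-tuple S] rho,
      forall t, 0 <= rho t,
      forall t : l.-tuple S, ~~ uniq t -> rho t = 0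
    & forall B : 'I_l -> set S, (forall i, measurable (B i)) ->
        trivIset [set: 'I_l] B ->
        ('E_P[fun w => (\prod_(i < l) count_points (B i) w)%R] =
         integral_tuple mu
           (fun t => (rho t * \prod_(i < l) \1_(B i) (tnth t i))%:E))%E].

Definition determinantal (mu : {measure set S -> \bar R}) (K : S -> S -> R[i]) :
    Prop :=
  simple_process /\
  forall l, (0 < l)%N -> exists2 rho : l.-tuple S -> R,
    joint_intensity mu rho &
    forall t, (rho t)%:C%C = \det (\matrix_(i < l, j < l) K (tnth t i) (tnth t j)).

End point_process.

(* Stereographic projection from the North Pole [(0, 0, 1)] onto the equatorial
   plane; the pole itself, a [sigma]-null point, is sent to 0. *)
Definition stereo (R : realType) (x : S2 R) : R[i] :=
  ((val x 0 0 / (1 - val x 0 2)) +i* (val x 0 1 / (1 - val x 0 2)))%C.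

Definition spherical_kernel (R : realType) (N : nat) (x y : S2 R) : R[i] :=
  let z := stereo x in let w := stereo y in
  let weight (u : R[i]) : R :=
    (1 + (complex.Re u ^+ 2 + complex.Im u ^+ 2)) `^ ((N%:R - 1) / 2) in
  N%:R * (1 + z * (w^*)%C) ^+ N.-1 / ((weight z)%:C * (weight w)%:C)%C.

(* The points [x i], for [i < N], are a measurable labelling of the spherical
   ensemble with [N] points. *)
Definition spherical_ensemble (R : realType) d (Omega : measurableType d)
    (P : probability Omega R) (N : nat) (x : 'I_N -> {RV P >-> S2 R}) : Prop :=
  determinantal x (@sigma R) (@spherical_kernel R N).
Arguments spherical_ensemble {R d Omega} P {N} x.

(* Main.v *)
From HB Require Import structures.
From mathcomp Require Import all_boot all_order all_algebra.
From mathcomp Require Import all_classical all_reals all_analysis.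
From mathcomp Require Import measurable_realfun complex ring lra zify.
Require Import Defs.

Set Implicit Arguments.
Unset Strict Implicit.
Unset Printing Implicit Defensive.

Import Order.TTheory GRing.Theory Num.Theory.
Import numFieldNormedType.Exports.

Local Open Scope classical_set_scope.
Local Open Scope ring_scope.

(** Put [u(x, y) = (1 + x.y) / 2] and [k_n(x, y) = (n+1) u(x, y)^n], and let
    [T_n] be the operator on functions on the sphere with kernel [k_n].  Since
    [k_n] is nonnegative, symmetric, and has integral 1 in each variable, [T_n]
    is a symmetric Markov operator.  The squared modulus of the kernel of the
    ensemble with [n+1] points is [(n+1) k_n] almost everywhere, and therefore
    the variance of the linear statistic of [f] is [(n+1) q_n(f)], where
    [q_n(f) = <f, f - T_n f>] is the Dirichlet form of [T_n]
    ([ensemble_variance]).  Everything is thus about the limit of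
    [(n+1) q_n(f)].

    The engine is a recursion.  Let [R_i] be the derivative along the rotation
    field [v |-> e_i x v]; the sum of the squares of the [R_i] is the Laplacian
    of the sphere, and it maps [k_(n+1)(x, .)] to
    [(n+2)(n+1) (k_n - k_(n+1))(x, .)] ([lapkE]).  If [f] has weak derivatives
    [H_i = R_i f] in L2, two integrations by parts turn this into
    [(n+2)(n+1) (q_n(f) - q_(n+1)(f)) = \sum_i <H_i, T_(n+1) H_i>]
    ([qform_diff_grad]).  The operators [T_n] converge strongly to the identity
    ([L2_qnull]), so the right-hand side tends to [\sum_i |H_i|^2]; because
    [1 / ((n+2)(n+1))] telescopes to [1 / (n+1)] and [q_n(f)] tends to 0,
    [(n+1) q_n(f)] has the same limit ([energy_limit]).

    Conversely, suppose that [(n+1) q_n(f)] does not tend to infinity, so that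
    it stays below a constant for arbitrarily large [n].  The functions
    [T_(m+1) f] have bounded gradients [H_m].  The same recursion shows that the
    operators [T_n] commute ([T_comm]), whence [q_n(T_m f) <= q_n(f)]
    ([qform_T]) and, by the first part applied to [T_(m+1) f], a bound on the
    norm of [H_m].  Moreover [<H_m, H_k>] tends, as [k] grows, to
    [a_m = (m+2)(m+1) (q_m(f) - q_(m+1)(f))].  If [M] is the upper limit of
    [a_m], then [|H_m|^2 <= M] for all [m], while [a_m] is almost [M] for
    arbitrarily large [m]; along suitable indices the [H_m] therefore form a
    rapidly converging Cauchy sequence, and its limit is a weak gradient of [f]
    ([bounded_rot_grad]).

    The triple [H] and a tangent field [G] encode the same gradient:
    [H_i = G . (e_i x v)], [G = \sum_i H_i (e_i x v)] and
    [|G|^2 = \sum_i H_i^2] ([weak_gradient_rot_grad],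
    [rot_grad_weak_gradient]).

    For the variance, the joint intensities determine the law of pairs of
    points only on products of disjoint sets.  The diagonal blocks follow from
    the fact that the number of points is constant
    ([measure_disjoint_rectangles]), and the law of pairs, integrated against
    [(f(s) - f(t))^2], gives the second moment. *)

(** * Change of variables *)

Section transfer.
Local Open Scope ereal_scope.
Context d1 d2 (X : measurableType d1) (Y : measurableType d2) (R : realType).
Variables (mu : {measure set X -> \bar R}) (nu : {measure set Y -> \bar R}).
Variables (phi : X -> Y) (w : X -> R) (D : set X).
Hypotheses (mphi : measurable_fun setT phi) (mw : measurable_fun setT w).
Hypotheses (mD : measurable D) (w0 : forall x, D x -> (0 <= w x)%R).
Hypothesis nuE : forall A, measurable A ->
  nu A = \int[mu]_(x in D `&` phi @^-1` A) (w x)%:E.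

Import HBNNSimple.

(** The image of a density: the hypothesis is the case of indicators, and
    monotone approximation by simple functions does the rest. *)
Lemma ge0_integral_density (f : Y -> \bar R) :
  measurable_fun setT f -> (forall y, 0 <= f y) ->
  \int[nu]_y f y = \int[mu]_(x in D) (f (phi x) * (w x)%:E).
Proof.
move=> mf f0.
pose h := nnsfun_approx measurableT mf.
have mwD (g : Y -> R) : measurable_fun setT g ->
    measurable_fun D (fun x => (g (phi x) * w x)%:E).
  move=> mg; apply/measurable_funTS/measurable_EFinP/measurable_funM => //.
  exact: measurableT_comp.
have -> : \int[nu]_y f y = limn (fun n => \int[nu]_y (h n y)%:E).
  rewrite -monotone_convergence//.
  - apply: eq_integral => y _; apply/esym/cvg_lim => //.
    by apply: cvg_nnsfun_approx.
  - by move=> n; exact/measurable_EFinP/measurable_funP.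
  - by move=> n y _; rewrite lee_fin.
  - by move=> y _ m n mn; rewrite lee_fin; exact/lefP/nd_nnsfun_approx.
have -> : \int[mu]_(x in D) (f (phi x) * (w x)%:E) =
    limn (fun n => \int[mu]_(x in D) (h n (phi x) * w x)%:E).
  rewrite -monotone_convergence//.
  - apply: eq_integral => x /[!inE] Dx; apply/esym/cvg_lim => //.
    under eq_fun do rewrite EFinM.
    by apply: cvgeZr => //; exact: cvg_nnsfun_approx.
  - by move=> n; apply: mwD; exact: measurable_funP.
  - by move=> n x Dx; rewrite lee_fin mulr_ge0 ?w0.
  - move=> x Dx m n mn; rewrite lee_fin ler_wpM2r ?w0//.
    exact/lefP/nd_nnsfun_approx.
congr (limn _); apply/funext => n.
have mk k : measurable (phi @^-1` (h n @^-1` [set k])).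
  by rewrite -[X in measurable X]setTI; exact: mphi.
under eq_integral do rewrite fimfunE -fsumEFin//.
rewrite ge0_integral_fsum//; last 2 first.
- by move=> y; exact/measurable_EFinP/measurable_funM.
- by move=> y x _; rewrite nnfun_muleindic_ge0.
have -> : \int[mu]_(x in D) (h n (phi x) * w x)%:E =
    \int[mu]_(x in D) \sum_(y \in range (h n))
       ((y * \1_(h n @^-1` [set y]) (phi x))%:E * (w x)%:E).
  apply: eq_integral => x _; rewrite -ge0_mule_fsuml; last first.
    by move=> y; exact: nnfun_muleindic_ge0.
  by rewrite fsumEFin// -fimfunE EFinM.
rewrite ge0_integral_fsum//=; last 2 first.
- move=> y; apply: (mwD (fun t => y * \1_(h n @^-1` [set y]) t)%R).
  exact: measurable_funM.
- by move=> y x Dx; rewrite mule_ge0 ?nnfun_muleindic_ge0 ?lee_fin ?w0.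
apply: eq_fsbigr => r rh; rewrite integralZl_indic_nnsfun// integral_indic//.
rewrite setIT nuE// integral_mkcondr.
have r0 : (0 <= r)%R.
  by move: rh; rewrite inE => -[y _ <-].
rewrite -ge0_integralZl//; last 2 first.
- apply/(measurable_restrict _ _ _).1 => //.
  by apply/measurable_funTS/measurable_EFinP.
- by move=> x Dx; rewrite /patch; case: ifP => _; rewrite ?lee_fin ?w0.
- apply: eq_integral => x _; rewrite EFinM -muleA; congr *%E.
  have -> : \1_(h n @^-1` [set r]) (phi x) = \1_(phi @^-1` (h n @^-1` [set r])) x :> R by [].
  by rewrite /patch indicE; case: ifP => _; rewrite ?mul1e ?mul0e.
Qed.

End transfer.

(** * The surface measure in spherical coordinates *)

Section sigma_facts.
Context (R : realType).
Let leb := @lebesgue_measure R.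
Local Notation S := (S2 R).
Local Notation cd := (@spherical_coord R).
Let bx : set (measurableTypeR R * measurableTypeR R) :=
  `[0, pi]%classic `*` `[0, 2 * pi]%classic.

Let mbx : measurable bx.
Proof. by apply: measurableX; exact: measurable_itv. Qed.

Lemma measurable_sin : measurable_fun [set: R] (@sin R).
Proof. by apply: continuous_measurable_fun; exact: continuous_sin. Qed.

Lemma measurable_cos : measurable_fun [set: R] (@cos R).
Proof. by apply: continuous_measurable_fun; exact: continuous_cos. Qed.

Lemma ge0_integral_sigma (f : S -> \bar R) :
  measurable_fun setT f -> (forall x, (0 <= f x)%E) ->
  (\int[@sigma R]_x f x =
   \int[leb \x leb]_(p in bx) (f (cd p) * ((4 * pi)^-1 * sin p.1)%:E))%E.
Proof.
apply: ge0_integral_density => //.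
- exact: measurable_spherical_coord.
- apply: measurable_funM => //; apply: measurableT_comp => //.
  exact: measurable_sin.
- move=> p [/= p1 _]; rewrite mulr_ge0 ?invr_ge0 ?mulr_ge0 ?pi_ge0//.
  by apply: sin_ge0_pi; move: p1; rewrite in_itv.
- move=> A mA; rewrite -[LHS]/(sigma A) /sigma -ge0_integralZl//.
  + by apply: measurableI => //; rewrite -[X in measurable X]setTI;
      exact: measurable_spherical_coord.
  + apply/measurable_funTS/measurable_EFinP; apply: measurableT_comp => //.
    exact: measurable_sin.
  + move=> p [[/= p1 _] _]; rewrite lee_fin.
    by apply: sin_ge0_pi; move: p1; rewrite in_itv.
  + by rewrite lee_fin invr_ge0 mulr_ge0// pi_ge0.
Qed.

Lemma integral_setX_fubini (f : measurableTypeR R * measurableTypeR R -> \bar R)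
    (A B : set (measurableTypeR R)) :
  measurable A -> measurable B -> measurable_fun setT f ->
  (forall p, (A `*` B) p -> 0 <= f p)%E ->
  (\int[leb \x leb]_(p in A `*` B) f p =
   \int[leb]_(x in A) \int[leb]_(y in B) f (x, y))%E.
Proof.
move=> mA mB mf f0.
rewrite integral_mkcond.
rewrite (fubini_tonelli1 (f \_ (A `*` B))); last 2 first.
- apply/(measurable_restrictT _ _).1; first exact: measurableX.
  exact: measurable_funTS.
- by move=> p; apply: erestrict_ge0.
rewrite [RHS]integral_mkcond; apply: eq_integral => x _.
rewrite /fubini_F/= [in RHS]/patch; case: ifPn => xA.
  rewrite [RHS]integral_mkcond; apply: eq_integral => y _.
  by rewrite /patch in_setX xA.
rewrite integral0_eq// => y _.
by rewrite /patch in_setX (negbTE xA).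
Qed.

Lemma continuous_FTC (F f : R -> R) (a b : R) : a < b -> continuous f ->
  (forall x : R, is_derive x (1 : R) F (f x)) ->
  (\int[leb]_(x in `[a, b]) (f x)%:E = (F b - F a)%:E)%E.
Proof.
move=> ab cf dF; rewrite EFinB; apply: continuous_FTC2 => //.
- exact: continuous_subspaceT.
- have cF x : {for x, continuous F}.
    by apply: differentiable_continuous; apply/derivable1_diffP; case: (dF x).
  split.
  + by move=> x _; case: (dF x).
  + exact/cvg_at_right_filter/cF.
  + exact/cvg_at_left_filter/cF.
- by move=> x _; rewrite derive1E; case: (dF x).
Qed.

Lemma sigma_setT : sigma [set: S] = 1%E.
Proof.
rewrite /sigma preimage_setT setIT integral_setX_fubini//; last 2 first.
- apply/measurable_EFinP; apply: measurableT_comp => //.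
  exact: measurable_sin.
- move=> p [/= p1 _]; rewrite lee_fin; apply: sin_ge0_pi.
  by move: p1; rewrite in_itv.
have pi2 : 0 < 2 * pi :> R by rewrite mulr_gt0 ?pi_gt0.
under eq_integral do rewrite /= integral_cst//= lebesgue_measure_itv/=
  lte_fin pi2 -EFinB subr0 -EFinM.
rewrite (_ : (\int[leb]_(x in `[0%R, pi]) (sin x * (2 * pi))%:E)%E =
    (- cos pi * (2 * pi) - (- cos 0 * (2 * pi)))%:E); last first.
  apply: (@continuous_FTC (fun x => - cos x * (2 * pi))).
  - exact: pi_gt0.
  - move=> x; apply: cvgM; last exact: cvg_cst.
    exact: continuous_sin.
  - move=> x; apply: is_derive_eq.
    by rewrite scaler0 add0r opprK /= /GRing.scale/= mulrC.
rewrite cospi cos0 -EFinM; congr EFin.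
have := pi_gt0 R; move: (pi : R) => p /lt0r_neq0 p0; field; exact: p0.
Qed.

HB.instance Definition _ :=
  Measure_isProbability.Build _ _ _ (@sigma R) sigma_setT.

(** The stereographic projection is a coordinate only away from the pole; the
    kernel is computed up to this null set. *)
Lemma sigma_pole : sigma [set x : S | val x 0 2%:R = 1] = 0%E.
Proof.
rewrite /sigma integral0_eq ?mule0// => p [[/= p1 _]].
rewrite mxE/= => cp; congr EFin; apply/eqP.
by have := cos2Dsin2 p.1; rewrite cp expr1n => /eqP; rewrite addrC eq_sym -subr_eq subrr eq_sym sqrf_eq0.
Qed.

End sigma_facts.

(** * Bounded measurable functions *)

Section bounded_measurable.
Context d (T : measurableType d) (R : realType).
Implicit Types f g : T -> R.

(** Bounded measurable functions form an algebra of multipliers of L1, which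
    settles every integrability question about kernels. *)
Definition bmeas f :=
  measurable_fun setT f /\ exists M, forall x, `|f x| <= M.

Lemma bmeas_cst c : bmeas (cst c).
Proof. by split; [exact: measurable_cst|exists `|c|]. Qed.

Lemma bmeasD f g : bmeas f -> bmeas g -> bmeas (fun x => f x + g x).
Proof.
move=> [mf [M fM]] [mg [N gN]]; split; first exact: measurable_funD.
by exists (M + N) => x; rewrite (le_trans (ler_normD _ _))// lerD.
Qed.

Lemma bmeasN f : bmeas f -> bmeas (fun x => - f x).
Proof.
move=> [mf [M fM]]; split; first exact: measurable_funN.
by exists M => x; rewrite normrN.
Qed.

Lemma bmeasB f g : bmeas f -> bmeas g -> bmeas (fun x => f x - g x).
Proof. by move=> bf bg; apply: bmeasD => //; exact: bmeasN. Qed.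

Lemma bmeasM f g : bmeas f -> bmeas g -> bmeas (fun x => f x * g x).
Proof.
move=> [mf [M fM]] [mg [N gN]]; split; first exact: measurable_funM.
by exists (M * N) => x; rewrite normrM ler_pM.
Qed.

Lemma bmeasX f n : bmeas f -> bmeas (fun x => f x ^+ n).
Proof.
move=> bf; elim: n => [|n IH]; first by under eq_fun do rewrite expr0; exact: bmeas_cst.
by under eq_fun do rewrite exprS; exact: bmeasM.
Qed.

Lemma bmeas_sum n (f : 'I_n -> T -> R) : (forall i, bmeas (f i)) ->
  bmeas (fun x => \sum_(i < n) f i x).
Proof.
elim: n f => [f _|n IH f bf].
  by under eq_fun do rewrite big_ord0; exact: bmeas_cst.
under eq_fun do rewrite big_ord_recr/=.
by apply: bmeasD => //; apply: IH.
Qed.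

Lemma bmeas_integrable (mu : {finite_measure set T -> \bar R}) f D :
  measurable D -> bmeas f -> mu.-integrable D (EFin \o f).
Proof.
move=> mD [mf [M fM]]; apply: measurable_bounded_integrable => //.
- by rewrite -ge0_fin_numE// fin_num_measure.
- exact: measurable_funTS.
- exists M; split; first exact: num_real.
  by move=> N MN x _ /=; rewrite (le_trans (fM _))// ltW.
Qed.

End bounded_measurable.

Lemma bmeas_comp d d' (T : measurableType d) (T' : measurableType d')
    (R : realType) (f : T' -> R) (g : T -> T') :
  measurable_fun setT g -> bmeas f -> bmeas (f \o g).
Proof.
move=> mg [mf [M fM]]; split; first exact: measurableT_comp.
by exists M => x; exact: fM.
Qed.

Section sphere_functions.
Context (R : realType).
Local Notation S := (S2 R).
Local Notation V := 'rV[R]_3.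

Lemma measurable_coord (i : 'I_3) : measurable_fun [set: S] (fun x : S => val x 0 i).
Proof.
move=> _ B mB; rewrite setTI; apply: sub_sigma_algebra.
rewrite /= -bigcup_mkord_ord /=.
by exists i; [exact: ltn_ord|exists B => //; rewrite inord_val setTI].
Qed.

Lemma coord_le1 (x : S) i : `|val x 0 i| <= 1.
Proof.
move: (val x) (valP x) => v /eqP sv.
rewrite -(@expr_le1 _ 2)// real_normK ?num_real//.
rewrite -sv /dot (bigD1 i)//= expr2 lerDl sumr_ge0// => j _.
by rewrite -expr2 sqr_ge0.
Qed.

Lemma bmeas_coord i : bmeas (fun x : S => val x 0 i).
Proof.
split; first exact: measurable_coord.
by exists 1 => x; exact: coord_le1.
Qed.

(** The sigma-algebra of the sphere is generated by the coordinates, so a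
    continuous function is measurable as a pointwise limit of functions of the
    coordinates rounded down to multiples of [1 / (n+1)], each of which takes
    countably many values. *)
Lemma bmeas_continuous (u : V -> R) : continuous u ->
  bmeas (fun x : S => u (val x)).
Proof.
move=> cu; split.
  pose dv n (v : V) : V := \row_i ((Num.floor (n.+1%:R * v 0 i))%:~R / n.+1%:R).
  have dvv v : u (dv n v) @[n --> \oo] --> u v.
    apply: (cvg_comp (fun n => dv n v) u); last exact: cu.
    apply/cvg_ballP => e e0; near=> n.
    rewrite /ball/= /mx_ball; split => // i j.
    rewrite (ord1 i) !mxE.
    set z := n.+1%:R * v 0 j.
    have zE : v 0 j = z / n.+1%:R by rewrite /z mulrAC mulfV ?mul1r.
    rewrite /ball/= {1}zE -mulrBl ger0_norm; last first.
      by rewrite divr_ge0// subr_ge0 floor_le.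
    apply: (@le_lt_trans _ _ (n.+1%:R^-1)).
      rewrite ler_piMl ?invr_ge0//.
      by have := floorD1_gt z; rewrite intrD -[1%:~R]/(1 : R); lra.
    near: n; exact: near_infty_natSinv_lt (PosNum e0).
  apply: (@measurable_fun_cvg _ _ _ setT (fun n (x : S) => u (dv n (val x)))).
  - move=> n _ B mB; rewrite setTI.
    pose E (z : {ffun 'I_3 -> int}) (i : 'I_3) : set S :=
      [set x : S | Num.floor (n.+1%:R * val x 0 i) = z i].
    have mE z i : measurable (E z i).
      rewrite (_ : E z i = (fun x : S => n.+1%:R * val x 0 i) @^-1`
          `[(z i)%:~R, (z i + 1)%:~R[%classic).
        rewrite -[X in measurable X]setTI.
        have : measurable_fun [set: S] (fun x : S => n.+1%:R * val x 0 i).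
          by apply: measurable_funM => //; exact: measurable_coord.
        by apply => //; exact: measurable_itv.
      apply/seteqP; split => x; rewrite /E/= in_itv/= -floor_eq.
        by move=> ->.
      by move/eqP.
    pose G (z : {ffun 'I_3 -> int}) : set S :=
      if u (\row_i ((z i)%:~R / n.+1%:R)) \in B then
      E z 0 `&` E z 1 `&` E z 2%:R else set0.
    rewrite [X in measurable X](_ : _ = \bigcup_z G z).
      apply: countable_bigcupT_measurable; first exact: countableP.
      move=> z; rewrite /G; case: ifP => // _.
      by do 2 apply: measurableI => //.
    apply/seteqP; split => [x /= Bx|x [z _]].
      exists [ffun i => Num.floor (n.+1%:R * val x 0 i)] => //.
      rewrite /G (_ : \row_i _ = dv n (val x)); last first.
        by apply/rowP => i; rewrite !mxE ffunE.
      by rewrite mem_set// /E/=; split; [split|]; rewrite ffunE.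
    rewrite /G; case: ifPn => // /set_mem Bz [[z0 z1] z2].
    rewrite /= (_ : dv n (val x) = \row_i ((z i)%:~R / n.+1%:R))//.
    apply/rowP => i; rewrite !mxE; congr (_%:~R / _).
    case: i => -[|[|[|//]]] i3.
    - by rewrite (_ : Ordinal i3 = 0)//; exact/val_inj.
    - by rewrite (_ : Ordinal i3 = 1)//; exact/val_inj.
    - by rewrite (_ : Ordinal i3 = 2%:R)//; exact/val_inj.
  - by move=> x _; exact: dvv.
have cK : compact [set v : V | forall i, `[(-1 : R), 1]%classic (v ord0 i)].
  apply: (@rV_compact _ _ (fun=> `[(-1 : R), 1]%classic)) => i.
  exact: segment_compact.
have /compact_bounded[M [Mr MK]] :
    compact (u @` [set v : V | forall i, `[(-1 : R), 1]%classic (v ord0 i)]).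
  by apply: continuous_compact => //; exact: continuous_subspaceT.
exists (M + 1) => x; apply: (MK (M + 1)); first by rewrite ltrDl.
exists (val x) => // i /=; rewrite in_itv/= -ler_norml.
exact: coord_le1.
Unshelve. all: by end_near. Qed.

End sphere_functions.

(** * Rotation fields and their derivatives *)

Section real_continuity.
Context (R : realType) (T : topologicalType).
Implicit Types f g : T -> R.

Lemma contD f g : continuous f -> continuous g -> continuous (fun x => f x + g x).
Proof. by move=> cf cg x; apply: cvgD; [exact: cf|exact: cg]. Qed.

Lemma contM f g : continuous f -> continuous g -> continuous (fun x => f x * g x).
Proof. by move=> cf cg x; apply: cvgM; [exact: cf|exact: cg]. Qed.

Lemma contN f : continuous f -> continuous (fun x => - f x).
Proof. by move=> cf x; apply: cvgN; exact: cf. Qed.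

Lemma cont_sum n (f : 'I_n -> T -> R) : (forall i, continuous (f i)) ->
  continuous (fun x => \sum_(i < n) f i x).
Proof.
elim: n f => [f _|n IH f cf].
  by under eq_fun do rewrite big_ord0; exact: cst_continuous.
under eq_fun do rewrite big_ord_recr/=.
by apply: contD => //; apply: IH.
Qed.

Lemma eq_cont f g : f =1 g -> continuous g -> continuous f.
Proof. by move=> /funext ->. Qed.

End real_continuity.

Section rotation_derivative.
Context (R : realType).
Local Notation S := (S2 R).
Local Notation V := 'rV[R]_3.
Implicit Types (u v w : V) (f g h : V -> R).

Lemma sum3 (F : 'I_3 -> R) : \sum_(i < 3) F i = F 0 + F 1 + F 2.
Proof.
rewrite !big_ord_recl big_ord0 addr0 addrA.
by congr (_ + F _ + F _); exact/val_inj.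
Qed.

Lemma ord3P (P : 'I_3 -> Prop) : P 0 -> P 1 -> P 2 -> forall i, P i.
Proof.
move=> P0 P1 P2 [[|[|[|//]]] i3].
- by rewrite (_ : Ordinal i3 = 0)//; exact/val_inj.
- by rewrite (_ : Ordinal i3 = 1)//; exact/val_inj.
- by rewrite (_ : Ordinal i3 = 2)//; exact/val_inj.
Qed.

Lemma vec3E (a b c : R) :
  ((vec3 a b c 0 0 = a) * (vec3 a b c 0 1 = b) * (vec3 a b c 0 2 = c))%type.
Proof. by rewrite !mxE. Qed.

Definition cross u v : V :=
  vec3 (u 0 1 * v 0 2 - u 0 2 * v 0 1) (u 0 2 * v 0 0 - u 0 0 * v 0 2)
       (u 0 0 * v 0 1 - u 0 1 * v 0 0).

(** The velocity at [v] of the rotation around the [i]-th axis. *)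
Definition rot (i : 'I_3) v : V := cross (delta_mx 0 i) v.

Definition Rd (i : 'I_3) h v : R := 'D_(rot i v) h v.

Definition C1 h := Ck 1 h.

Lemma rot0E v : rot 0 v = vec3 0 (- v 0 2) (v 0 1).
Proof. by rewrite /rot /cross !mxE/= !(mul0r, mul1r, subr0, sub0r, oppr0). Qed.

Lemma rot1E v : rot 1 v = vec3 (v 0 2) 0 (- v 0 0).
Proof. by rewrite /rot /cross !mxE/= !(mul0r, mul1r, subr0, sub0r, oppr0). Qed.

Lemma rot2E v : rot 2 v = vec3 (- v 0 1) (v 0 0) 0.
Proof. by rewrite /rot /cross !mxE/= !(mul0r, mul1r, subr0, sub0r, oppr0). Qed.

Lemma derive_coord h v u : differentiable h v ->
  'D_u h v = \sum_(j < 3) u 0 j * 'D_(delta_mx 0 j) h v.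
Proof.
move=> dh; rewrite deriveE// [in LHS](row_sum_delta u) linear_sum/=.
by apply: eq_bigr => j _; rewrite linearZ/= deriveE.
Qed.

Lemma C1_diff h v : C1 h -> differentiable h v.
Proof. by case. Qed.

Lemma C1_continuous h : C1 h -> continuous h.
Proof. by case=> dh _ v; exact: differentiable_continuous. Qed.

Lemma C1_derive_continuous h u : C1 h -> continuous (fun v => 'D_u h v).
Proof. by case. Qed.

Lemma C1_intro h (k : V -> V -> R) : (forall v, differentiable h v) ->
  (forall u v, 'D_u h v = k u v) -> (forall u, continuous (k u)) -> C1 h.
Proof.
move=> dh hk ck; split => // u.
suff -> : (fun v => 'D_u h v) = k u by exact: ck.
by apply/funext => v; exact: hk.
Qed.

Lemma C1_cst c : C1 (cst c).
Proof.
apply: (@C1_intro _ (fun _ _ => 0)) => [v|u v|u].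
- exact: differentiable_cst.
- by rewrite derive_cst.
- exact: cst_continuous.
Qed.

Lemma derive_coordE j v u : 'D_u (fun v : V => v 0 j) v = u 0 j.
Proof.
have := @derive_mx R V 1 3 id v u (@derivable_id R V v u); move/rowP => /(_ j).
by rewrite mxE derive_id => <-.
Qed.

Lemma C1_coord j : C1 (fun v : V => v 0 j).
Proof.
apply: (@C1_intro _ (fun u _ => u 0 j)) => [v|u v|u].
- exact: differentiable_coord.
- exact: derive_coordE.
- exact: cst_continuous.
Qed.

Lemma C1D f g : C1 f -> C1 g -> C1 (fun v => f v + g v).
Proof.
move=> Cf Cg; apply: (@C1_intro _ (fun u v => 'D_u f v + 'D_u g v)) => [v|u v|u].
- by apply: differentiableD; exact: C1_diff.
- by rewrite deriveD//; exact/diff_derivable/C1_diff.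
- apply: contD.
    exact: (@C1_derive_continuous _ u Cf).
  exact: (@C1_derive_continuous _ u Cg).
Qed.

Lemma C1M f g : C1 f -> C1 g -> C1 (fun v => f v * g v).
Proof.
move=> Cf Cg.
apply: (@C1_intro _ (fun u v => f v * 'D_u g v + g v * 'D_u f v)) => [v|u v|u].
- by apply: differentiableM; exact: C1_diff.
- by rewrite deriveM//; exact/diff_derivable/C1_diff.
- apply: contD; apply: contM.
  + exact: (C1_continuous Cf).
  + exact: (@C1_derive_continuous _ u Cg).
  + exact: (C1_continuous Cg).
  + exact: (@C1_derive_continuous _ u Cf).
Qed.

Lemma RdD i f g v : C1 f -> C1 g ->
  Rd i (fun v => f v + g v) v = Rd i f v + Rd i g v.
Proof. by move=> Cf Cg; rewrite /Rd deriveD//; exact/diff_derivable/C1_diff. Qed.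

Lemma RdM i f g v : C1 f -> C1 g ->
  Rd i (fun v => f v * g v) v = f v * Rd i g v + g v * Rd i f v.
Proof. by move=> Cf Cg; rewrite /Rd deriveM//; exact/diff_derivable/C1_diff. Qed.

Lemma Rd_cst i c v : Rd i (cst c) v = 0.
Proof. by rewrite /Rd derive_cst. Qed.

Lemma Rd_coord i j v : Rd i (fun v : V => v 0 j) v = rot i v 0 j.
Proof.
by rewrite /Rd derive_coordE.
Qed.

Lemma RdE i h v : C1 h ->
  Rd i h v = \sum_(j < 3) rot i v 0 j * 'D_(delta_mx 0 j) h v.
Proof. by move=> Ch; rewrite /Rd derive_coord//; exact: C1_diff. Qed.

Lemma vec3_cont (T : topologicalType) (a b c : T -> R) j : continuous a -> continuous b ->
  continuous c -> continuous (fun t => vec3 (a t) (b t) (c t) 0 j).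
Proof.
move=> ca cb cc; elim/ord3P : j.
- by apply: (@eq_cont _ _ _ a) => // t; rewrite vec3E.
- by apply: (@eq_cont _ _ _ b) => // t; rewrite vec3E.
- by apply: (@eq_cont _ _ _ c) => // t; rewrite vec3E.
Qed.

Lemma rot_continuous i j : continuous (fun v : V => rot i v 0 j).
Proof.
have cc k : continuous (fun v : V => v 0 k) by exact: coord_continuous.
have cNc k : continuous (fun v : V => - v 0 k) by apply: contN.
have c0 : continuous (fun v : V => 0 : R) by exact: cst_continuous.
elim/ord3P : i.
- apply: (eq_cont (fun v => congr1 (fun w : V => w 0 j) (rot0E v))).
  exact: vec3_cont.
- apply: (eq_cont (fun v => congr1 (fun w : V => w 0 j) (rot1E v))).
  exact: vec3_cont.
- apply: (eq_cont (fun v => congr1 (fun w : V => w 0 j) (rot2E v))).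
  exact: vec3_cont.
Qed.

Lemma Rd_continuous i h : C1 h -> continuous (Rd i h).
Proof.
move=> Ch; rewrite (_ : Rd i h =
  fun v => \sum_(j < 3) rot i v 0 j * 'D_(delta_mx 0 j) h v).
  apply: cont_sum => j; apply: contM.
    exact: rot_continuous.
  exact: (@C1_derive_continuous _ (delta_mx 0 j) Ch).
by apply/funext => v; exact: RdE.
Qed.

Lemma is_derive_curve h (c : R -> V) (t : R) (c' : V) :
  differentiable h (c t) -> is_derive t (1 : R) c c' ->
  is_derive t (1 : R) (h \o c) ('D_c' h (c t)).
Proof.
move=> dh [dc dcE].
have dct : differentiable c t by exact/derivable1_diffP.
have dhc : differentiable (h \o c) t by exact: differentiable_comp.
split; first exact: diff_derivable.
by rewrite deriveE// diff_comp//= -dcE [in RHS]deriveE// deriveE.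
Qed.

Lemma is_derive_vec3 (a b c : R -> R) (t a' b' c' : R) :
  is_derive t (1 : R) a a' -> is_derive t (1 : R) b b' ->
  is_derive t (1 : R) c c' ->
  is_derive t (1 : R) (fun t => vec3 (a t) (b t) (c t)) (vec3 a' b' c').
Proof.
move=> [da daE] [db dbE] [dc dcE].
have dM : derivable (fun t => vec3 (a t) (b t) (c t)) t 1.
  apply/derivable_mxP => i j; rewrite (ord1 i).
  by elim/ord3P : j; under eq_fun do rewrite mxE.
split => //; rewrite derive_mx//; apply/rowP => j; rewrite mxE.
have coordE (F : R -> R) k : (fun t => vec3 (a t) (b t) (c t) 0 k) = F ->
    'D_1 F t = vec3 a' b' c' 0 k ->
    'D_1 (fun t => vec3 (a t) (b t) (c t) 0 k) t = vec3 a' b' c' 0 k.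
  by move=> ->.
elim/ord3P : j.
- by apply: (coordE a); [apply/funext => s; rewrite vec3E|rewrite vec3E].
- by apply: (coordE b); [apply/funext => s; rewrite vec3E|rewrite vec3E].
- by apply: (coordE c); [apply/funext => s; rewrite vec3E|rewrite vec3E].
Qed.

End rotation_derivative.

(** * Integration by parts along rotations *)

Section integration_by_parts.
Context (R : realType).
Let leb := @lebesgue_measure R.
Local Notation S := (S2 R).
Local Notation V := 'rV[R]_3.
Local Notation cd := (@spherical_coord R).
Local Notation RR := (measurableTypeR R * measurableTypeR R)%type.
Let I1 : set (measurableTypeR R) := `[0, pi]%classic.
Let I2 : set (measurableTypeR R) := `[0, 2 * pi]%classic.
Let bx : set RR := I1 `*` I2.

Let mbx : measurable bx.
Proof. by apply: measurableX; exact: measurable_itv. Qed.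

Let pi2_gt0 : 0 < 2 * pi :> R. Proof. by rewrite mulr_gt0 ?pi_gt0. Qed.

Lemma bmeas_integrable_box (a : RR -> R) : bmeas a ->
  (leb \x leb)%E.-integrable bx (EFin \o a).
Proof.
move=> [ma [M aM]]; apply: measurable_bounded_integrable => //.
- rewrite [X in (X < _)%E](_ : _ =
      (leb (`[0, pi]%classic)%R * leb (`[0, 2 * pi]%classic)%R)%E); last first.
    by apply: product_measure1E; exact: measurable_itv.
  by rewrite /leb !lebesgue_measure_itv/= !lte_fin pi_gt0 pi2_gt0 -!EFinB -EFinM ltry.
- exact: measurable_funTS.
- exists M; split; first exact: num_real.
  by move=> N MN x _ /=; rewrite (le_trans (aM _))// ltW.
Qed.

Lemma bmeas_sin_fst : bmeas (fun p : RR => sin p.1).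
Proof.
split; last by exists 1 => p; exact: sin_max.
by apply: measurableT_comp => //; exact: measurable_sin.
Qed.

Lemma bmeas_cos_fst : bmeas (fun p : RR => cos p.1).
Proof.
split; last by exists 1 => p; exact: cos_max.
by apply: measurableT_comp => //; exact: measurable_cos.
Qed.

Lemma bmeas_sin_snd : bmeas (fun p : RR => sin p.2).
Proof.
split; last by exists 1 => p; exact: sin_max.
by apply: measurableT_comp => //; exact: measurable_sin.
Qed.

Lemma bmeas_cos_snd : bmeas (fun p : RR => cos p.2).
Proof.
split; last by exists 1 => p; exact: cos_max.
by apply: measurableT_comp => //; exact: measurable_cos.
Qed.

(** From nonnegative to bounded integrands, by adding a constant. *)
Lemma integral_sigma_bmeas (g : S -> R) : bmeas g ->
  (\int[@sigma R]_x (g x)%:E =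
   \int[leb \x leb]_(p in bx) (g (cd p) * ((4 * pi)^-1 * sin p.1))%:E)%E.
Proof.
move=> bg; have [mg [M gM]] := bg.
pose w (p : RR) : R := (4 * pi)^-1 * sin p.1.
have bw : bmeas w by apply: bmeasM; [exact: bmeas_cst|exact: bmeas_sin_fst].
have M0 : 0 <= M by exact: le_trans (gM (spherical_coord (0, 0))).
have bgc : bmeas (fun p => g (cd p)).
  by apply: (bmeas_comp _ bg); exact: measurable_spherical_coord.
have EM : (\int[leb \x leb]_(p in bx) (M * w p)%:E = M%:E)%E.
  have := @ge0_integral_sigma R (fun=> M%:E) (measurable_cst _).
  rewrite integral_cst//= sigma_setT mule1 => <-//.
have EgM : (\int[@sigma R]_x (g x + M)%:E =
    \int[leb \x leb]_(p in bx) (g (cd p) * w p + M * w p)%:E)%E.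
  rewrite (@ge0_integral_sigma R (fun x => (g x + M)%:E)).
  - by apply: eq_integral => p _; rewrite -EFinM mulrDl.
  - by apply/measurable_EFinP; apply: measurable_funD.
  - move=> x; rewrite lee_fin; have := gM x; rewrite ler_norml => /andP[]; lra.
have iM : (@sigma R).-integrable setT (EFin \o cst M).
  by apply: bmeas_integrable => //; exact: bmeas_cst.
have ig := bmeas_integrable (@sigma R) measurableT bg.
have igw : (leb \x leb)%E.-integrable bx (EFin \o (fun p => g (cd p) * w p)).
  by apply: bmeas_integrable_box; exact: bmeasM.
have iMw : (leb \x leb)%E.-integrable bx (EFin \o (fun p => M * w p)).
  by apply: bmeas_integrable_box; apply: bmeasM => //; exact: bmeas_cst.
move: EgM; under eq_integral do rewrite EFinD.
have E1 : (\int[@sigma R]_x (EFin \o cst M) x = M%:E)%E.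
  rewrite -[LHS]/(\int[@sigma R]_x (cst M%:E x))%E.
  by rewrite integral_cst//= sigma_setT mule1.
rewrite (integralD measurableT ig iM) E1.
under [RHS]eq_integral do rewrite EFinD.
rewrite (integralD mbx igw iMw) EM => H.
by rewrite -[LHS](@addeK _ M%:E)// H addeK.
Qed.

Lemma box_fubini (a : RR -> R) : bmeas a ->
  (\int[leb \x leb]_(p in bx) (a p)%:E =
    \int[leb]_(x in I1) \int[leb]_(y in I2) (a (x, y))%:E)%E /\
  (\int[leb \x leb]_(p in bx) (a p)%:E =
    \int[leb]_(y in I2) \int[leb]_(x in I1) (a (x, y))%:E)%E.
Proof.
move=> /bmeas_integrable_box; rewrite integrable_mkcond// => ia.
have A : (\int[leb \x leb]_(p in bx) (a p)%:E =
  \int[leb \x leb]_p (((EFin \o a) \_ bx) p))%E by rewrite integral_mkcond.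
split; rewrite A.
- rewrite -(integral12_prod_meas1 ia) [RHS]integral_mkcond.
  apply: eq_integral => x _; rewrite /fubini_F [RHS]patchE.
  case: ifPn => xA.
    rewrite [RHS]integral_mkcond; apply: eq_integral => y _.
    by rewrite /patch in_setX xA.
  rewrite integral0_eq// => y _.
  by rewrite /patch in_setX (negbTE xA).
- rewrite -(integral21_prod_meas1 ia) [RHS]integral_mkcond.
  apply: eq_integral => y _; rewrite /fubini_G [RHS]patchE.
  case: ifPn => yB.
    rewrite [RHS]integral_mkcond; apply: eq_integral => x _.
    by rewrite /patch in_setX yB andbT.
  rewrite integral0_eq// => x _.
  by rewrite /patch in_setX (negbTE yB) andbF.
Qed.

(** The fundamental theorem of calculus in the first variable, under Fubini's
    theorem: a derivative whose primitive takes equal values at both ends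
    integrates to zero. *)
Lemma box_ibp_fst (a : RR -> R) (F : R -> R -> R) : bmeas a ->
  (forall y, continuous (fun x : R => a (x, y))) ->
  (forall x y : R, is_derive x (1 : R) (F ^~ y) (a (x, y))) ->
  (forall y, F pi y = F 0 y) ->
  (\int[leb \x leb]_(p in bx) (a p)%:E = 0)%E.
Proof.
move=> ba ca dF Fpi; have [_ ->] := box_fubini ba.
apply: integral0_eq => y _.
by rewrite (@continuous_FTC R (F ^~ y) _ _ _ (pi_gt0 _) (ca y))// Fpi subrr.
Qed.

Lemma box_ibp_snd (a : RR -> R) (F : R -> R -> R) : bmeas a ->
  (forall x, continuous (fun y : R => a (x, y))) ->
  (forall x y : R, is_derive y (1 : R) (F x) (a (x, y))) ->
  (forall x, F x (2 * pi) = F x 0) ->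
  (\int[leb \x leb]_(p in bx) (a p)%:E = 0)%E.
Proof.
move=> ba ca dF Fpi; have [-> _] := box_fubini ba.
apply: integral0_eq => x _.
by rewrite (@continuous_FTC R (F x) _ _ _ pi2_gt0 (ca x))// Fpi subrr.
Qed.

End integration_by_parts.

Section rotation_ibp.
Context (R : realType).
Let leb := @lebesgue_measure R.
Local Notation S := (S2 R).
Local Notation V := 'rV[R]_3.
Local Notation cd := (@spherical_coord R).
Local Notation RR := (measurableTypeR R * measurableTypeR R)%type.
Let bx : set RR := `[0, pi]%classic `*` `[0, 2 * pi]%classic.
Let mbx : measurable bx.
Proof. by apply: measurableX; exact: measurable_itv. Qed.

(* [co] is the point with colatitude [x] and longitude [y]; [ct] and [cp] are
   its derivatives in [x] and [y]. *)
Let co (x y : R) : V := vec3 (sin x * cos y) (sin x * sin y) (cos x).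
Let ct (x y : R) : V := vec3 (cos x * cos y) (cos x * sin y) (- sin x).
Let cp (x y : R) : V := vec3 (- (sin x * sin y)) (sin x * cos y) 0.

Let dco1 (x y : R) : is_derive x (1 : R) (co ^~ y) (ct x y).
Proof.
apply: is_derive_vec3.
- by apply: is_derive_eq; rewrite /GRing.scale/=; ring.
- by apply: is_derive_eq; rewrite /GRing.scale/=; ring.
Qed.

Let dco2 (x y : R) : is_derive y (1 : R) (co x) (cp x y).
Proof.
by apply: is_derive_vec3; apply: is_derive_eq; rewrite /GRing.scale/=; ring.
Qed.

Let cco1 y : continuous (co ^~ y).
Proof.
move=> x; apply: differentiable_continuous; apply/derivable1_diffP.
by case: (dco1 x y).
Qed.

Let cco2 x : continuous (co x).
Proof.
move=> y; apply: differentiable_continuous; apply/derivable1_diffP.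
by case: (dco2 x y).
Qed.

Lemma derive_lin2 (h : V -> R) v u w a b : differentiable h v ->
  'D_(a *: u + b *: w) h v = a * 'D_u h v + b * 'D_w h v.
Proof. by move=> dh; rewrite !deriveE// linearD !linearZ. Qed.

Lemma cont_derive_along (T : topologicalType) (h : V -> R) (e c : T -> V) :
  C1 h -> (forall j, continuous (fun t => e t 0 j)) -> continuous c ->
  continuous (fun t => 'D_(e t) h (c t)).
Proof.
move=> Ch ce cc; apply: (@eq_cont _ _ _
  (fun t => \sum_(j < 3) e t 0 j * 'D_(delta_mx 0 j) h (c t))).
  by move=> t; rewrite derive_coord//; exact: C1_diff.
apply: cont_sum => j; apply: contM => // t.
apply: (@continuous_comp _ _ _ c (fun v => 'D_(delta_mx 0 j) h v)).
  exact: cc.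
exact: (@C1_derive_continuous _ _ (delta_mx 0 j) Ch).
Qed.

Let bco (u : V -> R) : continuous u -> bmeas (fun p : RR => u (co p.1 p.2)).
Proof.
move=> cu.
exact: (bmeas_comp (@measurable_spherical_coord R) (bmeas_continuous cu)).
Qed.

Let bderive_along (h : V -> R) (e : RR -> V) : C1 h ->
  (forall j, bmeas (fun p => e p 0 j)) ->
  bmeas (fun p : RR => 'D_(e p) h (co p.1 p.2)).
Proof.
move=> Ch be; rewrite (_ : (fun p => _) = (fun p : RR =>
    \sum_(j < 3) e p 0 j * 'D_(delta_mx 0 j) h (co p.1 p.2))).
  apply: bmeas_sum => j; apply: bmeasM => //.
  apply: (bco (u := fun v => 'D_(delta_mx 0 j) h v)).
  exact: (@C1_derive_continuous _ _ (delta_mx 0 j) Ch).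
by apply/funext => p; rewrite derive_coord//; exact: C1_diff.
Qed.

Let bvec3 (a b c : RR -> R) j : bmeas a -> bmeas b -> bmeas c ->
  bmeas (fun p => vec3 (a p) (b p) (c p) 0 j).
Proof.
move=> ba bb bc; elim/ord3P : j.
- by rewrite (_ : (fun p => _) = a)//; apply/funext => p; rewrite vec3E.
- by rewrite (_ : (fun p => _) = b)//; apply/funext => p; rewrite vec3E.
- by rewrite (_ : (fun p => _) = c)//; apply/funext => p; rewrite vec3E.
Qed.

Let bs1 := @bmeas_sin_fst R.
Let bs2 := @bmeas_sin_snd R.
Let bc1 := @bmeas_cos_fst R.
Let bc2 := @bmeas_cos_snd R.
Let csin : continuous (@sin R) := @continuous_sin R.
Let ccos : continuous (@cos R) := @continuous_cos R.

Let bct j : bmeas (fun p : RR => ct p.1 p.2 0 j).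
Proof. by apply: bvec3; do ?apply: bmeasM => //; apply: bmeasN. Qed.

Let bcp j : bmeas (fun p : RR => cp p.1 p.2 0 j).
Proof.
by apply: bvec3; [apply: bmeasN; apply: bmeasM|apply: bmeasM|exact: bmeas_cst].
Qed.

Variable h : V -> R.
Hypothesis Ch : C1 h.

Let ch := C1_continuous Ch.
Let dh v := C1_diff v Ch.

Let chco1 y : continuous (fun x => h (co x y)).
Proof. by move=> x; apply: continuous_comp; [exact: cco1|exact: ch]. Qed.

Let chco2 x : continuous (fun y => h (co x y)).
Proof. by move=> y; apply: continuous_comp; [exact: cco2|exact: ch]. Qed.

(* The integrand is the colatitude derivative of [s(y) sin(x) h], and the sine
   vanishes at both poles. *)
Let int_theta (s : R -> R) : bmeas (fun p : RR => s p.2) ->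
  (\int[leb \x leb]_(p in bx) (s p.2 * (cos p.1 * h (co p.1 p.2) +
     sin p.1 * 'D_(ct p.1 p.2) h (co p.1 p.2)))%:E = 0)%E.
Proof.
move=> bs.
apply: (@box_ibp_fst R (fun p => s p.2 * (cos p.1 * h (co p.1 p.2) +
     sin p.1 * 'D_(ct p.1 p.2) h (co p.1 p.2)))
  (fun x y => s y * (sin x * h (co x y)))).
- apply: bmeasM => //; apply: bmeasD; apply: bmeasM => //.
    exact: bco.
  exact: bderive_along.
- move=> y /=; apply: contM; first exact: cst_continuous.
  apply: contD; apply: contM => //.
  apply: cont_derive_along => // j; apply: vec3_cont.
  + by apply: contM => //; exact: cst_continuous.
  + by apply: contM => //; exact: cst_continuous.
  + exact: contN.
- move=> x y /=.
  have dhc := @is_derive_curve R h (co ^~ y) x _ (dh _) (dco1 x y).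
  by apply: is_derive_eq; rewrite /GRing.scale/=; ring.
- by move=> y; rewrite sinpi sin0 !mul0r.
Qed.

(* The integrand is the longitude derivative of [g(x) s(y) h], which is
   periodic. *)
Let int_phi (g s s' : R -> R) : bmeas (fun p : RR => g p.1) ->
  bmeas (fun p : RR => s p.2) -> bmeas (fun p : RR => s' p.2) ->
  continuous s -> continuous s' ->
  (forall y : R, is_derive y (1 : R) s (s' y)) -> s (2 * pi) = s 0 ->
  (\int[leb \x leb]_(p in bx) (g p.1 * (s' p.2 * h (co p.1 p.2) +
     s p.2 * 'D_(cp p.1 p.2) h (co p.1 p.2)))%:E = 0)%E.
Proof.
move=> bg bs bs' cs cs' ds sper.
apply: (@box_ibp_snd R (fun p => g p.1 * (s' p.2 * h (co p.1 p.2) +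
     s p.2 * 'D_(cp p.1 p.2) h (co p.1 p.2)))
  (fun x y => g x * (s y * h (co x y)))).
- apply: bmeasM => //; apply: bmeasD; apply: bmeasM => //.
    exact: bco.
  exact: bderive_along.
- move=> x /=; apply: contM; first exact: cst_continuous.
  apply: contD; apply: contM => //.
  apply: cont_derive_along => // j; apply: vec3_cont.
  + by apply: contN; apply: contM => //; exact: cst_continuous.
  + by apply: contM => //; exact: cst_continuous.
  + exact: cst_continuous.
- move=> x y /=.
  have dhc := @is_derive_curve R h (co x) y _ (dh _) (dco2 x y).
  by apply: is_derive_eq; rewrite /GRing.scale/=; ring.
- move=> x; rewrite sper; congr (_ * (_ * h _)).
  by rewrite /co mulr_natl cos2pi sin2pi cos0 sin0.
Qed.

(** Rotations preserve the surface measure.  In spherical coordinates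
    [sin x * R_i h] is a sum of a colatitude derivative and a longitude
    derivative, both of which integrate to zero.  The coefficients of the
    decomposition come from writing [sin x] times the rotation field in the
    frame [ct], [cp]; for the third axis the rotation field is [cp] itself. *)
Lemma integral_Rd i : (\int[@sigma R]_x (Rd i h (val x))%:E = 0)%E.
Proof.
pose k : R := (4 * pi)^-1.
have sper : sin (2 * pi) = sin 0 :> R by rewrite mulr_natl sin2pi sin0.
have cper : cos (2 * pi) = cos 0 :> R by rewrite mulr_natl cos2pi cos0.
rewrite (integral_sigma_bmeas (bmeas_continuous (Rd_continuous (i := i) Ch))).
have add0 (a a1 a2 : RR -> R) : bmeas a1 -> bmeas a2 ->
    (forall p, a p = a1 p + a2 p) ->
    (\int[leb \x leb]_(p in bx) (a1 p)%:E = 0)%E ->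
    (\int[leb \x leb]_(p in bx) (a2 p)%:E = 0)%E ->
    (\int[leb \x leb]_(p in bx) (a p)%:E = 0)%E.
  move=> b1 b2 aE i1 i2.
  under eq_integral do rewrite aE EFinD.
  rewrite (integralD mbx (bmeas_integrable_box b1) (bmeas_integrable_box b2)).
  by rewrite i1 i2 adde0.
have bA : bmeas (fun p : RR => cos p.1 * h (co p.1 p.2) +
     sin p.1 * 'D_(ct p.1 p.2) h (co p.1 p.2)).
  apply: bmeasD; apply: bmeasM => //; first exact: bco.
  exact: bderive_along.
have bB (s s' : RR -> R) : bmeas s -> bmeas s' ->
  bmeas (fun p : RR => s' p * h (co p.1 p.2) +
     s p * 'D_(cp p.1 p.2) h (co p.1 p.2)).
  move=> ? ?; apply: bmeasD; apply: bmeasM => //; first exact: bco.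
  exact: bderive_along.
have bk (s : RR -> R) : bmeas s -> bmeas (fun p => k * s p).
  by move=> ?; apply: bmeasM => //; exact: bmeas_cst.
elim/ord3P : i.
- apply: (add0 _ (fun p => k * - sin p.2 * (cos p.1 * h (co p.1 p.2) +
     sin p.1 * 'D_(ct p.1 p.2) h (co p.1 p.2)))
     (fun p => k * - cos p.1 * (- sin p.2 * h (co p.1 p.2) +
     cos p.2 * 'D_(cp p.1 p.2) h (co p.1 p.2)))).
  + by apply: bmeasM => //; apply: bk; exact: bmeasN.
  + apply: bmeasM; first by apply: bk; exact: bmeasN.
    by apply: bB => //; exact: bmeasN.
  + move=> [x y] /=; rewrite /Rd -/(co x y) -/k.
    transitivity (k * 'D_(sin x *: rot 0 (co x y)) h (co x y)).
      by rewrite -[sin x *: _]addr0 -(scale0r (0 : V)) derive_lin2//; ring.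
    have -> : sin x *: rot 0 (co x y) =
        (- (sin x * sin y)) *: ct x y + (- (cos x * cos y)) *: cp x y.
      rewrite rot0E; apply/rowP; elim/ord3P; rewrite !mxE/=.
      * by ring.
      * by have := cos2Dsin2 y => /(congr1 (fun t => sin x * cos x * t)); lra.
      * by ring.
    by rewrite derive_lin2//; ring.
  + by apply: (@int_theta (fun y => k * - sin y)); apply: bk; exact: bmeasN.
  + apply: (@int_phi (fun x => k * - cos x) cos (fun y => - sin y)) => //.
    * by apply: bk; exact: bmeasN.
    * exact: bmeasN.
    * exact: contN.
- apply: (add0 _ (fun p => k * cos p.2 * (cos p.1 * h (co p.1 p.2) +
     sin p.1 * 'D_(ct p.1 p.2) h (co p.1 p.2)))
     (fun p => k * - cos p.1 * (cos p.2 * h (co p.1 p.2) +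
     sin p.2 * 'D_(cp p.1 p.2) h (co p.1 p.2)))).
  + by apply: bmeasM => //; apply: bk.
  + apply: bmeasM; first by apply: bk; exact: bmeasN.
    by apply: bB.
  + move=> [x y] /=; rewrite /Rd -/(co x y) -/k.
    transitivity (k * 'D_(sin x *: rot 1 (co x y)) h (co x y)).
      by rewrite -[sin x *: _]addr0 -(scale0r (0 : V)) derive_lin2//; ring.
    have -> : sin x *: rot 1 (co x y) =
        (sin x * cos y) *: ct x y + (- (cos x * sin y)) *: cp x y.
      rewrite rot1E; apply/rowP; elim/ord3P; rewrite !mxE/=.
      * by have := cos2Dsin2 y => /(congr1 (fun t => sin x * cos x * t)); lra.
      * by ring.
      * by ring.
    by rewrite derive_lin2//; ring.
  + by apply: (@int_theta (fun y => k * cos y)); apply: bk.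
  + apply: (@int_phi (fun x => k * - cos x) sin cos) => //.
    by apply: bk; exact: bmeasN.
- transitivity (\int[leb \x leb]_(p in bx) (k * sin p.1 *
    (0 * h (co p.1 p.2) + 1 * 'D_(cp p.1 p.2) h (co p.1 p.2)))%:E)%E.
    apply: eq_integral => -[x y] _ /=; congr EFin.
    rewrite /Rd -/(co x y) rot2E !vec3E -/(cp x y) -/k; ring.
  apply: (@int_phi (fun x => k * sin x) (fun=> 1) (fun=> 0)) => //.
  + exact: bk.
  + exact: bmeas_cst.
  + exact: bmeas_cst.
  + exact: cst_continuous.
  + exact: cst_continuous.
Qed.

End rotation_ibp.

(** * L1, L2 and kernel operators on a probability space *)

(** Locked, so that comparing two means compares the integrands and does not
    unfold the integral. *)
HB.lock Definition mean d (T : measurableType d) (R : realType)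
  (mu : probability T R) (f : T -> R) : R := \int[mu]_x f x.

Section probability_space.
Context d (T : measurableType d) (R : realType) (mu : probability T R).
Implicit Types (f g h : T -> R) (K : T -> T -> R).

Definition is_L1 f := mu.-integrable setT (EFin \o f).
Definition is_L2 f := measurable_fun setT f /\ is_L1 (fun x => f x ^+ 2).
Local Notation I := (mean mu).
Local Notation L1 := is_L1.
Local Notation L2 := is_L2.

Lemma L1_measurable f : L1 f -> measurable_fun setT f.
Proof. by move=> /measurable_int /measurable_EFinP. Qed.

Lemma IE f : L1 f -> (\int[mu]_x (f x)%:E)%E = (I f)%:E.
Proof. by move=> f1; rewrite mean.unlock /Rintegral fineK//; exact: integrable_fin_num. Qed.

Lemma eq_I f g : f =1 g -> I f = I g.
Proof. by move=> /funext ->. Qed.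

Lemma L1_le f g : measurable_fun setT f -> (forall x, `|f x| <= g x) -> L1 g ->
  L1 f.
Proof.
move=> mf fg; apply: le_integrable => //; first exact/measurable_EFinP.
by move=> x _ /=; rewrite lee_fin (le_trans (fg x))// ler_norm.
Qed.

Lemma L1_bmeas f : bmeas f -> L1 f.
Proof. exact: bmeas_integrable. Qed.

Lemma L1_cst c : L1 (fun=> c).
Proof. exact/L1_bmeas/bmeas_cst. Qed.

Lemma L1D f g : L1 f -> L1 g -> L1 (fun x => f x + g x).
Proof. by move=> f1 g1; exact: (integrableD measurableT f1 g1). Qed.

Lemma L1B f g : L1 f -> L1 g -> L1 (fun x => f x - g x).
Proof. by move=> f1 g1; exact: (integrableB measurableT f1 g1). Qed.

Lemma L1Z c f : L1 f -> L1 (fun x => c * f x).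
Proof. by move=> f1; exact: (integrableZl measurableT c f1). Qed.

Lemma L1_sum n (F : 'I_n -> T -> R) : (forall i, L1 (F i)) ->
  L1 (fun x => \sum_(i < n) F i x).
Proof.
elim: n F => [F _|n IH F F1].
  by under eq_fun do rewrite big_ord0; exact: L1_cst.
by under eq_fun do rewrite big_ord_recr/=; apply: L1D => //; exact: IH.
Qed.

Lemma L1_norm f : L1 f -> L1 (fun x => `|f x|).
Proof. exact: integrable_norm. Qed.

Lemma L1M f g : L1 f -> bmeas g -> L1 (fun x => f x * g x).
Proof.
move=> f1 [mg [M gM]]; apply: (@L1_le _ (fun x => M * `|f x|)).
- by apply: measurable_funM => //; exact: L1_measurable.
- by move=> x; rewrite normrM mulrC ler_wpM2r.
- exact/L1Z/L1_norm.
Qed.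

Lemma ID f g : L1 f -> L1 g -> I (fun x => f x + g x) = I f + I g.
Proof. by move=> f1 g1; rewrite mean.unlock RintegralD. Qed.

Lemma IB f g : L1 f -> L1 g -> I (fun x => f x - g x) = I f - I g.
Proof. by move=> f1 g1; rewrite mean.unlock RintegralB. Qed.

Lemma IZ c f : L1 f -> I (fun x => c * f x) = c * I f.
Proof. by move=> f1; rewrite mean.unlock RintegralZl. Qed.

Lemma I_cst c : I (fun=> c) = c.
Proof.
by rewrite mean.unlock Rintegral_cst//= probability_setT mulr1.
Qed.

Lemma I_sum n (F : 'I_n -> T -> R) : (forall i, L1 (F i)) ->
  I (fun x => \sum_(i < n) F i x) = \sum_(i < n) I (F i).
Proof.
elim: n F => [F _|n IH F F1].
  by under eq_fun do rewrite big_ord0; rewrite I_cst big_ord0.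
under eq_fun do rewrite big_ord_recr/=.
by rewrite ID ?IH ?big_ord_recr//; exact: L1_sum.
Qed.

Lemma I_ge0 f : (forall x, 0 <= f x) -> 0 <= I f.
Proof. by move=> f0; rewrite mean.unlock; apply: Rintegral_ge0. Qed.

Lemma I_le f g : L1 f -> L1 g -> (forall x, f x <= g x) -> I f <= I g.
Proof. by move=> f1 g1 fg; rewrite mean.unlock; apply: le_Rintegral. Qed.

Lemma I_norm f : L1 f -> `|I f| <= I (fun x => `|f x|).
Proof. by move=> f1; rewrite mean.unlock; apply: le_normr_Rintegral. Qed.

Lemma L2_measurable f : L2 f -> measurable_fun setT f.
Proof. by case. Qed.

Lemma L2_sq f : L2 f -> L1 (fun x => f x ^+ 2).
Proof. by case. Qed.

Lemma L2_mul f g : L2 f -> L2 g -> L1 (fun x => f x * g x).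
Proof.
move=> [mf f2] [mg g2]; apply: (@L1_le _ (fun x => f x ^+ 2 + g x ^+ 2)).
- exact: measurable_funM.
- move=> x; rewrite ler_norml; apply/andP; split.
    by have := sqr_ge0 (f x + g x); rewrite -subr_ge0; nra.
  by have := sqr_ge0 (f x - g x); nra.
- exact: L1D.
Qed.

Lemma L2_bmeas f : bmeas f -> L2 f.
Proof. by move=> bf; split; [case: bf|apply/L1_bmeas/bmeasX]. Qed.

Lemma L2_L1 f : L2 f -> L1 f.
Proof.
move=> f2; have : L1 (fun x => f x * 1).
  by apply: L2_mul => //; apply/L2_bmeas/bmeas_cst.
by under eq_fun do rewrite mulr1.
Qed.

Lemma L2_Lfun f : L2 f <-> f \in Lfun mu 2%:E.
Proof.
split=> [[mf f2]|lf]; last first.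
  split; last exact: Lfun2_integrable_sqr.
  by move: lf; rewrite inE => /andP[/[!inE]].
rewrite inE; apply/andP; split; rewrite inE//=.
rewrite /finite_norm unlock /Lnorm poweR_lty//.
under eq_integral do rewrite /= powR_mulrn// real_normK ?num_real//.
have /integrableP[_] := f2; apply: le_lt_trans.
by under [leRHS]eq_integral do rewrite /= ger0_norm ?sqr_ge0//.
Qed.

Lemma L2D f g : L2 f -> L2 g -> L2 (fun x => f x + g x).
Proof.
move=> f2 g2; split; first by apply: measurable_funD; exact: L2_measurable.
have -> : (fun x => (f x + g x) ^+ 2) =
    (fun x => f x ^+ 2 + 2 * (f x * g x) + g x ^+ 2).
  by apply/funext => x; ring.
apply: L1D; last exact: L2_sq.
by apply: L1D; [exact: L2_sq|apply/L1Z/L2_mul].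
Qed.

Lemma L2Z c f : L2 f -> L2 (fun x => c * f x).
Proof.
move=> f2; split.
  by apply: measurable_funM => //; exact: L2_measurable.
by under eq_fun do rewrite exprMn; apply/L1Z/L2_sq.
Qed.

Lemma L2B f g : L2 f -> L2 g -> L2 (fun x => f x - g x).
Proof.
move=> f2 g2; have : L2 (fun x => f x + -1 * g x) by apply/L2D/L2Z.
by under eq_fun do rewrite mulN1r.
Qed.

Lemma L2_le f g : measurable_fun setT f -> (forall x, `|f x| <= `|g x|) ->
  L2 g -> L2 f.
Proof.
move=> mf fg [mg g2]; split => //; apply: L1_le g2.
  exact: measurable_funX.
move=> x; rewrite ger0_norm ?sqr_ge0// -(real_normK (num_real (f x))).
by rewrite -(real_normK (num_real (g x))) lerXn2r// ?nnegrE.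
Qed.

Lemma L2_sum n (F : 'I_n -> T -> R) : (forall i, L2 (F i)) ->
  L2 (fun x => \sum_(i < n) F i x).
Proof.
elim: n F => [F _|n IH F F2].
  by under eq_fun do rewrite big_ord0; apply/L2_bmeas/bmeas_cst.
by under eq_fun do rewrite big_ord_recr/=; apply: L2D => //; exact: IH.
Qed.

Lemma L2M f g : L2 f -> bmeas g -> L2 (fun x => f x * g x).
Proof.
move=> [mf f2] [mg [M gM]]; apply: (@L2_le _ (fun x => M * f x)).
- exact: measurable_funM.
- move=> x; rewrite mulrC !normrM ler_wpM2r// (le_trans (gM x))//.
  exact: ler_norm.
- by apply: L2Z; split.
Qed.

(** The quadratic form [(t, s) |-> mean ((t f + s g)^2)] is nonnegative; it is
    evaluated at its minimum. *)
Lemma I_CS f g : L2 f -> L2 g ->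
  I (fun x => f x * g x) ^+ 2 <= I (fun x => f x ^+ 2) * I (fun x => g x ^+ 2).
Proof.
move=> f2 g2.
set a := I (fun x => f x ^+ 2); set b := I (fun x => f x * g x).
set c := I (fun x => g x ^+ 2).
have quad t s : 0 <= t ^+ 2 * a + 2 * t * s * b + s ^+ 2 * c.
  have -> : t ^+ 2 * a + 2 * t * s * b + s ^+ 2 * c =
      I (fun x => (t * f x + s * g x) ^+ 2).
    have -> : (fun x => (t * f x + s * g x) ^+ 2) = (fun x =>
        t ^+ 2 * f x ^+ 2 + (2 * t * s) * (f x * g x) + s ^+ 2 * g x ^+ 2).
      by apply/funext => x; ring.
    rewrite ID; [|apply: L1D|]; try apply: L1Z; try exact: L2_sq;
      try exact: L2_mul.
    by rewrite ID ?IZ//; try apply: L1Z; try exact: L2_sq; exact: L2_mul.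
  by apply: I_ge0 => x; exact: sqr_ge0.
have a0 : 0 <= a by apply: I_ge0 => x; exact: sqr_ge0.
have [a00|a0'] := eqVneq a 0.
  have := quad 1 0; have := quad (- (c + 1) / 2) b; rewrite a00.
  have c0 : 0 <= c by apply: I_ge0 => x; exact: sqr_ge0.
  by have := sqr_ge0 b; nra.
have := quad (- b) a.
have -> : (- b) ^+ 2 * a + 2 * - b * a * b + a ^+ 2 * c = a * (a * c - b ^+ 2).
  by ring.
by rewrite pmulr_rge0 ?lt_neqAle ?a0 ?andbT 1?eq_sym// subr_ge0.
Qed.

Definition bker K := bmeas (fun p : T * T => K p.1 p.2).

Lemma bker_l K x : bker K -> bmeas (K x).
Proof. by move=> bK; exact: (bmeas_comp (pair1_measurable x) bK). Qed.

Lemma bkerT K : bker K -> bker (fun x y => K y x).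
Proof.
move=> bK; apply: (bmeas_comp _ bK (g := fun p : T * T => (p.2, p.1))).
exact: measurable_fun_pair.
Qed.

Definition kernel_op K f x := I (fun y => K x y * f y).

Lemma L1_ker K f x : bker K -> L1 f -> L1 (fun y => K x y * f y).
Proof.
by move=> bK f1; under eq_fun do rewrite mulrC; exact/L1M/bker_l.
Qed.

Lemma prod_integrable K f g : bker K -> L1 f -> L1 g ->
  (mu \x mu)%E.-integrable setT
    (EFin \o (fun p : T * T => g p.1 * (K p.1 p.2 * f p.2))).
Proof.
move=> [mK [M KM]] f1 g1.
have mf := L1_measurable f1; have mg := L1_measurable g1.
have m1 : measurable_fun setT (fun p : T * T => g p.1) by exact: measurableT_comp.
have m2 : measurable_fun setT (fun p : T * T => f p.2) by exact: measurableT_comp.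
apply/integrable12ltyP.
  by apply/measurable_EFinP; do 2! apply: measurable_funM => //.
have nf1 := L1_norm f1; have ng1 := L1_norm g1.
apply: (@le_lt_trans _ _ (\int[mu]_x (`|g x| * (M * I (fun y => `|f y|)))%:E)%E).
  apply: ge0_le_integral => //=.
  - by move=> x _; apply: integral_ge0 => y _.
  - apply: (measurable_fun_fubini_tonelli_F
      (fun p : T * T => (`|g p.1 * (K p.1 p.2 * f p.2)|)%:E)) => //.
    apply/measurable_EFinP; apply: measurableT_comp => //.
    by do 2! apply: measurable_funM => //.
  - apply/measurable_EFinP; apply: measurable_funM => //.
    exact: measurableT_comp.
  - move=> x _; rewrite EFinM -EFinM.
    apply: (@le_trans _ _ (\int[mu]_y (`|g x| * (M * `|f y|))%:E)%E).
      apply: ge0_le_integral => //=.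
      + apply/measurable_EFinP; apply: measurableT_comp => //.
        apply: measurable_funM => //; apply: measurable_funM => //.
        exact: (measurableT_comp mK (pair1_measurable x)).
      + apply/measurable_EFinP; do 2! apply: measurable_funM => //.
        exact: measurableT_comp.
      + move=> y _; rewrite lee_fin !normrM ler_wpM2l// ler_wpM2r//.
        exact: (KM (x, y)).
    rewrite IE; last exact/L1Z/L1Z.
    by rewrite !IZ//; exact: L1Z.
rewrite (_ : (fun x => _) = (fun x => (M * I (fun y => `|f y|) * `|g x|)%:E)).
  by rewrite IE ?ltry//; exact: L1Z.
by apply/funext => x; rewrite mulrC.
Qed.

Lemma op_bmeas K f : bker K -> L1 f -> bmeas (kernel_op K f).
Proof.
move=> bK f1; split.
  have := measurable_fubini_F (prod_integrable bK f1 (L1_cst 1)).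
  move=> mF; rewrite (_ : kernel_op K f = fun x => fine (fubini_F mu
    (EFin \o (fun p : T * T => 1 * (K p.1 p.2 * f p.2))) x)).
    by apply: (measurableT_comp _ mF).
  apply/funext => x; rewrite /kernel_op mean.unlock /Rintegral; congr fine.
  by apply: eq_integral => y _ /=; rewrite mul1r.
have [mK [M KM]] := bK.
exists (M * I (fun y => `|f y|)) => x.
apply: (le_trans (I_norm (L1_ker x bK f1))).
rewrite -IZ; last exact: L1_norm.
apply: I_le.
- exact/L1_norm/L1_ker.
- exact/L1Z/L1_norm.
- by move=> y; rewrite normrM ler_wpM2r//; exact: (KM (x, y)).
Qed.

Lemma op_fubini K f g : bker K -> L1 f -> L1 g ->
  I (fun x => g x * kernel_op K f x) = I (fun y => f y * kernel_op (fun x y => K y x) g y).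
Proof.
move=> bK f1 g1; have ip := prod_integrable bK f1 g1.
have bop := op_bmeas bK f1; have bop' := op_bmeas (bkerT bK) g1.
apply: EFin_inj; rewrite -!IE; try exact: L1M.
have := Fubini ip => /=.
have -> : (\int[mu]_x \int[mu]_y (g x * (K x y * f y))%:E)%E =
    (\int[mu]_x (g x * kernel_op K f x)%:E)%E.
  apply: eq_integral => x _; rewrite IE; last exact/L1Z/L1_ker.
  by rewrite IZ//; exact: L1_ker.
move=> ->; apply: eq_integral => y _.
rewrite (_ : (fun x => _) = (fun x => (f y * (K x y * g x))%:E)); last first.
  by apply/funext => x; congr EFin; ring.
rewrite IE; last exact/L1Z/(L1_ker y (bkerT bK)).
by rewrite IZ//; exact: (L1_ker y (bkerT bK)).
Qed.

Lemma opD K f g x : bker K -> L1 f -> L1 g ->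
  kernel_op K (fun y => f y + g y) x = kernel_op K f x + kernel_op K g x.
Proof.
move=> bK f1 g1; rewrite /kernel_op -ID; try exact: L1_ker.
by apply: eq_I => y; rewrite mulrDr.
Qed.

Lemma opB K f g x : bker K -> L1 f -> L1 g ->
  kernel_op K (fun y => f y - g y) x = kernel_op K f x - kernel_op K g x.
Proof.
move=> bK f1 g1; rewrite /kernel_op -IB; try exact: L1_ker.
by apply: eq_I => y; rewrite mulrBr.
Qed.

Lemma opZ K c f x : bker K -> L1 f -> kernel_op K (fun y => c * f y) x = c * kernel_op K f x.
Proof.
move=> bK f1; rewrite /kernel_op -IZ; last exact: L1_ker.
by apply: eq_I => y; rewrite mulrCA.
Qed.

End probability_space.

(** * The kernels and their Laplacian *)

Section kernel.
Context (R : realType).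
Local Notation S := (S2 R).
Local Notation V := 'rV[R]_3.
Implicit Types (a b v w : V) (f g h P : V -> R) (x y z : S).

Lemma dotE u v : dot u v = u 0 0 * v 0 0 + u 0 1 * v 0 1 + u 0 2 * v 0 2 :> R.
Proof. by rewrite /dot sum3. Qed.

Lemma dotC u v : dot u v = dot v u :> R.
Proof. by rewrite !dotE; ring. Qed.

Lemma dotNl u v : dot (- u) v = - dot u v :> R.
Proof. by rewrite /dot -sumrN; apply: eq_bigr => i _; rewrite mxE mulNr. Qed.

Lemma dotxx x : dot (val x) (val x) = 1.
Proof. exact/eqP/(valP x). Qed.

Lemma dot_rot a v i : dot a (rot i v) = - dot (rot i a) v.
Proof. by rewrite !dotE; elim/ord3P: i; rewrite ?rot0E ?rot1E ?rot2E !vec3E; ring. Qed.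

Lemma dot_rot_rot a v i : dot (rot i a) (rot i v) = dot a v - a 0 i * v 0 i.
Proof. by rewrite !dotE; elim/ord3P: i; rewrite ?rot0E ?rot1E ?rot2E !vec3E; ring. Qed.

Lemma sum_dot_rot_sqr a v :
  \sum_(i < 3) dot a (rot i v) ^+ 2 = dot a a * dot v v - dot a v ^+ 2.
Proof. by rewrite sum3 !dotE rot0E rot1E rot2E !vec3E; ring. Qed.

Lemma sum_dot_rot_rot a v : \sum_(i < 3) dot (rot i a) (rot i v) = 2 * dot a v.
Proof. by rewrite sum3 !dot_rot_rot !dotE; ring. Qed.

Lemma dot_le1 x y : -1 <= dot (val x) (val y) <= 1.
Proof.
have := dotxx x; have := dotxx y; rewrite !dotE.
move: (val x) (val y) => u v hv hu.
have := sqr_ge0 (u 0 0 - v 0 0); have := sqr_ge0 (u 0 0 + v 0 0).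
have := sqr_ge0 (u 0 1 - v 0 1); have := sqr_ge0 (u 0 1 + v 0 1).
have := sqr_ge0 (u 0 2 - v 0 2); have := sqr_ge0 (u 0 2 + v 0 2).
by move=> *; apply/andP; split; nra.
Qed.

Lemma C1_dot a : C1 (fun v => dot a v).
Proof.
rewrite (_ : (fun v => _) = (fun v => a 0 0 * v 0 0 + a 0 1 * v 0 1 + a 0 2 * v 0 2)).
  by apply: C1D; [apply: C1D|]; apply: C1M; [exact: C1_cst|exact: C1_coord|
    exact: C1_cst|exact: C1_coord|exact: C1_cst|exact: C1_coord].
by apply/funext => v; rewrite dotE.
Qed.

Lemma Rd_dot i a v : Rd i (fun v => dot a v) v = dot a (rot i v).
Proof.
rewrite (_ : (fun v => _) = (fun v => a 0 0 * v 0 0 + a 0 1 * v 0 1 + a 0 2 * v 0 2)).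
  have cc k := @C1_coord R k; have ck c := @C1_cst R c.
  have cm k := C1M (ck (a 0 k)) (cc k).
  rewrite (RdD i v (C1D (cm 0) (cm 1)) (cm 2)) (RdD i v (cm 0) (cm 1)).
  rewrite !(RdM i v (ck _) (cc _)).
  by rewrite !Rd_coord !Rd_cst !mulr0 !addr0 dotE.
by apply/funext => v'; rewrite dotE.
Qed.

Lemma C1X f n : C1 f -> C1 (fun v => f v ^+ n).
Proof.
move=> Cf; elim: n => [|n IH].
  rewrite (_ : (fun v => _) = cst 1); first exact: C1_cst.
  by apply/funext => v; rewrite expr0.
rewrite (_ : (fun v => _) = fun v => f v * f v ^+ n); first exact: C1M.
by apply/funext => v; rewrite exprS.
Qed.

Lemma RdX i f n v : C1 f ->
  Rd i (fun v => f v ^+ n) v = n%:R * f v ^+ n.-1 * Rd i f v.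
Proof.
move=> Cf; elim: n => [|n IH].
  rewrite (_ : (fun v => _) = cst 1); first by rewrite Rd_cst !mul0r.
  by apply/funext => w; rewrite expr0.
rewrite (_ : (fun v => _) = fun v => f v * f v ^+ n); last first.
  by apply/funext => w; rewrite exprS.
rewrite (RdM i v Cf (C1X n Cf)).
rewrite IH/=; case: n {IH} => [|n] /=; first by rewrite expr0; ring.
by rewrite -!natr1 exprS; ring.
Qed.

(** For unit vectors at angle [t] this is [cos (t / 2) ^ 2], which is also
    [1 - |a - v|^2 / 4]. *)
Definition cos2_half a v : R := (1 + dot a v) / 2.

Lemma C1_cos2_half a : C1 (cos2_half a).
Proof.
apply: C1M; last exact: C1_cst.
by apply: C1D; [exact: C1_cst|exact: C1_dot].
Qed.

Lemma Rd_cos2_half i a v : Rd i (cos2_half a) v = dot a (rot i v) / 2.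
Proof.
rewrite RdM; [|apply: C1D; [exact: C1_cst|exact: C1_dot]|exact: C1_cst].
rewrite RdD; [|exact: C1_cst|exact: C1_dot].
by rewrite Rd_dot !(Rd_cst i) mulr0 !add0r mulrC.
Qed.

(** For [a] and [v] on the sphere and away from the pole, this is [1 / (n+1)]
    times the squared modulus of the kernel of the ensemble with [n+1] points.
    It is a probability density in each variable. *)
Definition kfun n a v : R := n.+1%:R * cos2_half a v ^+ n.

Definition kd n a v : R := (n.+2%:R * n.+1%:R / 2) * cos2_half a v ^+ n.

(** The derivative of [kfun n.+1 a] along the [i]-th rotation, see [Rd_kfun],
    in a form where the antisymmetry in [a] and [v] is visible. *)
Definition rkfun n i a v : R := kd n a v * dot a (rot i v).

Lemma kfun_sym n a v : kfun n a v = kfun n v a.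
Proof. by rewrite /kfun /cos2_half dotC. Qed.

Lemma rkfun_antisym n i a v : rkfun n i a v = - rkfun n i v a.
Proof. by rewrite /rkfun /kd /cos2_half (dotC a v) (dot_rot a) (dotC (rot i a)) mulrN. Qed.

Lemma C1_kfun n a : C1 (kfun n a).
Proof. by apply: C1M; [exact: C1_cst|apply: C1X; exact: C1_cos2_half]. Qed.

Lemma C1_kd n a : C1 (kd n a).
Proof. by apply: C1M; [exact: C1_cst|apply: C1X; exact: C1_cos2_half]. Qed.

Lemma rkfunE n i a : rkfun n i a = fun v => kd n a v * dot (- rot i a) v.
Proof.
by apply/funext => v; rewrite /rkfun dot_rot dotNl.
Qed.

Lemma C1_rkfun n i a : C1 (rkfun n i a).
Proof. by rewrite rkfunE; apply: C1M; [exact: C1_kd|exact: C1_dot]. Qed.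

Lemma Rd_kfun n i a v : Rd i (kfun n.+1 a) v = rkfun n i a v.
Proof.
rewrite RdM; [|exact: C1_cst|apply: C1X; exact: C1_cos2_half].
rewrite (Rd_cst i) mulr0 addr0 RdX; last exact: C1_cos2_half.
by rewrite Rd_cos2_half /rkfun /kd /=; field.
Qed.

(** The spherical Laplacian of [kfun n.+1 a]. *)
Definition lapk n a v : R := \sum_(i < 3) Rd i (rkfun n i a) v.

(** The recursion behind the whole proof.  With [c = cos2_half a v] one has
    [\sum_i (a . (e_i x v))^2 = 1 - (a . v)^2 = 4 c (1 - c)] and
    [\sum_i (e_i x a) . (e_i x v) = 2 (a . v)], so the Laplacian of a power of
    [c] is a combination of that power and the previous one. *)
Lemma lapkE n a v : dot a a = 1 -> dot v v = 1 ->
  lapk n a v = n.+2%:R * n.+1%:R * (kfun n a v - kfun n.+1 a v).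
Proof.
move=> a1 v1.
have E i : Rd i (rkfun n i a) v = n.+2%:R * n.+1%:R / 4 * (n%:R * cos2_half a v ^+ n.-1) *
    dot a (rot i v) ^+ 2 - kd n a v * dot (rot i a) (rot i v).
  rewrite rkfunE RdM; [|exact: C1_kd|exact: C1_dot].
  rewrite Rd_dot RdM; [|exact: C1_cst|apply: C1X; exact: C1_cos2_half].
  rewrite (Rd_cst i) mulr0 addr0 RdX; last exact: C1_cos2_half.
  rewrite Rd_cos2_half.
  by rewrite !dotNl -(dot_rot a v); field.
rewrite /lapk (eq_bigr _ (fun i _ => E i)) big_split/= -mulr_sumr sumrN -mulr_sumr.
rewrite sum_dot_rot_sqr sum_dot_rot_rot a1 v1 /kd /kfun.
have -> : dot a v = 2 * cos2_half a v - 1 by rewrite /cos2_half; field.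
case: n {E} => [|n] /=; first by rewrite !expr0 expr1; field.
by rewrite -!natr1 !exprS; field.
Qed.

Definition kn n x y : R := kfun n (val x) (val y).
Definition rk n i x y : R := rkfun n i (val x) (val y).
Definition lk n x y : R := lapk n (val x) (val y).

Lemma knC n x y : kn n x y = kn n y x.
Proof. exact: kfun_sym. Qed.

Lemma rkC n i x y : rk n i x y = - rk n i y x.
Proof. exact: rkfun_antisym. Qed.

Lemma lkE n x y : lk n x y = n.+2%:R * n.+1%:R * (kn n x y - kn n.+1 x y).
Proof. by rewrite /lk lapkE// dotxx. Qed.

Lemma cos2_half_ge0 x y : 0 <= cos2_half (val x) (val y).
Proof. by have := dot_le1 x y; rewrite /cos2_half => /andP[]; lra. Qed.

Lemma cos2_half_le1 x y : cos2_half (val x) (val y) <= 1.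
Proof. by have := dot_le1 x y; rewrite /cos2_half => /andP[]; lra. Qed.

Lemma kn_ge0 n x y : 0 <= kn n x y.
Proof. by rewrite mulr_ge0// exprn_ge0// cos2_half_ge0. Qed.

Lemma kn_le n x y : kn n x y <= n.+1%:R.
Proof. by rewrite ler_piMr// exprn_ile1// ?cos2_half_ge0 ?cos2_half_le1. Qed.

Lemma bker_coord1 i : bker (fun x (y : S) => val x 0 i).
Proof. exact: (bmeas_comp measurable_fst (bmeas_coord _ i)). Qed.

Lemma bker_coord2 i : bker (fun (x : S) y => val y 0 i).
Proof. exact: (bmeas_comp measurable_snd (bmeas_coord _ i)). Qed.

Lemma bker_dot : bker (fun x y : S => dot (val x) (val y)).
Proof.
apply: bmeas_sum => i.
by apply: bmeasM; [exact: bker_coord1|exact: bker_coord2].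
Qed.

Lemma bker_cos2_half : bker (fun x y => cos2_half (val x) (val y)).
Proof.
apply: bmeasM; last exact: bmeas_cst.
by apply: bmeasD; [exact: bmeas_cst|exact: bker_dot].
Qed.

Lemma bker_kn n : bker (kn n).
Proof. by apply: bmeasM; [exact: bmeas_cst|apply: bmeasX; exact: bker_cos2_half]. Qed.

Lemma bker_rk n i : bker (rk n i).
Proof.
apply: bmeasM; first by apply: bmeasM; [exact: bmeas_cst|apply: bmeasX; exact: bker_cos2_half].
have b12 j k : bmeas (fun p : S * S => val p.1 0 j * val p.2 0 k).
  by apply: bmeasM; [exact: bker_coord1|exact: bker_coord2].
have E (c1 c2 : S * S -> R) : bmeas c1 -> bmeas c2 ->
    (fun p : S * S => dot (val p.1) (rot i (val p.2))) = (fun p => c1 p - c2 p) ->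
    bmeas (fun p : S * S => dot (val p.1) (rot i (val p.2))).
  by move=> b1 b2 ->; exact: bmeasB.
elim/ord3P : i E => E.
- apply: (E _ _ (b12 2 1) (b12 1 2)).
  by apply/funext => p; rewrite dotE rot0E !vec3E; ring.
- apply: (E _ _ (b12 0 2) (b12 2 0)).
  by apply/funext => p; rewrite dotE rot1E !vec3E; ring.
- apply: (E _ _ (b12 1 0) (b12 0 1)).
  by apply/funext => p; rewrite dotE rot2E !vec3E; ring.
Qed.

Lemma bmeas_C1 h : C1 h -> bmeas (fun x : S => h (val x)).
Proof. by move=> Ch; apply: bmeas_continuous; exact: C1_continuous. Qed.

Lemma bmeas_Rd i h : C1 h -> bmeas (fun x : S => Rd i h (val x)).
Proof. by move=> Ch; apply: bmeas_continuous; exact: Rd_continuous. Qed.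

Local Notation I := (mean (@sigma R)).
Local Notation L1 := (is_L1 (@sigma R)).
Local Notation L2 := (is_L2 (@sigma R)).
Local Notation op := (kernel_op (@sigma R)).

Lemma I_Rd i h : C1 h -> I (fun x => Rd i h (val x)) = 0.
Proof.
by move=> Ch; rewrite mean.unlock /Rintegral integral_Rd.
Qed.

Lemma I_ibp i g h : C1 g -> C1 h ->
  I (fun x => g (val x) * Rd i h (val x)) = - I (fun x => h (val x) * Rd i g (val x)).
Proof.
move=> Cg Ch; apply/eqP; rewrite -addr_eq0 -ID.
- rewrite -(I_Rd i (C1M Cg Ch)); apply/eqP; apply: eq_I => x.
  by rewrite RdM.
- by apply: L1_bmeas; apply: bmeasM; [exact: bmeas_C1|exact: bmeas_Rd].
- by apply: L1_bmeas; apply: bmeasM; [exact: bmeas_C1|exact: bmeas_Rd].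
Qed.

(** Induction on [n]: the Laplacian integrates to zero, and it is a nonzero
    multiple of the difference of two consecutive kernels. *)
Lemma I_kn n x : I (kn n x) = 1.
Proof.
elim: n => [|n IH].
  rewrite -(I_cst (@sigma R) 1); apply: eq_I => y.
  by rewrite /kn /kfun expr0 mulr1.
have b k : L1 (kn k x) by apply: L1_bmeas; exact/bker_l/bker_kn.
have : I (lk n x) = 0.
  rewrite /lk /lapk I_sum.
    by apply: big1 => i _; rewrite (I_Rd i (C1_rkfun n i (val x))).
  move=> i; apply: L1_bmeas; apply: bmeas_Rd; exact: C1_rkfun.
rewrite (eq_I _ (fun y => lkE n x y)) IZ; last exact: L1B.
rewrite IB// IH => /eqP; rewrite !mulf_eq0 !pnatr_eq0/= subr_eq0.
by move=> /eqP.
Qed.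

(** The Laplacian is symmetric: one integration by parts on each side gives
    minus the integral of the product of the two gradients. *)
Lemma I_lk_kn n m x y :
  I (fun z => lk n x z * kn m.+1 y z) = I (fun z => kn n.+1 x z * lk m y z).
Proof.
have E k l (a b : S) : I (fun z => lk k a z * kn l b z) =
    \sum_(i < 3) I (fun z => kfun l (val b) (val z) * Rd i (rkfun k i (val a)) (val z)).
  rewrite -I_sum; last first.
    by move=> i; apply: L1_bmeas; apply: bmeasM;
      [exact/bmeas_C1/C1_kfun|exact/bmeas_Rd/C1_rkfun].
  apply: eq_I => z; rewrite /lk /lapk mulr_suml.
  by apply: eq_bigr => i _; rewrite mulrC.
rewrite E [RHS](_ : _ = I (fun z => lk m y z * kn n.+1 x z)); last first.
  by apply: eq_I => z; rewrite mulrC.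
rewrite E; apply: eq_bigr => i _.
apply: (etrans (I_ibp i (C1_kfun m.+1 (val y)) (C1_rkfun n i (val x)))).
apply: (etrans _ (esym (I_ibp i (C1_kfun n.+1 (val x)) (C1_rkfun m i (val y))))).
apply: (congr1 -%R).
by apply: eq_I => z; rewrite !Rd_kfun mulrC.
Qed.

(** The kernel of the composite of two of the operators. *)
Definition conv n m x y : R := I (fun z => kn n x z * kn m y z).

Lemma conv_rec n m x y :
  n.+2%:R * n.+1%:R * (conv n m.+1 x y - conv n.+1 m.+1 x y) =
  m.+2%:R * m.+1%:R * (conv n.+1 m x y - conv n.+1 m.+1 x y).
Proof.
have b k l (a b : S) : L1 (fun z => kn k a z * kn l b z).
  by apply: L1_bmeas; apply: bmeasM; exact/bker_l/bker_kn.
have := I_lk_kn n m x y.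
rewrite (eq_I _ (g := fun z => n.+2%:R * n.+1%:R *
  (kn n x z * kn m.+1 y z - kn n.+1 x z * kn m.+1 y z))); last first.
  by move=> z; rewrite lkE; ring.
rewrite [RHS](eq_I _ (g := fun z => m.+2%:R * m.+1%:R *
  (kn n.+1 x z * kn m y z - kn n.+1 x z * kn m.+1 y z))); last first.
  by move=> z; rewrite lkE; ring.
by rewrite !IZ ?IB//; exact: L1B.
Qed.

(** Induction on the index sum.  The recursion at [(n, m)] and at [(m, n)]
    determines [conv n.+1 m.+1] and [conv m.+1 n.+1] from the same two kernels of
    smaller index sum, because the factors [(n+2)(n+1)] and [(m+2)(m+1)] differ
    when [n] and [m] do. *)
Lemma convC n m x y : conv n m x y = conv m n x y.
Proof.
have [k] := ubnP (n + m); elim: k n m => // k IH [|n] [|m] // nmk.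
- rewrite /conv (eq_I _ (g := kn m.+1 y)); last first.
    by move=> z; rewrite /kn /kfun expr0 !mul1r.
  rewrite [RHS](eq_I _ (g := kn m.+1 x)) ?I_kn// => z.
  by rewrite /kn /kfun expr0 !mulr1.
- rewrite /conv (eq_I _ (g := kn n.+1 x)); last first.
    by move=> z; rewrite /kn /kfun expr0 !mulr1.
  rewrite [RHS](eq_I _ (g := kn n.+1 y)) ?I_kn// => z.
  by rewrite /kn /kfun expr0 !mul1r.
have [->//|nm] := eqVneq n m.
have := conv_rec n m x y; have := conv_rec m n x y.
rewrite (IH m n.+1); last by move: nmk; lia.
rewrite (IH m.+1 n); last by move: nmk; lia.
set p : R := n.+2%:R * n.+1%:R; set q : R := m.+2%:R * m.+1%:R.
have pq : p - q != 0.
  rewrite subr_eq0 /p /q -!natrM eqr_nat; apply/eqP => e.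
  by move/eqP: nm; apply; nia.
move=> h1 h2; apply: (mulfI pq); lra.
Qed.

Local Notation T n := (op (kn n)).

Lemma T_comm n m (f : S -> R) x : L1 f -> T n (T m f) x = T m (T n f) x.
Proof.
move=> f1.
have E k l : T k (T l f) x = I (fun y => f y * conv k l x y).
  rewrite [LHS](op_fubini (bker_kn l) f1); last first.
    by apply: L1_bmeas; exact/bker_l/bker_kn.
  apply: eq_I => y; congr (_ * _); apply: eq_I => z.
  by rewrite mulrC (knC l).
by rewrite !E; apply: eq_I => y; rewrite convC.
Qed.

End kernel.

(** * The Dirichlet forms *)

Section quadratic_form.
Context (R : realType).
Local Notation S := (S2 R).
Local Notation I := (mean (@sigma R)).
Local Notation L1 := (is_L1 (@sigma R)).
Local Notation L2 := (is_L2 (@sigma R)).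
Local Notation op := (kernel_op (@sigma R)).
Local Notation T n := (op (kn n)).
Implicit Types (f g h : S -> R) (n m : nat).

Lemma T_bmeas n f : L1 f -> bmeas (T n f).
Proof. by move=> f1; apply: op_bmeas => //; exact: bker_kn. Qed.

Lemma T_L2 n f : L2 f -> L2 (T n f).
Proof. by move=> f2; exact/L2_bmeas/T_bmeas/L2_L1. Qed.

Lemma T_sym n f g : L1 f -> L1 g -> I (fun x => g x * T n f x) = I (fun x => f x * T n g x).
Proof.
move=> f1 g1; rewrite op_fubini//; last exact: bker_kn.
apply: eq_I => x; congr (_ * _); apply: eq_I => y.
by rewrite knC.
Qed.

Lemma T_cst n c x : T n (fun=> c) x = c.
Proof.
rewrite -[RHS]mulr1 -(I_kn n x) -IZ; last exact/L1_bmeas/bker_l/bker_kn.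
by apply: eq_I => y; rewrite mulrC.
Qed.

Lemma I_T n f : L1 f -> I (T n f) = I f.
Proof.
move=> f1; have := @T_sym n f (fun=> 1) f1 (L1_cst _ _).
rewrite (eq_I _ (g := T n f)); last by move=> x; rewrite mul1r.
by move=> ->; apply: eq_I => x; rewrite T_cst mulr1.
Qed.

Lemma T_sqr n f x : L2 f -> T n f x ^+ 2 <= T n (fun y => f y ^+ 2) x.
Proof.
move=> f2; set t := T n f x.
have f1 := L2_L1 f2; have ff1 := L2_sq f2.
have : 0 <= T n (fun y => f y ^+ 2 - 2 * t * f y + t ^+ 2) x.
  apply: I_ge0 => y; rewrite mulr_ge0 ?kn_ge0//.
  by have := sqr_ge0 (f y - t); rewrite (_ : (_ - t) ^+ 2 = f y ^+ 2 - 2 * t * f y + t ^+ 2)//; ring.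
rewrite opD ?opB ?opZ ?T_cst//; try exact: bker_kn; try exact: L1_cst.
- by rewrite -/t; lra.
- exact: L1Z.
- by apply: L1B => //; exact: L1Z.
Qed.

Lemma T_contraction n f : L2 f ->
  I (fun x => T n f x ^+ 2) <= I (fun x => f x ^+ 2).
Proof.
move=> f2; rewrite -(I_T n (L2_sq f2)); apply: I_le.
- exact/L2_sq/T_L2.
- by apply: L1_bmeas; apply: T_bmeas; exact: L2_sq.
- by move=> x; exact: T_sqr.
Qed.

(** The Dirichlet form of the Markov operator [T n], polarized; [qform] is its
    diagonal. *)
Definition dform n f g : R := I (fun x => f x * g x) - I (fun x => f x * T n g x).
Definition qform n f : R := dform n f f.

Lemma L1_fT n f g : L2 f -> L2 g -> L1 (fun x => f x * T n g x).
Proof. by move=> f2 g2; apply: L2_mul => //; exact: T_L2. Qed.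

Lemma dform_sym n f g : L2 f -> L2 g -> dform n f g = dform n g f.
Proof.
move=> f2 g2; rewrite /dform (T_sym n (L2_L1 g2) (L2_L1 f2)); congr (_ - _).
by apply: eq_I => x; rewrite mulrC.
Qed.

Lemma dform_lin n f g h a b : L2 f -> L2 g -> L2 h ->
  dform n f (fun x => a * g x + b * h x) = a * dform n f g + b * dform n f h.
Proof.
move=> f2 g2 h2.
have g1 := L2_L1 g2; have h1 := L2_L1 h2.
rewrite /dform (eq_I _ (g := fun x => a * (f x * g x) + b * (f x * h x))); last first.
  by move=> x; ring.
rewrite (eq_I _ (f := fun x => f x * T n _ x)
  (g := fun x => a * (f x * T n g x) + b * (f x * T n h x))); last first.
  move=> x; rewrite opD ?opZ//; try exact: bker_kn; try exact: L1Z.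
  by ring.
rewrite !ID ?IZ; try exact: L2_mul; try exact: L1_fT; try (apply: L1Z; exact: L2_mul);
  try (apply: L1Z; exact: L1_fT).
by ring.
Qed.

Lemma qform_innerE n f x : L2 f -> I (fun y => kn n x y * (f x - f y) ^+ 2) =
  f x ^+ 2 - 2 * (f x * T n f x) + T n (fun y => f y ^+ 2) x.
Proof.
move=> f2; have f1 := L2_L1 f2; have ff1 := L2_sq f2.
rewrite -[LHS]/(T n (fun y => (f x - f y) ^+ 2) x).
have -> : (fun y => (f x - f y) ^+ 2) =
    (fun y => f x ^+ 2 - 2 * f x * f y + f y ^+ 2) by apply/funext => y; ring.
rewrite opD ?opB ?opZ ?T_cst//; try exact: bker_kn; try exact: L1_cst;
  try exact: L1Z.
- by ring.
- by apply: L1B; [exact: L1_cst|exact: L1Z].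
Qed.

Lemma qform_inner_L1 n f : L2 f ->
  L1 (fun x => I (fun y => kn n x y * (f x - f y) ^+ 2)).
Proof.
move=> f2; under eq_fun do rewrite qform_innerE//.
apply: L1D; last by apply: L1_bmeas; apply: T_bmeas; exact: L2_sq.
by apply: L1B; [exact: L2_sq|apply: L1Z; exact: L1_fT].
Qed.

Lemma kn_sqr_L1 n f x : L2 f -> L1 (fun y => kn n x y * (f x - f y) ^+ 2).
Proof.
move=> f2; apply: L1_ker; first exact: bker_kn.
by apply: L2_sq; apply: L2B => //; exact/L2_bmeas/bmeas_cst.
Qed.

(** The usual representation of a Dirichlet form as a mean squared increment,
    from which positivity and the contraction property follow. *)
Lemma qform_double n f : L2 f ->
  2 * qform n f = I (fun x => I (fun y => kn n x y * (f x - f y) ^+ 2)).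
Proof.
move=> f2; have ff1 := L2_sq f2.
rewrite (eq_I _ (fun x => qform_innerE n x f2)).
rewrite ID ?IB ?IZ ?I_T//; try exact: L1_fT; try (apply: L1Z; exact: L1_fT).
- by rewrite /qform /dform; under eq_fun do rewrite -expr2; ring.
- by apply: L1B => //; apply: L1Z; exact: L1_fT.
- by apply: L1_bmeas; exact: T_bmeas.
Qed.

Lemma qform_ge0 n f : L2 f -> 0 <= qform n f.
Proof.
move=> f2; have := qform_double n f2 => e.
have : 0 <= 2 * qform n f.
  rewrite e; apply: I_ge0 => x; apply: I_ge0 => y.
  by rewrite mulr_ge0 ?kn_ge0 ?sqr_ge0.
by lra.
Qed.

Lemma qform_lin n f g a b : L2 f -> L2 g ->
  qform n (fun x => a * f x + b * g x) =
  a ^+ 2 * qform n f + 2 * a * b * dform n f g + b ^+ 2 * qform n g.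
Proof.
move=> f2 g2.
have fg2 : L2 (fun x => a * f x + b * g x) by apply: L2D; exact: L2Z.
rewrite /qform dform_lin// dform_sym// dform_lin// (dform_sym n fg2)// dform_lin// (dform_sym n g2 f2).
by ring.
Qed.

Lemma dform_CS n f g : L2 f -> L2 g -> dform n f g ^+ 2 <= qform n f * qform n g.
Proof.
move=> f2 g2.
have quad a b : 0 <= a ^+ 2 * qform n f + 2 * a * b * dform n f g + b ^+ 2 * qform n g.
  by rewrite -qform_lin//; apply: qform_ge0; apply: L2D; exact: L2Z.
have qf := qform_ge0 n f2; have qg := qform_ge0 n g2.
have [f0|f0] := eqVneq (qform n f) 0.
  have := quad (- (qform n g + 1) / 2) (dform n f g); rewrite f0.
  by have := sqr_ge0 (dform n f g); nra.
have := quad (- dform n f g) (qform n f).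
rewrite (_ : _ + _ = qform n f * (qform n f * qform n g - dform n f g ^+ 2)); last by ring.
by rewrite pmulr_rge0 ?lt_neqAle ?qf ?andbT 1?eq_sym// subr_ge0.
Qed.

Lemma qform_le n f : L2 f -> qform n f <= 2 * I (fun x => f x ^+ 2).
Proof.
move=> f2; have := I_CS f2 (T_L2 n f2); have := T_contraction n f2.
have ffE : I (fun x => f x * f x) = I (fun x => f x ^+ 2).
  by apply: eq_I => x; rewrite expr2.
rewrite /qform /dform ffE.
set a := I (fun x => f x ^+ 2); set b := I _; set c := I (fun x => f x * _).
have a0 : 0 <= a by apply: I_ge0 => x; exact: sqr_ge0.
have b0 : 0 <= b by apply: I_ge0 => x; exact: sqr_ge0.
by move=> ba; nra.
Qed.

(** [T m] is symmetric and commutes with [T n]. *)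
Lemma dform_T n m f g : L2 f -> L2 g -> dform n (T m f) g = dform n f (T m g).
Proof.
move=> f2 g2.
have f1 := L2_L1 f2; have g1 := L2_L1 g2.
have Tg1 k : L1 (T k g) by exact/L2_L1/T_L2.
rewrite /dform; congr (_ - _).
  rewrite [RHS](T_sym m g1 f1); apply: eq_I => x; exact: mulrC.
rewrite (eq_I _ (g := fun x => T n g x * T m f x)); last by move=> x; exact: mulrC.
rewrite (T_sym m f1 (Tg1 n)); apply: eq_I => x.
by rewrite (T_comm n m x g1).
Qed.

(** Reid's inequality.  The sequence [F j = qform n (T_m^j f)] satisfies
    [F (j+1)^2 <= F j * F (j+2)] by the Cauchy-Schwarz inequality for [dform],
    and it is bounded because [T m] is a contraction.  A log-convex sequence
    whose first increment is positive would grow at least linearly. *)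
Lemma qform_T n m f : L2 f -> qform n (T m f) <= qform n f.
Proof.
move=> f2.
pose g j := iter j (T m) f.
have g2 j : L2 (g j) by elim: j => //= j IH; exact: T_L2.
pose F j := qform n (g j).
have F0 j : 0 <= F j by exact: qform_ge0.
have Fconv j : F j.+1 ^+ 2 <= F j * F j.+2.
  have -> : F j.+1 = dform n (g j) (g j.+2).
    by rewrite -[g j.+2]/(T m (g j.+1)) -dform_T.
  exact: dform_CS.
have Fbnd j : F j <= 2 * I (fun x => f x ^+ 2).
  apply: (le_trans (qform_le n (g2 j))); rewrite ler_pM2l//.
  elim: j => //= j IH; apply: le_trans IH; exact: T_contraction.
rewrite -[qform n (T m f)]/(F 1) -[qform n f]/(F 0); rewrite leNgt; apply/negP => F01.
have Fp j : 0 < F j /\ F j.+1 - F j >= F 1 - F 0.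
  elim: j => [|j [Fj dF]].
    split; last by [].
    rewrite lt_neqAle F0 andbT eq_sym; apply/eqP => F00.
    by have := Fconv 0; rewrite F00 mul0r; have := F0 1; rewrite F00 in F01; nra.
  have Fj1 : 0 < F j.+1 by lra.
  split=> //.
  by have := Fconv j; nra.
have Flin j : F j >= j%:R * (F 1 - F 0).
  elim: j => [|j IH]; first by rewrite mul0r.
  by have [_ dF] := Fp j; rewrite -natr1; lra.
set B := 2 * I (fun x => f x ^+ 2).
have d0 : 0 < F 1 - F 0 by lra.
have := Flin (Num.bound (B / (F 1 - F 0))).
have B0 : 0 <= B / (F 1 - F 0).
  by rewrite divr_ge0 ?(ltW d0)// mulr_ge0//; apply: I_ge0 => x; exact: sqr_ge0.
have := archi_boundP B0; rewrite ltr_pdivrMr// => h1 h2.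
by have := Fbnd (Num.bound (B / (F 1 - F 0))); rewrite -/B; lra.
Qed.

Lemma qform_D2 n f g : L2 f -> L2 g ->
  qform n (fun x => f x + g x) <= 2 * qform n f + 2 * qform n g.
Proof.
move=> f2 g2.
have e1 := qform_lin n 1 1 f2 g2; have e2 := qform_lin n 1 (-1) f2 g2.
have : 0 <= qform n (fun x => 1 * f x + -1 * g x).
  by apply: qform_ge0; apply: L2D; exact: L2Z.
rewrite e2; move: e1.
rewrite (_ : (fun x => _) = (fun x => f x + g x)); last first.
  by apply/funext => x; rewrite !mul1r.
by move=> ->; lra.
Qed.

End quadratic_form.

(** * Strong convergence to the identity *)

Section dominated.
Context d (T : measurableType d) (R : realType) (mu : probability T R).
Local Notation I := (mean mu).
Local Notation L1 := (is_L1 mu).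
Local Notation L2 := (is_L2 mu).

(** Convergence to 0 with explicit thresholds, which is the form in which
    indices are chosen below. *)
Definition vanishes (u : nat -> R) := forall e, 0 < e ->
  exists n0, forall n, (n0 <= n)%N -> `|u n| <= e.

Lemma cvg_vanishes (u : nat -> R) : u n @[n --> \oo] --> (0 : R) -> vanishes u.
Proof.
move=> /cvgrPdist_le u0 e e0; have [n0 _ un0] := u0 _ e0.
by exists n0 => n n0n; have := un0 n n0n; rewrite sub0r normrN.
Qed.

Lemma I_dct (g : nat -> T -> R) (f h : T -> R) :
  (forall n, measurable_fun setT (g n)) ->
  (forall x, g n x @[n --> \oo] --> f x) ->
  (forall n x, `|g n x| <= h x) -> L1 h ->
  L1 f /\ vanishes (fun n => I (g n) - I f).
Proof.
move=> mg gf gh h1.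
have mf : measurable_fun setT f.
  by apply: (measurable_fun_cvg mg) => x _; exact: gf.
have [] := @dominated_convergence _ _ _ mu setT measurableT
  (fun n x => (g n x)%:E) (EFin \o f) (EFin \o h).
- by move=> n; exact/measurable_EFinP.
- exact/measurable_EFinP.
- by apply: aeW => x _; apply/fine_cvgP; split; [exact: nearW|exact: gf].
- exact: h1.
- by apply: aeW => x n _; rewrite lee_fin.
move=> f1 _ gI; split; first exact: f1.
have g1 n : L1 (g n) by apply: L1_le h1.
apply: cvg_vanishes; rewrite -(subrr (I f)); apply: cvgB; last exact: cvg_cst.
move: gI; rewrite (_ : (fun n => _) = (fun n => (I (g n))%:E)); last first.
  by apply/funext => n; rewrite /= IE.
by rewrite [X in _ --> X -> _](IE f1) => /fine_cvgP[].
Qed.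

Lemma I_dct2 (g : nat -> T -> R) (f h : T -> R) :
  (forall n, measurable_fun setT (g n)) ->
  (forall x, g n x @[n --> \oo] --> f x) ->
  (forall n x, `|g n x| <= h x) -> L2 h ->
  L2 f /\ vanishes (fun n => I (fun x => (g n x - f x) ^+ 2)).
Proof.
move=> mg gf gh h2.
have mf : measurable_fun setT f.
  by apply: (measurable_fun_cvg mg) => x _; exact: gf.
have fh x : `|f x| <= h x.
  have nf : `|g n x| @[n --> \oo] --> `|f x| by apply: cvg_norm; exact: gf.
  by apply: (cvgr_to_le nf); exact: nearW.
have f2 : L2 f.
  by apply: (L2_le mf _ h2) => x; rewrite (le_trans (fh x))// ler_norm.
split => //.
have [] := @I_dct (fun n x => (g n x - f x) ^+ 2) (fun=> 0)
  (fun x => 4 * h x ^+ 2).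
- by move=> n; apply: measurable_funX; exact: measurable_funB.
- move=> x; have cB : g n x - f x @[n --> \oo] --> (0 : R).
    by rewrite -(subrr (f x)); apply: cvgB; [exact: gf|exact: cvg_cst].
  rewrite (_ : (fun n => _) = (fun n => (g n x - f x) * (g n x - f x))).
    by rewrite -[X in _ --> X](mulr0 (0 : R)); exact: cvgM.
  by apply/funext => n; rewrite expr2.
- move=> n x; rewrite ger0_norm ?sqr_ge0//.
  have := gh n x; have := fh x; rewrite !ler_norml => /andP[? ?] /andP[? ?].
  nra.
- by apply: L1Z; exact: L2_sq.
by move=> _; rewrite I_cst; under eq_fun do rewrite subr0.
Qed.

End dominated.

Section approximate_identity.
Context (R : realType).
Local Notation S := (S2 R).
Local Notation I := (mean (@sigma R)).
Local Notation L1 := (is_L1 (@sigma R)).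
Local Notation L2 := (is_L2 (@sigma R)).
Local Notation op := (kernel_op (@sigma R)).
Local Notation T n := (op (kn n)).
Implicit Types (f g h : S -> R) (n m : nat).

(** Strong convergence of [T n] to the identity is only ever needed as the
    decay of the Dirichlet forms.  This class is a vector space closed under
    dominated limits; the coordinates belong to it, hence the indicators of
    measurable sets, hence all of L2. *)
Definition qnull f := L2 f /\ vanishes (fun n => qform n f).

Lemma qnull_lin a b f g : qnull f -> qnull g ->
  qnull (fun x => a * f x + b * g x).
Proof.
move=> [f2 qf] [g2 qg].
have af2 := L2Z a f2; have bg2 := L2Z b g2.
split; first exact: L2D.
move=> e e0.
have ea : 0 < e / (4 * (a ^+ 2 + 1)).
  by rewrite divr_gt0// mulr_gt0// ltr_wpDl ?sqr_ge0.
have eb : 0 < e / (4 * (b ^+ 2 + 1)).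
  by rewrite divr_gt0// mulr_gt0// ltr_wpDl ?sqr_ge0.
have [n1 h1] := qf _ ea; have [n2 h2] := qg _ eb.
exists (maxn n1 n2) => n; rewrite geq_max => /andP[n1n n2n].
have {h1} := h1 n n1n; have {h2} := h2 n n2n.
have q0 := qform_ge0 n f2; have q1 := qform_ge0 n g2.
rewrite !ger0_norm ?qform_ge0//; last exact: L2D.
rewrite ler_pdivlMr ?mulr_gt0 ?ltr_wpDl ?sqr_ge0// => h2.
rewrite ler_pdivlMr ?mulr_gt0 ?ltr_wpDl ?sqr_ge0// => h1.
apply: (le_trans (qform_D2 n af2 bg2)).
have E c k : L2 k -> qform n (fun x => c * k x) = c ^+ 2 * qform n k.
  move=> k2; have := qform_lin n c 0 k2 k2.
  rewrite (_ : (fun x => c * k x + 0 * k x) = (fun x => c * k x)).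
    by move=> ->; ring.
  by apply/funext => x; rewrite mul0r addr0.
rewrite !E//; have := sqr_ge0 a; have := sqr_ge0 b; nra.
Qed.

(** The forms are bounded by twice the squared norm, uniformly in [n], so the
    class is closed in L2. *)
Lemma qnull_close f : L2 f ->
  (forall e, 0 < e -> exists2 g, qnull g & I (fun x => (g x - f x) ^+ 2) <= e) ->
  qnull f.
Proof.
move=> f2 fg; split => // e e0.
have e8 : 0 < e / 8 by rewrite divr_gt0.
have e4 : 0 < e / 4 by rewrite divr_gt0.
have [g [g2 qg] gfe] := fg _ e8.
have [n0 gn0] := qg _ e4; exists n0 => n /gn0.
rewrite !ger0_norm ?qform_ge0// => gn.
have d2 : L2 (fun x => g x - f x) by exact: L2B.
have d2' : L2 (fun x => -1 * (g x - f x)) by exact: L2Z.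
have fE : (fun x => g x + -1 * (g x - f x)) = f by apply/funext => x; ring.
have dE : (fun x => (-1 * (g x - f x)) ^+ 2) = (fun x => (g x - f x) ^+ 2).
  by apply/funext => x; ring.
have := qform_D2 n g2 d2'; have := qform_le n d2'; rewrite fE dE.
by lra.
Qed.

Lemma qnull_dct (g : nat -> S -> R) f h : (forall n, qnull (g n)) ->
  (forall x, g n x @[n --> \oo] --> f x) ->
  (forall n x, `|g n x| <= h x) -> L2 h -> qnull f.
Proof.
move=> qg gf gh h2.
have [|f2 gf0] := @I_dct2 _ _ _ (@sigma R) g f h _ gf gh h2.
  by move=> n; case: (qg n) => /L2_measurable.
apply: qnull_close => // e /gf0[n0 /(_ n0 (leqnn _))]; exists (g n0) => //.
by apply: le_trans; [exact: ler_norm|].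
Qed.

Lemma qform_cst n (c : R) : qform n (fun=> c : R) = 0.
Proof.
rewrite /qform /dform (eq_I _ (f := fun x => c * T n _ x) (g := fun x => c * c)).
  by rewrite subrr.
by move=> x; rewrite T_cst.
Qed.

Lemma qnull_cst c : qnull (fun=> c).
Proof.
have c2 : L2 (fun=> c) by exact/L2_bmeas/bmeas_cst.
by split => // e e0; exists 0%N => n _; rewrite qform_cst normr0 ltW.
Qed.

(** Dirichlet forms decrease under maps that do not increase distances; here
    the increments of [f] are controlled by those of two functions. *)
Lemma qform_monotone n f g h : L2 f -> L2 g -> L2 h ->
  (forall x y, (f x - f y) ^+ 2 <= (g x - g y) ^+ 2 + (h x - h y) ^+ 2) ->
  qform n f <= qform n g + qform n h.
Proof.
move=> f2 g2 h2 fgh.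
suff : 2 * qform n f <= 2 * qform n g + 2 * qform n h by lra.
rewrite !qform_double// -ID; try exact: qform_inner_L1.
apply: I_le; first exact: qform_inner_L1.
  by apply: L1D; exact: qform_inner_L1.
move=> x; rewrite -ID; try exact: kn_sqr_L1.
apply: I_le; first exact: kn_sqr_L1.
  by apply: L1D; exact: kn_sqr_L1.
by move=> y; rewrite -mulrDr ler_wpM2l ?kn_ge0.
Qed.

(** [(x_i - y_i)^2] is at most [|x - y|^2 = 4 (1 - cos2_half x y)], and the
    mean of [cos2_half] under [kn n x] is [(n+1) / (n+2)]. *)
Lemma qform_coord n i : qform n (fun x : S => val x 0 i) <= 2 / n.+2%:R.
Proof.
have c2 : L2 (fun x : S => val x 0 i) by exact/L2_bmeas/bmeas_coord.
suff : 2 * qform n (fun x : S => val x 0 i) <= 4 / n.+2%:R.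
  by move=> h; rewrite -(@ler_pM2l _ 2)// (le_trans h)// mulrA -natrM.
rewrite qform_double//.
have b m (x : S) : L1 (kn m x) by exact/L1_bmeas/bker_l/bker_kn.
rewrite -(I_cst (@sigma R) (4 / n.+2%:R)); apply: I_le.
- exact: qform_inner_L1.
- exact: L1_cst.
move=> x; have -> : 4 / n.+2%:R =
    I (fun y => 4 * (kn n x y - n.+1%:R / n.+2%:R * kn n.+1 x y)).
  have e1 : I (fun y => n.+1%:R / n.+2%:R * kn n.+1 x y) = n.+1%:R / n.+2%:R.
    by rewrite IZ// I_kn mulr1.
  rewrite IZ; last by apply: L1B => //; exact: L1Z.
  rewrite IB//; last exact: L1Z.
  rewrite e1 I_kn -[n.+2%:R]natr1.
  have n2 : n.+1%:R + 1 != 0 :> R by rewrite natr1 pnatr_eq0.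
  by field.
apply: I_le; first exact: kn_sqr_L1.
  by apply: L1Z; apply: L1B => //; exact: L1Z.
move=> y.
have -> : n.+1%:R / n.+2%:R * kn n.+1 x y = kn n x y * cos2_half (val x) (val y).
  rewrite /kn /kfun exprS.
  have n2 : n.+2%:R != 0 :> R by rewrite pnatr_eq0.
  by field.
rewrite (_ : 4 * _ = kn n x y * (4 * (1 - cos2_half (val x) (val y)))); last by ring.
rewrite ler_wpM2l ?kn_ge0//.
rewrite /cos2_half; have := dotxx x; have := dotxx y; rewrite !dotE.
move: (val x) (val y) => u v hv hu.
elim/ord3P : i c2 => _.
- by have := sqr_ge0 (u 0 1 - v 0 1); have := sqr_ge0 (u 0 2 - v 0 2); nra.
- by have := sqr_ge0 (u 0 0 - v 0 0); have := sqr_ge0 (u 0 2 - v 0 2); nra.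
- by have := sqr_ge0 (u 0 0 - v 0 0); have := sqr_ge0 (u 0 1 - v 0 1); nra.
Qed.

Lemma qnull_coord i : qnull (fun x : S => val x 0 i).
Proof.
have c2 : L2 (fun x : S => val x 0 i) by exact/L2_bmeas/bmeas_coord.
split => // e e0; exists (Num.bound (2 / e)) => n ne.
rewrite ger0_norm ?qform_ge0//; apply: (le_trans (qform_coord n i)).
rewrite ler_pdivrMr// mulrC -ler_pdivrMr//.
have : 0 <= 2 / e by rewrite divr_ge0 ?ltW.
move/archi_boundP/ltW => h; apply: (le_trans h); rewrite ler_nat.
by rewrite (leq_trans ne)// leqW.
Qed.

(** The indicator is the increasing limit of the ramps
    [min 1 (max 0 (n (x_i - c)))], which are [n]-Lipschitz functions of the
    coordinate. *)
Lemma qnull_ray i (c : R) : qnull (\1_[set x : S | c < val x 0 i]).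
Proof.
pose g (n : nat) (x : S) : R :=
  Num.min 1 (Num.max 0 (n%:R * (val x 0 i - c))).
have mg n : measurable_fun setT (g n).
  apply: measurable_minr => //; apply: measurable_maxr => //.
  apply: measurable_funM => //; apply: measurable_funB => //.
  exact: measurable_coord.
have g01 n x : 0 <= g n x <= 1.
  by rewrite /g le_min ler01 le_max lexx ge_min lexx.
apply: (@qnull_dct g _ (fun=> 1)).
- move=> n.
  have g2 : L2 (g n).
    apply: L2_bmeas; split => //; exists 1 => x.
    by have /andP[g0 g1] := g01 n x; rewrite ger0_norm.
  split => // e e0.
  have [c2 _] := qnull_coord i.
  have [n0 h] := (qnull_lin n%:R 0 (qnull_coord i) (qnull_coord i)).2 _ e0.
  exists n0 => k /h; apply: le_trans; rewrite !ger0_norm ?qform_ge0//; last first.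
    by apply: L2D; exact: L2Z.
  have z2 : L2 (fun=> 0) by exact/L2_bmeas/bmeas_cst.
  apply: (@le_trans _ _ (qform k (fun x : S => n%:R * val x 0 i + 0 * val x 0 i) + qform k (fun=> 0))).
    apply: qform_monotone => //; first by apply: L2D; exact: L2Z.
    move=> x y; rewrite !mul0r !addr0 subrr expr0n/= addr0.
    rewrite -(real_normK (num_real (g n x - g n y))).
    rewrite -(real_normK (num_real (_ - n%:R * _))).
    rewrite lerXn2r ?nnegrE// /g.
    move: (val x 0 i) (val y 0 i) => a b.
    have -> : n%:R * a - n%:R * b = n%:R * (a - c) - n%:R * (b - c) by ring.
    move: (n%:R * (a - c)) (n%:R * (b - c)) => s t.
    rewrite ler_norml; have := ler_norm (s - t); have := ler_norm (t - s).
    rewrite (distrC t s); move: `|s - t| (normr_ge0 (s - t)) => r r0 h1 h2.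
    rewrite /Num.min /Num.max.
    by apply/andP; split; repeat case: ifPn; rewrite -?leNgt; lra.
  by rewrite qform_cst addr0.
- move=> x; rewrite indicE; case: (ltP c (val x 0 i)) => cx.
    rewrite mem_set//=; apply: (@cvg_near_cst _ _ _ (fun n => g n x)).
    exists (Num.bound ((val x 0 i - c)^-1)) => // n /= hn.
    have dx : 0 < val x 0 i - c by rewrite subr_gt0.
    have b1 : 1 <= n%:R * (val x 0 i - c).
      rewrite -ler_pdivrMr// div1r.
      have /archi_boundP/ltW h : 0 <= (val x 0 i - c)^-1 by rewrite invr_ge0 ltW.
      by rewrite (le_trans h)// ler_nat.
    by rewrite /g max_r ?min_l// (le_trans _ b1).
  rewrite memNset/=; last by rewrite /= ltNge cx.
  rewrite (_ : (fun n => g n x) = fun=> 0); first exact: cvg_cst.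
  apply/funext => n; rewrite /g max_l ?min_r//.
  by rewrite mulr_ge0_le0// subr_le0.
- by move=> n x; have /andP[g0 g1] := g01 n x; rewrite ger0_norm.
- exact/L2_bmeas/bmeas_cst.
Qed.

Lemma L2_indic (B : set S) : measurable B -> L2 (\1_B).
Proof.
move=> mB; apply: L2_bmeas; split; first exact: measurable_indic.
by exists 1 => x; rewrite indicE; case: (_ \in _); rewrite ?normr1 ?normr0.
Qed.

(** These sets form a sigma-algebra; that it contains the half-spaces
    orthogonal to the axes makes it the whole one. *)
Definition qset (B : set S) := measurable B /\ qnull (\1_B).

Lemma qset_setC B : qset B -> qset (~` B).
Proof.
move=> [mB qB]; split; first exact: measurableC.
have := qnull_lin 1 (-1) (qnull_cst 1) qB; congr qnull.
by apply/funext => x; rewrite !indicE in_setC; case: (_ \in _); rewrite /=; ring.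
Qed.

(** An increment of the indicator of a union is an increment of one of the two
    indicators. *)
Lemma qset_setU B C : qset B -> qset C -> qset (B `|` C).
Proof.
move=> [mB [B2 qB]] [mC [C2 qC]]; split; first exact: measurableU.
have BC2 : L2 (\1_(B `|` C)) by apply: L2_indic; exact: measurableU.
split => // e e0.
have e2 : 0 < e / 2 by rewrite divr_gt0.
have [n1 h1] := qB _ e2; have [n2 h2] := qC _ e2.
exists (maxn n1 n2) => n; rewrite geq_max => /andP[/h1 + /h2].
rewrite !ger0_norm ?qform_ge0// => hB hC.
suff : qform n (\1_(B `|` C)) <= qform n (\1_B) + qform n (\1_C) by lra.
apply: qform_monotone => // x y; rewrite !indicE !in_setU.
by do 4! case: (_ \in _) => /=; lra.
Qed.

Lemma qset_bigcup (F : (set S)^nat) : (forall n, qset (F n)) ->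
  qset (\bigcup_n F n).
Proof.
move=> qF; split; first by apply: bigcupT_measurable => n; case: (qF n).
pose G n := \big[setU/set0]_(k < n) F k.
have qG n : qset (G n).
  elim: n => [|n IH]; rewrite /G ?big_ord0 ?big_ord_recr/=.
    split => //; have := qnull_cst 0; congr qnull.
    by apply/funext => x; rewrite indicE in_set0.
  exact: qset_setU.
apply: (@qnull_dct (fun n => \1_(G n)) _ (fun=> 1)).
- by move=> n; case: (qG n).
- move=> x; apply: (@cvg_near_cst _ _ _ (fun n => \1_(G n) x : R)).
  have [[k _ Fkx]|NF] := pselect ((\bigcup_n F n) x).
    exists k.+1 => // n /= kn; rewrite !indicE !mem_set//.
      by exists k.
    by rewrite /G -bigcup_mkord; exists k.
  near=> n; rewrite !indicE !memNset//.
  by rewrite /G -bigcup_mkord => -[k _ Fk]; apply: NF; exists k.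
- by move=> n x; rewrite indicE; case: (_ \in _); rewrite ?normr1 ?normr0.
- exact/L2_bmeas/bmeas_cst.
Unshelve. all: by end_near. Qed.

Lemma measurable_qset (B : set S) : measurable B -> qset B.
Proof.
have q0 : qset set0.
  split => //; have := qnull_cst 0; congr qnull.
  by apply/funext => x; rewrite indicE in_set0.
apply: smallest_sub.
  split; [exact: q0|by move=> C qC; rewrite setTD; exact: qset_setC|].
  by move=> F qF; exact: qset_bigcup.
rewrite -bigcup_mkord_ord; apply: bigcup_sub => i _ _ [C mC <-].
rewrite setTI.
move: C mC; rewrite -[measurable]/(@measurable _ (measurableTypeR R)).
rewrite RGenOInfty.measurableE.
apply: smallest_sub.
  split.
  - by rewrite preimage_set0.
  - by move=> C qC; rewrite setTD preimage_setC; exact: qset_setC.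
  - by move=> F qF; rewrite preimage_bigcup; exact: qset_bigcup.
move=> _ [c ->]; split.
  have := @measurable_coord R (inord i) measurableT `]c, +oo[%classic
    (measurable_itv _).
  by rewrite setTI.
have := qnull_ray (inord i) c; congr (qnull (\1_ _)).
by apply/seteqP; split => x /=; rewrite in_itv/= andbT.
Qed.

Import HBNNSimple.

Lemma qnull_nnsfun (g : {nnsfun S >-> R}) : qnull g.
Proof.
have qs (s : seq R) : qnull (fun x => \sum_(c <- s) c * \1_(g @^-1` [set c]) x).
  elim: s => [|c s IH].
    by under eq_fun do rewrite big_nil; exact: qnull_cst.
  under eq_fun do rewrite big_cons.
  have qc : qnull (\1_(g @^-1` [set c])).
    by apply: (measurable_qset _).2; exact: measurable_funPTI.
  have := qnull_lin c 1 qc IH; congr qnull.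
  by apply/funext => x; rewrite mul1r.
have := qs (finmap.enum_fset (fset_set (range g))); congr qnull.
by apply/funext => x; rewrite [RHS]fimfunE fsbig_finite.
Qed.

Lemma L2_qnull_ge0 f : (forall x, 0 <= f x) -> L2 f -> qnull f.
Proof.
move=> f0 f2; have mf := L2_measurable f2.
have mf' : measurable_fun setT (EFin \o f) by exact/measurable_EFinP.
pose h := nnsfun_approx measurableT mf'.
have hf x : h n x @[n --> \oo] --> f x.
  have : (EFin \o h ^~ x) @ \oo --> (EFin \o f) x.
    by apply: (cvg_nnsfun_approx measurableT mf') => // y _; rewrite lee_fin.
  by move=> /fine_cvgP[].
apply: (@qnull_dct (fun n => h n) _ f) => //.
- by move=> n; exact: qnull_nnsfun.
- move=> n x; rewrite ger0_norm//.
  have nd : {homo (fun n => h n x) : a b / (a <= b)%N >-> a <= b}.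
    by move=> a b ab; exact/lefP/nd_nnsfun_approx.
  by apply: (cvgr_to_ge (hf x)); exists n => // m /= nm; exact: nd.
Qed.

(** Positive and negative parts, each the increasing limit of simple
    functions. *)
Theorem L2_qnull f : L2 f -> qnull f.
Proof.
move=> f2; have mf := L2_measurable f2.
have p2 : qnull (fun x => Num.max (f x) 0).
  apply: L2_qnull_ge0; first by move=> x; rewrite le_max lexx orbT.
  apply: (L2_le _ _ f2); first exact: measurable_maxr.
  by move=> x; rewrite /Num.max; case: ifP => _; rewrite ?normr0.
have m2 : qnull (fun x => Num.max (- f x) 0).
  apply: L2_qnull_ge0; first by move=> x; rewrite le_max lexx orbT.
  apply: (L2_le _ _ f2); first by apply: measurable_maxr => //; exact: measurable_funN.
  by move=> x; rewrite /Num.max; case: ifP => _; rewrite ?normr0 ?normrN.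
have := qnull_lin 1 (-1) p2 m2; congr qnull; apply/funext => x.
by rewrite /Num.max; repeat case: ifPn; rewrite -?leNgt; lra.
Qed.

End approximate_identity.

(** * Completeness of L2 *)

(** The Cauchy-Schwarz inequality with weights [2^j], whose inverses sum to at
    most 2. *)
Lemma sum_CS_geometric (R : realType) (D : nat -> R) n :
  (forall j, 0 <= D j) ->
  (\sum_(0 <= j < n) D j) ^+ 2 <= 2 * \sum_(0 <= j < n) 2 ^+ j * D j ^+ 2.
Proof.
move=> D0.
suff : (\sum_(0 <= j < n) D j) ^+ 2 <=
    (2 - 2 * 2^-1 ^+ n) * \sum_(0 <= j < n) 2 ^+ j * D j ^+ 2.
  move=> /le_trans; apply; apply: ler_wpM2r.
    by apply: sumr_ge0 => j _; rewrite mulr_ge0 ?exprn_ge0 ?sqr_ge0.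
  by rewrite lerBlDl lerDr mulr_ge0// exprn_ge0// invr_ge0.
elim: n => [|n IH]; first by rewrite !big_nil mulr0 expr0n.
rewrite !big_nat_recr//=.
have S0 : 0 <= \sum_(0 <= i < n) D i by apply: sumr_ge0.
have Q0 : 0 <= \sum_(0 <= j < n) 2 ^+ j * D j ^+ 2.
  by apply: sumr_ge0 => j _; rewrite mulr_ge0 ?exprn_ge0 ?sqr_ge0.
have t0 : 0 < 2^-1 ^+ n :> R by rewrite exprn_gt0// invr_gt0.
have tE : 2 ^+ n * 2^-1 ^+ n = 1 :> R by rewrite -exprMn mulfV// expr1n.
have s0 : 0 < 2 ^+ n :> R by rewrite exprn_gt0.
have t1 : 2^-1 ^+ n <= 1 :> R by rewrite exprn_ile1// invf_le1// ler1n.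
have -> : 2 - 2 * 2^-1 ^+ n.+1 = 2 - 2^-1 ^+ n :> R by rewrite exprS; field.
move: S0 Q0 t0 tE s0 t1 IH (D0 n).
set a := \sum_(0 <= i < n) D i; set b := \sum_(0 <= j < n) _.
move: a b (2^-1 ^+ n) (2 ^+ n) (D n).
move=> s Q t r x s0 Q0 t0 tE r0 t1 IH x0.
(* With [t = 2^-n] and [r = 2^n], the induction needs to absorb the cross term
   [2 s x]; it is at most twice the geometric mean of the two summands of [key],
   because [s^2 <= (2 - 2 t) Q] and [r t = 1]. *)
have c0 : 0 <= 2 - 2 * t by lra.
have t0' := ltW t0; have r0' := ltW r0.
have key : 2 * s * x <= t * Q + (2 - 2 * t) * r * x ^+ 2.
  rewrite -(@ler_pXn2r _ 2)//; last 2 first.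
  - by rewrite nnegrE !mulr_ge0.
  - by rewrite nnegrE addr_ge0// !mulr_ge0// sqr_ge0.
  apply: (@le_trans _ _ (4 * ((t * Q) * ((2 - 2 * t) * r * x ^+ 2)))).
    rewrite (_ : (2 * s * x) ^+ 2 = 4 * x ^+ 2 * s ^+ 2); last by ring.
    rewrite (_ : 4 * (t * Q * _) = 4 * x ^+ 2 * ((2 - 2 * t) * Q) * (r * t)); last by ring.
    by rewrite tE mulr1 ler_wpM2l// mulr_ge0// sqr_ge0.
  have := sqr_ge0 (t * Q - (2 - 2 * t) * r * x ^+ 2); nra.
have -> : (2 - t) * (Q + r * x ^+ 2) =
    (2 - 2 * t) * Q + t * Q + (2 - 2 * t) * r * x ^+ 2 + r * t * x ^+ 2 by ring.
by rewrite tE mul1r; nra.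
Qed.

Section riesz_fischer.
Context d (T : measurableType d) (R : realType) (mu : probability T R).
Local Notation I := (mean mu).
Local Notation L1 := (is_L1 mu).
Local Notation L2 := (is_L2 mu).

(** Riesz-Fischer for a sequence with geometrically small increments: the
    weighted sum [W] of the squared increments is integrable, so it is finite
    almost everywhere; where it is finite the sequence converges, and
    [2 u_0^2 + 4 W] dominates its square. *)
Lemma L2_fast_cauchy (u : nat -> T -> R) : (forall j, L2 (u j)) ->
  (forall j, I (fun x => (u j.+1 x - u j x) ^+ 2) <= 4 * 4^-1 ^+ j) ->
  exists2 v, L2 v & vanishes (fun j => I (fun x => (u j x - v x) ^+ 2)).
Proof.
move=> u2 ufast.
pose D j x := `|u j.+1 x - u j x|.
pose c j x := 2 ^+ j * D j x ^+ 2.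
have DE j x : D j x ^+ 2 = (u j.+1 x - u j x) ^+ 2 by rewrite real_normK ?num_real.
have c0 j x : 0 <= c j x by rewrite mulr_ge0 ?sqr_ge0// exprn_ge0.
have c1 j : L1 (c j).
  rewrite /c; apply: L1Z; rewrite (_ : (fun x => _) = fun x => (u j.+1 x - u j x) ^+ 2).
    by apply: L2_sq; exact: L2B.
  by apply/funext => x; exact: DE.
have Ic j : I (c j) <= 4 * 2^-1 ^+ j.
  rewrite /c IZ; last by under eq_fun do rewrite DE; apply: L2_sq; exact: L2B.
  rewrite (eq_I _ (DE j)) (le_trans (ler_wpM2l _ (ufast j)))// ?exprn_ge0//.
  rewrite mulrCA -exprMn ler_wpM2l// (_ : 2 * 4^-1 = 2^-1)//.
  by field.
pose W x : \bar R := (\sum_(j <oo) (c j x)%:E)%E.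
have mc j : measurable_fun setT (EFin \o c j) by case/integrableP: (c1 j).
have c0E j x : (0 <= (c j x)%:E)%E by rewrite lee_fin.
have W0 x : (0 <= W x)%E by apply: nneseries_ge0.
have mW : measurable_fun setT W.
  by apply: (ge0_emeasurable_sum (h := fun j => EFin \o c j)) => // j x _ _; exact: c0E.
have IW : (\int[mu]_x W x < +oo)%E.
  rewrite integral_nneseries//.
  apply: (@le_lt_trans _ _ 8%:E); last exact: ltry.
  apply: lime_le; first by apply: is_cvg_nneseries => j _ _; exact: integral_ge0.
  apply: nearW => n.
  rewrite (eq_bigr (fun j => (I (c j))%:E)); last by move=> j _; rewrite IE.
  rewrite sumEFin lee_fin.
  apply: (@le_trans _ _ (\sum_(0 <= j < n) 4 * 2^-1 ^+ j)); first exact: ler_sum.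
  suff -> : \sum_(0 <= j < n) 4 * 2^-1 ^+ j = 8 - 8 * 2^-1 ^+ n :> R.
    by rewrite gerBl mulr_ge0// exprn_ge0// invr_ge0.
  elim: n => [|n IH]; first by rewrite big_nil expr0; ring.
  by rewrite big_nat_recr//= IH exprS; field.
have iW : mu.-integrable setT W.
  apply/integrableP; split => //.
  by under eq_integral do rewrite gee0_abs//.
pose E := [set x | W x < +oo]%E.
have mE : measurable E.
  rewrite -[X in measurable X]setTI.
  exact: (emeasurable_fun_infty_o measurableT mW).
have bE : bmeas (\1_E : T -> R).
  split; first exact: measurable_indic.
  by exists 1 => x; rewrite indicE; case: (_ \in _); rewrite ?normr1 ?normr0.
(* Outside [E] everything is set to zero, so that the convergence and the
   domination hold at every point. *)
pose W' x : R := fine (W x) * \1_E x.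
have W'0 x : 0 <= W' x by rewrite mulr_ge0 ?fine_ge0.
have W'1 : L1 W'.
  apply: (@le_integrable _ _ _ mu setT measurableT _ W) => //.
  - apply/measurable_EFinP; apply: measurable_funM; last by case: bE.
    exact: measurableT_comp.
  - move=> x _; rewrite (gee0_abs (W0 x)) /= ger0_norm//.
    rewrite /W' indicE; case: (boolP (x \in E)) => [/set_mem Ex|_].
      by rewrite mulr1 fineK// ge0_fin_numE.
    by rewrite mulr0.
have sumE x n : E x -> \sum_(0 <= j < n) c j x <= W' x.
  move=> Ex; rewrite /W' indicE mem_set// mulr1 -lee_fin fineK ?ge0_fin_numE//.
  by rewrite -sumEFin; apply: nneseries_lim_ge => j _ _; exact: c0E.
have SD x n : E x -> \sum_(0 <= j < n) D j x <= 2 * (W' x + 1).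
  move=> Ex; rewrite -(@ler_pXn2r _ 2)//; last 2 first.
  - by rewrite nnegrE; apply: sumr_ge0 => j _; exact: normr_ge0.
  - by rewrite nnegrE mulr_ge0// addr_ge0.
  apply: (le_trans (sum_CS_geometric n (fun j => normr_ge0 (u j.+1 x - u j x)))).
  have := sumE x n Ex; have := W'0 x; rewrite /c /D.
  by move: (W' x) (\sum_(0 <= j < n) _) => w s w0 sw; nra.
have ucv x : E x -> cvgn (u^~ x).
  move=> Ex.
  have Dcv : cvgn [normed series (telescope (u^~ x))].
    have nE n : [normed series (telescope (u^~ x))] n = \sum_(0 <= j < n) D j x by [].
    apply: nondecreasing_is_cvgn.
      by apply/nondecreasing_seqP => n; rewrite !nE big_nat_recr//= lerDl /D normr_ge0.
    by exists (2 * (W' x + 1)) => _ [n _ <-]; rewrite nE; exact: SD.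
  have := normed_cvg Dcv; rewrite telescopeK => tcv.
  rewrite (_ : u^~ x = (fun n => (u n x - u 0 x) + u 0 x)).
    by apply: is_cvgD => //; exact: is_cvg_cst.
  by apply/funext => n; rewrite subrK.
pose u' j x := u j x * \1_E x.
pose v x := if x \in E then lim (u^~ x @ \oo) else 0.
pose h x := Num.sqrt (2 * u 0 x ^+ 2 + 4 * W' x).
have hsq x : h x ^+ 2 = 2 * u 0 x ^+ 2 + 4 * W' x.
  by rewrite sqr_sqrtr// addr_ge0// mulr_ge0// sqr_ge0.
have h2 : L2 h.
  split.
    apply: (measurableT_comp (continuous_measurable_fun (@sqrt_continuous R))).
    by apply: (@L1_measurable _ _ _ mu); apply: L1D; apply: L1Z => //; exact: L2_sq.
  under eq_fun do rewrite hsq.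
  by apply: L1D; apply: L1Z => //; exact: L2_sq.
have u'2 j : L2 (u' j) by exact: L2M.
have [] := @I_dct2 _ _ _ mu u' v h.
- by move=> j; exact: L2_measurable.
- move=> x; rewrite /u' /v indicE; case: ifPn => [/set_mem Ex|_] /=.
    by under eq_fun do rewrite mulr1; exact: ucv.
  by under eq_fun do rewrite mulr0; exact: cvg_cst.
- move=> j x; rewrite /u' indicE; case: (boolP (x \in E)) => [/set_mem Ex|_] /=.
    rewrite mulr1 -(@ler_pXn2r _ 2)// ?nnegrE ?sqrtr_ge0// hsq real_normK ?num_real//.
    have du : `|u j x - u 0 x| <= \sum_(0 <= k < j) D k x.
      rewrite -(telescope_sumr (u^~ x) (leq0n j)).
      exact: ler_norm_sum.
    have := sumE x j Ex.
    have := sum_CS_geometric j (fun k => normr_ge0 (u k.+1 x - u k x)).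
    rewrite -/(c _ x) => cs sc.
    have d2 : (u j x - u 0 x) ^+ 2 <= 2 * W' x.
      rewrite -real_normK ?num_real//.
      apply: (@le_trans _ _ ((\sum_(0 <= k < j) D k x) ^+ 2)).
        rewrite lerXn2r// nnegrE; apply: sumr_ge0 => k _; exact: normr_ge0.
      by apply: (le_trans cs); rewrite ler_pM2l.
    by have := sqr_ge0 (u j x - 2 * u 0 x); nra.
  by rewrite mulr0 normr0 sqrtr_ge0.
- exact: h2.
move=> v2 vv; exists v => //.
move=> e e0; have [n0 hn] := vv e e0; exists n0 => n /hn.
suff -> : I (fun x => (u' n x - v x) ^+ 2) = I (fun x => (u n x - v x) ^+ 2) by [].
apply: EFin_inj; rewrite -!IE; try by apply: L2_sq; exact: L2B.
apply: ae_eq_integral => //.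
- by apply/measurable_EFinP/L1_measurable/L2_sq/L2B.
- by apply/measurable_EFinP/L1_measurable/L2_sq/L2B.
have := integrable_ae measurableT iW; apply: filterS => x /(_ Logic.I) Wx _.
rewrite /u' indicE mem_set ?mulr1//=.
by rewrite /E/= -ge0_fin_numE.
Qed.

End riesz_fischer.

(** * Telescoping limits *)

Section telescoping.
Context (R : realType).
Implicit Types (q : nat -> R) (a e : R).

(** Since [1 / (k+1) - 1 / (k+2) = 1 / ((k+2)(k+1))], the hypothesis says that
    [q k - a / (k+1)] is nondecreasing; it tends to 0, so it is nonpositive. *)
Lemma telescoping_le q a n0 : vanishes q ->
  (forall n, (n0 <= n)%N -> n.+2%:R * n.+1%:R * (q n - q n.+1) <= a) ->
  forall n, (n0 <= n)%N -> n.+1%:R * q n <= a.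
Proof.
move=> q0 qa n n0n.
pose r k := q k - a / k.+1%:R.
have rS k : (n0 <= k)%N -> r k <= r k.+1.
  move=> /qa h; rewrite /r.
  have k1 : 0 < k.+1%:R :> R by [].
  have k2 : 0 < k.+2%:R :> R by [].
  suff : q k - q k.+1 <= a / k.+1%:R - a / k.+2%:R.
    by move: (a / k.+1%:R) (a / k.+2%:R) => u v; lra.
  rewrite (_ : a / k.+1%:R - a / k.+2%:R = a / (k.+2%:R * k.+1%:R)).
    by rewrite ler_pdivlMr ?mulr_gt0// mulrC.
  have k2' : k.+1%:R + 1 != 0 :> R by rewrite natr1 pnatr_eq0.
  have k1' : k.+1%:R != 0 :> R by rewrite pnatr_eq0.
  rewrite -[k.+2%:R]natr1; move: (k.+1%:R : R) k1' k2' => t t0 t1.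
  by field; apply/andP; split.
have rm k m : (n0 <= k)%N -> r k <= r (k + m)%N.
  move=> n0k; elim: m => [|m IH]; first by rewrite addn0.
  by rewrite (le_trans IH)// addnS rS// (leq_trans n0k)// leq_addr.
have n1 : 0 < n.+1%:R :> R by [].
suff : r n <= 0 by rewrite /r subr_le0 ler_pdivlMr// mulrC.
rewrite leNgt; apply/negP => rn0.
have [k hk] := q0 (r n / 2) (divr_gt0 rn0 (ltr0Sn _ 1)).
pose b := Num.bound (`|a| / (r n / 4)).
have b0 : 0 <= `|a| / (r n / 4) by rewrite divr_ge0// divr_ge0// ltW.
have hr : r n <= q (n + (k + b))%N - a / (n + (k + b)).+1%:R by exact: rm.
have h1 : q (n + (k + b))%N <= r n / 2.
  have := hk (n + (k + b))%N; rewrite ler_norml => /(_ _)/andP[|//].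
  by rewrite addnCA leq_addr.
have s0 : 0 < (n + (k + b)).+1%:R :> R by [].
have h2 : - (a / (n + (k + b)).+1%:R) <= r n / 4.
  rewrite -mulNr ler_pdivrMr//.
  have := archi_boundP b0; rewrite -/b ltr_pdivrMr ?divr_gt0// => h.
  have h3 : - a <= `|a| by rewrite -normrN ler_norm.
  have h4 : b%:R <= (n + (k + b)).+1%:R :> R by rewrite ler_nat; lia.
  apply: (le_trans h3); apply: (le_trans (ltW h)); rewrite mulrC.
  by rewrite ler_wpM2l// divr_ge0// ltW.
move: rn0 hr h1 h2; move: (r n) (q _) (a / _) => x y z *; lra.
Qed.

Lemma telescoping_ge q a n0 : vanishes q ->
  (forall n, (n0 <= n)%N -> a <= n.+2%:R * n.+1%:R * (q n - q n.+1)) ->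
  forall n, (n0 <= n)%N -> a <= n.+1%:R * q n.
Proof.
move=> q0 qa n n0n.
have : n.+1%:R * (- q n) <= - a.
  apply: (@telescoping_le (fun n => - q n) (- a) n0) => //.
    by move=> e /q0[k hk]; exists k => m /hk; rewrite normrN.
  by move=> m /qa; lra.
by lra.
Qed.

Lemma telescoping_limit q a : vanishes q ->
  vanishes (fun n => n.+2%:R * n.+1%:R * (q n - q n.+1) - a) ->
  vanishes (fun n => n.+1%:R * q n - a).
Proof.
move=> q0 qa e e0; have [n0 h] := qa e e0; exists n0 => n n0n.
rewrite ler_norml; apply/andP; split.
  have : a - e <= n.+1%:R * q n; last by lra.
  apply: (telescoping_ge q0 _ n0n) => k /h.
  by rewrite ler_norml => /andP[? ?]; lra.
have : n.+1%:R * q n <= a + e; last by lra.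
apply: (telescoping_le q0 _ n0n) => k /h.
by rewrite ler_norml => /andP[? ?]; lra.
Qed.

Lemma vanishesD (u v : nat -> R) : vanishes u -> vanishes v ->
  vanishes (fun n => u n + v n).
Proof.
move=> u0 v0 e e0.
have e2 : 0 < e / 2 by rewrite divr_gt0.
have [n1 h1] := u0 _ e2; have [n2 h2] := v0 _ e2.
exists (maxn n1 n2) => n; rewrite geq_max => /andP[/h1 un /h2 vn].
by rewrite (le_trans (ler_normD _ _))//; lra.
Qed.

Lemma vanishesZ c (u : nat -> R) : vanishes u -> vanishes (fun n => c * u n).
Proof.
move=> u0 e e0.
have c0 : 0 < `|c| + 1 by rewrite ltr_wpDl.
have [n h] := u0 (e / (`|c| + 1)) (divr_gt0 e0 c0).
exists n => k /h; rewrite normrM ler_pdivlMr//.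
by have := normr_ge0 (u k); nra.
Qed.

Lemma vanishes_sum k (u : 'I_k -> nat -> R) : (forall i, vanishes (u i)) ->
  vanishes (fun n => \sum_(i < k) u i n).
Proof.
elim: k u => [u _ e e0|k IH u u0].
  by exists 0%N => n _; rewrite big_ord0 normr0 ltW.
under eq_fun do rewrite big_ord_recr/=.
by apply: vanishesD => //; apply: IH.
Qed.

Lemma vanishes_shift (u : nat -> R) : vanishes u -> vanishes (fun n => u n.+1).
Proof. by move=> u0 e /u0[n h]; exists n => k nk; apply: h; exact: leqW. Qed.

Lemma vanishes_sqrt (u v : nat -> R) c : vanishes u ->
  (forall n, v n ^+ 2 <= c * u n) -> vanishes v.
Proof.
move=> u0 uv e e0.
have [n h] := vanishesZ c u0 (exprn_gt0 2 e0); exists n => k /h H.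
rewrite -(@ler_pXn2r _ 2)// ?nnegrE ?(ltW e0)// real_normK ?num_real//.
by apply: (le_trans (uv k)); apply: le_trans H; exact: ler_norm.
Qed.

Lemma vanishes_le (u : nat -> R) a b : vanishes (fun n => u n - a) ->
  (forall n0, exists2 n, (n0 <= n)%N & u n <= b) -> a <= b.
Proof.
move=> ua ub; rewrite leNgt; apply/negP => ba.
have d0 : 0 < (a - b) / 2 by rewrite divr_gt0// subr_gt0.
have [n0 h] := ua _ d0; have [n /h] := ub n0.
by rewrite ler_norml => /andP[? ?] ?; lra.
Qed.

Lemma vanishes_uniq (u : nat -> R) a b : vanishes (fun n => u n - a) ->
  vanishes (fun n => u n - b) -> a = b.
Proof.
move=> ua ub; apply/eqP; rewrite eq_le; apply/andP; split; rewrite leNgt; apply/negP => h.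
  have d0 : 0 < (a - b) / 3 by rewrite divr_gt0// subr_gt0.
  have [n1 h1] := ua _ d0; have [n2 h2] := ub _ d0.
  have := h1 (maxn n1 n2) (leq_maxl _ _); have := h2 (maxn n1 n2) (leq_maxr _ _).
  by rewrite !ler_norml => /andP[? ?] /andP[? ?]; lra.
have d0 : 0 < (b - a) / 3 by rewrite divr_gt0// subr_gt0.
have [n1 h1] := ua _ d0; have [n2 h2] := ub _ d0.
have := h1 (maxn n1 n2) (leq_maxl _ _); have := h2 (maxn n1 n2) (leq_maxr _ _).
by rewrite !ler_norml => /andP[? ?] /andP[? ?]; lra.
Qed.

End telescoping.

(** * Gradients of mollified functions *)

Section gradient_energy.
Context (R : realType).
Local Notation S := (S2 R).
Local Notation V := 'rV[R]_3.
Local Notation I := (mean (@sigma R)).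
Local Notation L1 := (is_L1 (@sigma R)).
Local Notation L2 := (is_L2 (@sigma R)).
Local Notation op := (kernel_op (@sigma R)).
Local Notation T n := (op (kn n)).
Implicit Types (f g h : S -> R) (P : V -> R) (H : 'I_3 -> S -> R) (n m k : nat).

(** [H i] is the weak derivative of [f] along the [i]-th rotation field, against
    the test functions in [X].  Two classes of test functions occur: all C1
    functions, and the few polynomials [ktest] to which the kernels give
    rise. *)
Definition rot_grad (X : set (V -> R)) f H :=
  (forall i, L2 (H i)) /\ forall i P, X P ->
    I (fun x => H i x * P (val x)) = - I (fun x => f x * Rd i P (val x)).

Definition ktest : set (V -> R) :=
  [set P | (exists n a, P = kfun n.+1 a) \/ (exists n i a, P = rkfun n i a)].

Lemma ktest_C1 : ktest `<=` @C1 R.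
Proof.
by move=> P [[n [a ->]]|[n [i [a ->]]]]; [exact: C1_kfun|exact: C1_rkfun].
Qed.

Lemma L1_rkf n i f x : L1 f -> L1 (fun y => rk n i x y * f y).
Proof. by apply: L1_ker; exact: bker_rk. Qed.

Section existing_gradient.
Variables (f : S -> R) (H : 'I_3 -> S -> R).
Hypotheses (f2 : L2 f) (fH : rot_grad ktest f H).

Let f1 := L2_L1 f2.
Let H2 i : L2 (H i) := fH.1 i.
Let H1 i := L2_L1 (H2 i).

Let op_rk n i x : op (rk n i) f x = - T n.+1 (H i) x.
Proof.
have := fH.2 i (kfun n.+1 (val x)) (or_introl (ex_intro _ n (ex_intro _ (val x) erefl))).
rewrite (eq_I _ (g := fun y => kn n.+1 x y * H i y)); last by move=> y; exact: mulrC.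
rewrite [X in _ = - X](eq_I _ (g := fun y => rk n i x y * f y)); last first.
  by move=> y; rewrite Rd_kfun mulrC.
by rewrite -/(op _ _ _) -/(op _ _ _) => ->; rewrite opprK.
Qed.

Let lap_rk n i x :
  I (fun y => f y * Rd i (rkfun n i (val x)) (val y)) = - op (rk n i) (H i) x.
Proof.
have h : ktest (rkfun n i (val x)) by right; exists n, i, (val x).
have := fH.2 i _ h => /eqP; rewrite eq_sym eqr_oppLR => /eqP ->.
by congr (- _); apply: eq_I => y; rewrite mulrC.
Qed.

(** By [lkE] the left-hand side is minus the double integral of
    [f(x) f(y) lk n x y], and the Laplacian [lk] is a sum of second derivatives.
    One integration by parts moves a derivative onto [f(y)]; another one, in the
    variable [x] and through the antisymmetry of [rk], moves the other onto
    [f(x)]. *)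
Lemma qform_diff_grad n : n.+2%:R * n.+1%:R * (qform n f - qform n.+1 f) =
  \sum_(i < 3) I (fun x => H i x * T n.+1 (H i) x).
Proof.
have b i : L1 (fun x => f x * op (rk n i) (H i) x).
  by apply: L1M => //; apply: op_bmeas => //; exact: bker_rk.
have -> : n.+2%:R * n.+1%:R * (qform n f - qform n.+1 f) =
    \sum_(i < 3) I (fun x => f x * op (rk n i) (H i) x).
  rewrite -I_sum//.
  transitivity (I (fun x => n.+2%:R * n.+1%:R * (f x * T n.+1 f x - f x * T n f x))).
    rewrite IZ ?IB; try exact: L1_fT.
      by rewrite /qform /dform; ring.
    by apply: L1B; exact: L1_fT.
  apply: eq_I => x.
  have rkL i : L1 (fun y => f y * Rd i (rkfun n i (val x)) (val y)).
    by apply: L1M => //; apply: bmeas_Rd; exact: C1_rkfun.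
  have -> : n.+2%:R * n.+1%:R * (f x * T n.+1 f x - f x * T n f x) =
      - f x * I (fun y => f y * lk n x y).
    rewrite [X in _ = _ * X](eq_I _
      (g := fun y => n.+2%:R * n.+1%:R * (kn n x y * f y - kn n.+1 x y * f y))).
      have Lk m : L1 (fun y => kn m x y * f y) by apply: L1_ker => //; exact: bker_kn.
      rewrite IZ ?IB//; last exact: L1B.
      by rewrite /kernel_op; ring.
    by move=> y; rewrite lkE; ring.
  rewrite (eq_I _ (f := fun y => f y * lk n x y)
    (g := fun y => \sum_(i < 3) f y * Rd i (rkfun n i (val x)) (val y))); last first.
    by move=> y; rewrite /lk /lapk mulr_sumr.
  rewrite I_sum// mulNr mulr_sumr -sumrN; apply: eq_bigr => i _.
  by rewrite lap_rk mulrN opprK.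
apply: eq_bigr => i _.
rewrite (op_fubini (bker_rk _ n i) (H1 i) f1).
apply: eq_I => y; congr (_ * _).
rewrite -[RHS]opprK -op_rk.
rewrite -mulN1r -[RHS](_ : I (fun x => -1 * (rk n i y x * f x)) = _); last first.
  by rewrite IZ//; exact: L1_rkf.
by apply: eq_I => x; rewrite rkC; ring.
Qed.

(** By [qform_diff_grad] the increments, multiplied by [(n+2)(n+1)], miss the
    energy of [H] by the Dirichlet forms of its components. *)
Theorem energy_limit : vanishes (fun n =>
  n.+1%:R * qform n f - \sum_(i < 3) I (fun x => H i x ^+ 2)).
Proof.
apply: telescoping_limit; first by case: (L2_qnull f2).
rewrite (_ : (fun n => _) = (fun n => \sum_(i < 3) (-1) * qform n.+1 (H i))).
  apply: vanishes_sum => i; apply: vanishesZ.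
  by apply: (vanishes_shift (u := fun n => qform n (H i))); case: (L2_qnull (H2 i)).
apply/funext => n; rewrite qform_diff_grad -sumrB; apply: eq_bigr => i _.
rewrite /qform /dform mulN1r opprB; congr (_ - _).
Qed.

End existing_gradient.

Section mollified_gradient.
Variables (f : S -> R).
Hypotheses (f2 : L2 f).
Let f1 := L2_L1 f2.

(** The gradient of [T m.+1 f].  The derivative falls on the first argument of
    the kernel, which accounts for the sign: [rk] carries the derivative in the
    second one. *)
Definition mollified_grad m (i : 'I_3) x : R := - op (rk m i) f x.
Local Notation Hm := mollified_grad.

Lemma bmeas_Hm m i : bmeas (Hm m i).
Proof. by apply: bmeasN; apply: op_bmeas => //; exact: bker_rk. Qed.

Lemma L2_Hm m i : L2 (Hm m i). Proof. exact/L2_bmeas/bmeas_Hm. Qed.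

Lemma Hm_fubini m i h : L1 h ->
  I (fun x => h x * Hm m i x) = I (fun y => f y * op (rk m i) h y).
Proof.
move=> h1.
have b : L1 (fun x => h x * op (rk m i) f x).
  by apply: L1M => //; apply: op_bmeas => //; exact: bker_rk.
rewrite (eq_I _ (g := fun x => -1 * (h x * op (rk m i) f x))); last first.
  by move=> x; rewrite /Hm; ring.
rewrite IZ// (op_fubini (bker_rk _ m i) f1 h1).
rewrite -IZ; last first.
  by apply: L1M => //; apply: op_bmeas => //; apply: bkerT; exact: bker_rk.
apply: eq_I => y; rewrite mulrCA; congr (_ * _).
rewrite /kernel_op -IZ; last first.
  by apply: (@L1_ker _ _ _ _ (fun x y => rk m i y x)) => //; apply: bkerT; exact: bker_rk.
by apply: eq_I => x; rewrite rkC; ring.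
Qed.

Lemma mollified_rot_grad m : rot_grad (@C1 R) (T m.+1 f) (Hm m).
Proof.
split=> [i|i P CP]; first exact: L2_Hm.
have bP := bmeas_C1 CP; have bRP := bmeas_Rd i CP.
rewrite (eq_I _ (g := fun x : S => P (val x) * Hm m i x)); last by move=> x; exact: mulrC.
rewrite Hm_fubini; last exact: L1_bmeas.
rewrite (eq_I _ (f := fun x => T m.+1 f x * _)
  (g := fun x : S => Rd i P (val x) * T m.+1 f x)); last by move=> x; exact: mulrC.
rewrite (T_sym m.+1 f1 (L1_bmeas (@sigma R) bRP)) -mulN1r -IZ; last first.
  by apply: L1M => //; apply: T_bmeas; exact: L1_bmeas.
apply: eq_I => y; rewrite mulrCA; congr (_ * _).
have := I_ibp i (C1_kfun m.+1 (val y)) CP.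
rewrite mulN1r (_ : I _ = T m.+1 (fun x : S => Rd i P (val x)) y)// => ->.
rewrite opprK; apply: eq_I => x.
by rewrite Rd_kfun mulrC.
Qed.

Definition energy_step m : R := m.+2%:R * m.+1%:R * (qform m f - qform m.+1 f).

(** The Gram matrix of the mollified gradients. *)
Definition mollified_dot m k : R := \sum_(i < 3) I (fun x => Hm m i x * Hm k i x).

(** Move the kernel [rk m] from one gradient to the other: the gradient of
    [T k.+1 f] then meets the gradient of [kfun m.+1], and the Laplacian of the
    latter is a difference of kernels.  The product is therefore
    [(m+2)(m+1) <f, (T (m+1) - T m) (T (k+1) f)>], and replacing [T (k+1) f] by
    [f] costs the two Dirichlet forms. *)
Lemma mollified_dotE m k : mollified_dot m k = energy_step m + m.+2%:R * m.+1%:R *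
  (dform k.+1 (T m f) f - dform k.+1 (T m.+1 f) f).
Proof.
have g2 := T_L2 k.+1 f2; have g1 := L2_L1 g2.
have Lk l (x : S) : L1 (fun y => kn l x y * T k.+1 f y).
  by apply: L1_ker => //; exact: bker_kn.
have -> : mollified_dot m k = m.+2%:R * m.+1%:R *
    (I (fun y => f y * T m.+1 (T k.+1 f) y) - I (fun y => f y * T m (T k.+1 f) y)).
  transitivity (\sum_(i < 3) I (fun y => f y * op (rk m i) (Hm k i) y)).
    apply: eq_bigr => i _; rewrite -Hm_fubini; last exact/L1_bmeas/bmeas_Hm.
    by apply: eq_I => x; rewrite mulrC.
  have Lop i : L1 (fun y => f y * op (rk m i) (Hm k i) y).
    by apply: L1M => //; apply: op_bmeas; [exact: bker_rk|exact/L1_bmeas/bmeas_Hm].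
  have LT l : L1 (fun y => f y * T l (T k.+1 f) y) by exact: L1_fT.
  rewrite -I_sum// -IB// -IZ; last exact: L1B.
  apply: eq_I => y.
  have E i : op (rk m i) (Hm k i) y =
      - I (fun x => T k.+1 f x * Rd i (rkfun m i (val y)) (val x)).
    rewrite -(mollified_rot_grad k).2; last exact: C1_rkfun.
    by apply: eq_I => x; rewrite mulrC.
  rewrite -mulr_sumr (eq_bigr _ (fun i _ => E i)) sumrN -I_sum; last first.
    by move=> i; apply: L1M => //; apply: bmeas_Rd; exact: C1_rkfun.
  rewrite -mulrBr mulrCA; congr (_ * _).
  rewrite (eq_I _ (g := fun x => m.+2%:R * m.+1%:R *
     (kn m y x * T k.+1 f x - kn m.+1 y x * T k.+1 f x))); last first.
    by move=> x; rewrite -mulr_sumr -/(lapk m (val y) (val x)) -/(lk m y x) lkE; ring.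
  rewrite IZ; last exact: L1B.
  by rewrite IB// -/(op _ _ _) -/(op _ _ _); ring.
have E l : I (fun y => f y * T l (T k.+1 f) y) = I (fun y => f y * T l f y) - dform k.+1 (T l f) f.
  have Tl1 := L2_L1 (T_L2 l f2).
  rewrite -(T_sym l f1 g1) /dform.
  rewrite (eq_I _ (f := fun x => T k.+1 f x * _) (g := fun x => T l f x * T k.+1 f x)).
    rewrite (eq_I _ (f := fun y => f y * _) (g := fun x => T l f x * f x)).
      by ring.
    by move=> x; exact: mulrC.
  by move=> x; exact: mulrC.
by rewrite !E /energy_step /qform /dform; ring.
Qed.

Lemma dform_vanishes h g : L2 h -> L2 g -> vanishes (fun k => dform k h g).
Proof.
move=> h2 g2; apply: (@vanishes_sqrt _ (fun k => qform k g) _ (2 * I (fun x => h x ^+ 2))).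
  by case: (L2_qnull g2).
move=> k; apply: (le_trans (dform_CS k h2 g2)); apply: ler_wpM2r; first exact: qform_ge0.
exact: qform_le.
Qed.

Lemma mollified_dot_limit m : vanishes (fun k => mollified_dot m k - energy_step m).
Proof.
rewrite (_ : (fun k => _) = (fun k => m.+2%:R * m.+1%:R *
  (dform k.+1 (T m f) f + -1 * dform k.+1 (T m.+1 f) f))); last first.
  by apply/funext => k; rewrite mollified_dotE; ring.
apply: vanishesZ; apply: vanishesD.
  by apply: (vanishes_shift (u := fun k => dform k (T m f) f)); apply: dform_vanishes => //; exact: T_L2.
apply: vanishesZ; apply: (vanishes_shift (u := fun k => dform k (T m.+1 f) f)).
by apply: dform_vanishes => //; exact: T_L2.
Qed.

(** The energy of [T m.+1 f] is the limit of [(n+1) qform n (T m.+1 f)], and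
    [qform_T] compares it with that of [f]. *)
Lemma mollified_dot_le c m : (forall n0, exists2 n, (n0 <= n)%N & n.+1%:R * qform n f <= c) ->
  mollified_dot m m <= c.
Proof.
move=> fc.
have mr : rot_grad ktest (T m.+1 f) (Hm m).
  by split=> [i|i P XP]; [exact: L2_Hm|apply: (mollified_rot_grad m).2; exact: ktest_C1].
have := energy_limit (T_L2 m.+1 f2) mr.
rewrite (_ : \sum_(i < 3) _ = mollified_dot m m); last first.
  by apply: eq_bigr => i _; apply: eq_I => x; rewrite expr2.
move=> /vanishes_le; apply=> n0; have [n n0n nc] := fc n0; exists n => //.
by apply: le_trans nc; rewrite ler_wpM2l//; exact: qform_T.
Qed.

Lemma mollified_dot_dist m k : \sum_(i < 3) I (fun x => (Hm m i x - Hm k i x) ^+ 2) =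
  mollified_dot m m - 2 * mollified_dot m k + mollified_dot k k.
Proof.
have Lm j l i : L1 (fun x => Hm j i x * Hm l i x) by apply: L2_mul; exact: L2_Hm.
rewrite /mollified_dot mulr_sumr -sumrB -big_split/=; apply: eq_bigr => i _.
rewrite -IZ// -IB//; last exact: L1Z.
rewrite -ID//; last by apply: L1B => //; exact: L1Z.
by apply: eq_I => x; ring.
Qed.

Lemma mollified_dot_sum m k : 0 <= mollified_dot m m + 2 * mollified_dot m k + mollified_dot k k.
Proof.
have Lm j l i : L1 (fun x => Hm j i x * Hm l i x) by apply: L2_mul; exact: L2_Hm.
rewrite /mollified_dot mulr_sumr -!big_split/=; apply: sumr_ge0 => i _.
rewrite -IZ// -ID//; last exact: L1Z.
rewrite -ID//; last by apply: L1D => //; exact: L1Z.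
by apply: I_ge0 => x; have := sqr_ge0 (Hm m i x + Hm k i x); lra.
Qed.

End mollified_gradient.
End gradient_energy.

(** * Existence of a gradient under an energy bound *)

Section bounded_energy.
Context (R : realType).
Local Notation S := (S2 R).
Local Notation V := 'rV[R]_3.
Local Notation I := (mean (@sigma R)).
Local Notation L1 := (is_L1 (@sigma R)).
Local Notation L2 := (is_L2 (@sigma R)).
Local Notation op := (kernel_op (@sigma R)).
Variables (f : S -> R) (C : R).
Hypotheses (f2 : L2 f)
  (fC : forall n0, exists2 n, (n0 <= n)%N & n.+1%:R * qform n f <= C).
Let f1 := L2_L1 f2.
Local Notation Hm := (mollified_grad f).

Let HC m : mollified_dot f m m <= C. Proof. exact: mollified_dot_le. Qed.

Let mollified_dot_bnd m k : - C <= mollified_dot f m k <= C.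
Proof.
have := HC m; have := HC k; have := mollified_dot_sum f2 m k.
have : 0 <= mollified_dot f m m - 2 * mollified_dot f m k + mollified_dot f k k.
  by rewrite -mollified_dot_dist//; apply: sumr_ge0 => i _; apply: I_ge0 => x; exact: sqr_ge0.
by move=> *; apply/andP; split; lra.
Qed.

Let a_bnd m : - C <= energy_step f m <= C.
Proof.
have h := mollified_dot_limit f2 m; apply/andP; split.
  rewrite lerNl; apply: (vanishes_le (u := fun k => - mollified_dot f m k)).
    move=> e /h[n0 hn]; exists n0 => n /hn.
    by rewrite -opprD normrN.
  by move=> n0; exists n0 => //; have /andP[? _] := mollified_dot_bnd m n0; lra.
apply: (vanishes_le h) => n0; exists n0 => //.
by have /andP[] := mollified_dot_bnd m n0.
Qed.

(* [M] is the upper limit of [energy_step]: the infimum of its eventual upper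
   bounds. *)
Let B : set R := [set c | exists n0, forall m, (n0 <= m)%N -> energy_step f m <= c].
Let M := inf B.

Let Binf : has_inf B.
Proof.
split.
  by exists C; exists 0%N => m _; have /andP[] := a_bnd m.
exists (- C) => c [n0 /(_ n0 (leqnn _)) h].
by have /andP[? _] := a_bnd n0; exact: le_trans h.
Qed.

Let a_le e : 0 < e -> exists n0, forall m, (n0 <= m)%N -> energy_step f m <= M + e.
Proof.
move=> e0; have [c [n0 h] cM] := inf_adherent e0 Binf.
by exists n0 => m /h /le_trans; apply; exact: ltW.
Qed.

Let a_ge e n0 : 0 < e -> exists2 m, (n0 <= m)%N & M - e <= energy_step f m.
Proof.
move=> e0; apply: contrapT => H.
have : B (M - e).
  exists n0 => m n0m; rewrite leNgt; apply/negP => /ltW h.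
  by apply: H; exists m.
by move=> /(ge_inf Binf.2); rewrite -/M; lra.
Qed.

(* An eventual upper bound of [energy_step] bounds [(n+1) qform n] as well, by
   telescoping, hence the norms of all mollified gradients. *)
Let HM m : mollified_dot f m m <= M.
Proof.
apply/ler_addgt0Pr => e e0; apply: mollified_dot_le => // n0.
have [n1 h] := a_le e0; exists (maxn n0 n1); first exact: leq_maxl.
apply: (telescoping_le (L2_qnull f2).2 h).
exact: leq_maxr.
Qed.

Let step j m : exists m', [/\ (j <= m')%N, M - 4^-1 ^+ j.+1 <= energy_step f m' &
  `|mollified_dot f m m' - energy_step f m| <= 4^-1 ^+ j].
Proof.
have e0 k : 0 < 4^-1 ^+ k :> R by rewrite exprn_gt0// invr_gt0.
have [n0 h] := mollified_dot_limit f2 m (e0 j).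
have [m' nm' am'] := a_ge (maxn j n0) (e0 j.+1).
move: nm'; rewrite geq_max => /andP[jm' n0m'].
by exists m'; split => //; exact: h.
Qed.

(** Choose [m_0, m_1, ...] successively so that [energy_step] at [m_j] is at
    least [M - 4^-j] and the product of the gradients at [m_j] and [m_(j+1)] is
    within [4^-j] of its limit, [energy_step] at [m_j].  As the norms are at
    most [M], the squared distance of consecutive gradients is at most
    [2 M - 2 (M - 2 * 4^-j) = 4 * 4^-j].  The limit is a weak gradient of [f]
    because [T m f] tends to [f] weakly. *)
Theorem bounded_rot_grad : exists H, rot_grad (@C1 R) f H.
Proof.
pose s j := projT1 (choice (step j)); pose hs j := projT2 (choice (step j)).
have [m0 _ am0] := a_ge 0 (ltr01 : 0 < 1 :> R).
pose mm := fix mm j := if j is j'.+1 then s j' (mm j') else m0.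
have amm j : M - 4^-1 ^+ j <= energy_step f (mm j).
  case: j => [|j] /=; first by rewrite expr0.
  by have [] := hs j (mm j).
have dist j : \sum_(i < 3) I (fun x => (Hm (mm j) i x - Hm (mm j.+1) i x) ^+ 2)
    <= 4 * 4^-1 ^+ j.
  rewrite mollified_dot_dist//; have [_ _] := hs j (mm j).
  rewrite -/(mm j.+1) ler_norml => /andP[h1 _].
  by have := HM (mm j); have := HM (mm j.+1); have := amm j; lra.
have Hlim i : exists v, L2 v /\
    vanishes (fun j => I (fun x => (Hm (mm j) i x - v x) ^+ 2)).
  have [|j|v v2 vv] := @L2_fast_cauchy _ _ _ (@sigma R) (fun j => Hm (mm j) i).
  - by move=> j; exact: L2_Hm.
  - apply: le_trans (dist j).
    rewrite (bigD1 i)//= -[X in X <= _]addr0; apply: lerD.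
      rewrite le_eqVlt; apply/orP; left; apply/eqP; apply: eq_I => x; ring.
    by apply: sumr_ge0 => k _; apply: I_ge0 => x; exact: sqr_ge0.
  by exists v.
have [H hH] := choice Hlim.
exists H; split=> [i|i P CP]; first by case: (hH i).
have [H2 Hv] := hH i.
have bP := bmeas_C1 CP; have bRP := bmeas_Rd i CP.
have P2 : L2 (fun x : S => P (val x)) by exact: L2_bmeas.
have RP2 : L2 (fun x : S => Rd i P (val x)) by exact: L2_bmeas.
apply: (@vanishes_uniq _ (fun j => I (fun x => Hm (mm j) i x * P (val x)))).
  apply: (@vanishes_sqrt _ _ _ (I (fun x : S => P (val x) ^+ 2)) Hv) => j.
  have m2 := L2_Hm f2 (mm j) i.
  rewrite -IB; [|exact: L2_mul|exact: L2_mul].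
  rewrite (eq_I _ (g := fun x : S => P (val x) * (Hm (mm j) i x - H i x))).
    by apply: I_CS => //; exact: L2B.
  by move=> x; ring.
move=> e /(dform_vanishes RP2 f2)[n0 hn]; exists n0.+1 => -[//|j] n0j.
have jm : (n0 <= (mm j.+1).+1)%N.
  have [jm _ _] := hs j (mm j).
  by rewrite leqW// (leq_trans _ jm).
have := hn _ jm; rewrite (mollified_rot_grad f2 (mm j.+1)).2//.
have LT : L1 (fun x : S => Rd i P (val x) * op (kn (mm j.+1).+1) f x) by exact: L1_fT.
rewrite opprK /dform.
rewrite (eq_I _ (f := fun x : S => Rd i P (val x) * f x)
  (g := fun x : S => f x * Rd i P (val x))); last by move=> x; exact: mulrC.
rewrite (eq_I _ (f := fun x : S => Rd i P (val x) * _)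
  (g := fun x : S => op (kn (mm j.+1).+1) f x * Rd i P (val x))); last by move=> x; exact: mulrC.
by rewrite addrC.
Qed.

End bounded_energy.

(** * Polynomial vector fields *)

Section polynomial_maps.
Context (R : realType).
Local Notation V := 'rV[R]_3.
Implicit Types (P Q : V -> R).

(** A class of functions that contains the test functions in use, is closed
    under directional derivatives, and consists of C1 functions; smoothness
    follows by induction on the order. *)
Inductive polyfun : (V -> R) -> Prop :=
| polyfun_cst c : polyfun (cst c)
| polyfun_coord j : polyfun (fun v => v 0 j)
| polyfunD P Q : polyfun P -> polyfun Q -> polyfun (fun v => P v + Q v)
| polyfunM P Q : polyfun P -> polyfun Q -> polyfun (fun v => P v * Q v).

Lemma eq_polyfun P Q : P =1 Q -> polyfun Q -> polyfun P.
Proof. by move=> /funext ->. Qed.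

Lemma polyfun_C1 P : polyfun P -> C1 P.
Proof.
elim=> [c|j|? ? _ ? _ ?|? ? _ ? _ ?].
- exact: C1_cst.
- exact: C1_coord.
- exact: C1D.
- exact: C1M.
Qed.

Lemma polyfun_derive P u : polyfun P -> polyfun (fun v => 'D_u P v).
Proof.
elim=> [c|j|P1 P2 p1 IH1 p2 IH2|P1 P2 p1 IH1 p2 IH2].
- by apply: (eq_polyfun _ (polyfun_cst 0)) => v; rewrite derive_cst.
- by apply: (eq_polyfun _ (polyfun_cst (u 0 j))) => v; rewrite derive_coordE.
- apply: (eq_polyfun _ (polyfunD IH1 IH2)) => v.
  by rewrite deriveD//; exact/diff_derivable/C1_diff/polyfun_C1.
- apply: (eq_polyfun _ (polyfunD (polyfunM p1 IH2) (polyfunM p2 IH1))) => v.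
  by rewrite deriveM//; exact/diff_derivable/C1_diff/polyfun_C1.
Qed.

Lemma polyfunX P n : polyfun P -> polyfun (fun v => P v ^+ n).
Proof.
move=> pP; elim: n => [|n IH].
  by apply: (eq_polyfun _ (polyfun_cst 1)) => v; rewrite expr0.
by apply: (eq_polyfun _ (polyfunM pP IH)) => v; rewrite exprS.
Qed.

Lemma polyfun_dot a : polyfun (fun v => dot a v).
Proof.
have p j := polyfunM (polyfun_cst (a 0 j)) (polyfun_coord j).
apply: (eq_polyfun _ (polyfunD (polyfunD (p 0) (p 1)) (p 2))) => v.
by rewrite dotE.
Qed.

Lemma polyfun_cos2_half a : polyfun (cos2_half a).
Proof.
apply: polyfunM; last exact: polyfun_cst.
by apply: polyfunD; [exact: polyfun_cst|exact: polyfun_dot].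
Qed.

Lemma polyfun_rot i j : polyfun (fun v => rot i v 0 j).
Proof.
have pN k : polyfun (fun v => - v 0 k).
  apply: (eq_polyfun _ (polyfunM (polyfun_cst (-1)) (polyfun_coord k))) => v.
  by rewrite /= mulN1r.
have p0 := polyfun_cst 0.
elim/ord3P: i; elim/ord3P: j; [apply: (eq_polyfun _ p0)|
  apply: (eq_polyfun _ (pN 2))|apply: (eq_polyfun _ (polyfun_coord 1))|
  apply: (eq_polyfun _ (polyfun_coord 2))|apply: (eq_polyfun _ p0)|
  apply: (eq_polyfun _ (pN 0))|apply: (eq_polyfun _ (pN 1))|
  apply: (eq_polyfun _ (polyfun_coord 0))|apply: (eq_polyfun _ p0)] => v;
  by rewrite ?rot0E ?rot1E ?rot2E vec3E.
Qed.

Lemma ktest_polyfun P : ktest P -> polyfun P.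
Proof.
move=> [[n [a ->]]|[n [i [a ->]]]].
  by apply: polyfunM; [exact: polyfun_cst|apply: polyfunX; exact: polyfun_cos2_half].
rewrite rkfunE; apply: polyfunM; last exact: polyfun_dot.
by apply: polyfunM; [exact: polyfun_cst|apply: polyfunX; exact: polyfun_cos2_half].
Qed.

Lemma differentiable_row (F : 'I_3 -> V -> R) v :
  (forall j, differentiable (F j) v) ->
  differentiable (fun v => \row_j F j v) v.
Proof.
move=> dF.
rewrite (_ : (fun v => _) = \sum_(j < 3) (fun v => F j v *: (delta_mx 0 j : V))).
  by apply: differentiable_sum => j; exact: differentiableZl.
apply/funext => w; rewrite fct_sumE [LHS]row_sum_delta.
by apply: eq_bigr => j _; rewrite mxE.
Qed.

Lemma derive_row (F : 'I_3 -> V -> R) v u :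
  (forall j, differentiable (F j) v) ->
  'D_u (fun v => \row_j F j v) v = \row_j 'D_u (F j) v.
Proof.
move=> dF; rewrite derive_mx; last exact/diff_derivable/differentiable_row.
apply/rowP => j; rewrite !mxE; congr ('D_u _ v).
by apply/funext => w; rewrite mxE.
Qed.

Lemma polyfun_smooth (F : 'I_3 -> V -> R) : (forall j, polyfun (F j)) ->
  smooth (fun v => \row_j F j v).
Proof.
move=> pF k; elim: k F pF => [|k IH] F pF.
  move=> v; apply: differentiable_continuous; apply: differentiable_row => j.
  exact/C1_diff/polyfun_C1.
split => [v|h].
  by apply: differentiable_row => j; exact/C1_diff/polyfun_C1.
rewrite (_ : (fun v => _) = (fun v => \row_j 'D_h (F j) v)).
  by apply: (IH (fun j v => 'D_h (F j) v)) => j; exact: polyfun_derive.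
apply/funext => v; rewrite derive_row// => j.
exact/C1_diff/polyfun_C1.
Qed.

End polynomial_maps.

(** * Weak gradients and rotational gradients *)

Section weak_gradients.
Context (R : realType).
Local Notation S := (S2 R).
Local Notation V := 'rV[R]_3.
Local Notation I := (mean (@sigma R)).
Local Notation L1 := (is_L1 (@sigma R)).
Local Notation L2 := (is_L2 (@sigma R)).
Implicit Types (f g h : S -> R) (P : V -> R) (X : V -> V).

Lemma dotZl c (u v : V) : dot (c *: u) v = c * dot u v.
Proof. by rewrite /dot mulr_sumr; apply: eq_bigr => i _; rewrite mxE mulrA. Qed.

Lemma dotDl (u v w : V) : dot (u + v) w = dot u w + dot v w.
Proof. by rewrite /dot -big_split; apply: eq_bigr => i _; rewrite mxE mulrDl. Qed.

Lemma dot_rotx i (v : V) : dot (rot i v) v = 0.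
Proof. by rewrite dotE; elim/ord3P: i; rewrite ?rot0E ?rot1E ?rot2E !vec3E; ring. Qed.

Lemma derive_rot i j u (v : V) : 'D_u (fun v : V => rot i v 0 j) v = rot i u 0 j.
Proof.
have E (F : V -> R) (c : R) : (fun v : V => rot i v 0 j) = F -> 'D_u F v = c ->
  rot i u 0 j = c -> 'D_u (fun v : V => rot i v 0 j) v = rot i u 0 j.
  by move=> -> -> ->.
have N k : 'D_u (fun v : V => - v 0 k) v = - u 0 k.
  rewrite deriveN; last exact/diff_derivable/C1_diff/C1_coord.
  by rewrite derive_coordE.
have c k := derive_coordE k v u; have Z := derive_cst (0 : R) v u.
elim/ord3P: i E; elim/ord3P: j => E; [apply: (E _ _ _ Z)|
  apply: (E _ _ _ (N 2))|apply: (E _ _ _ (c 1))|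
  apply: (E _ _ _ (c 2))|apply: (E _ _ _ Z)|
  apply: (E _ _ _ (N 0))|apply: (E _ _ _ (N 1))|
  apply: (E _ _ _ (c 0))|apply: (E _ _ _ Z)];
  try (by apply/funext => w; rewrite ?rot0E ?rot1E ?rot2E vec3E);
  by rewrite ?rot0E ?rot1E ?rot2E vec3E.
Qed.

(** Rotation fields are divergence free, and the normal part of the derivative
    vanishes because they are tangent to all spheres around the origin. *)
Lemma div_rotation_field P i x : C1 P ->
  div_S2 (fun v => \row_j (P v * rot i v 0 j)) x = Rd i P x.
Proof.
move=> CP.
have dr j : C1 (fun v : V => rot i v 0 j) by exact/polyfun_C1/polyfun_rot.
have dF j : differentiable (fun v => P v * rot i v 0 j) x.
  exact/C1_diff/C1M.
have D u j : ('D_u (fun v => \row_j (P v * rot i v 0 j)) x) 0 j =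
    P x * rot i u 0 j + rot i x 0 j * 'D_u P x.
  rewrite derive_row// mxE deriveM; [|exact/diff_derivable/C1_diff..].
  by rewrite derive_rot.
rewrite /div_S2 (eq_bigr _ (fun j _ => D (delta_mx 0 j) j)) big_split/=.
rewrite -mulr_sumr.
have -> : \sum_(j < 3) rot i (delta_mx 0 j : V) 0 j = 0.
  by rewrite sum3; elim/ord3P: i {dr dF D}; rewrite ?rot0E ?rot1E ?rot2E !vec3E !mxE/=; ring.
rewrite mulr0 add0r -RdE//.
rewrite (_ : dot _ x = (P x + 'D_x P x) * dot (rot i x) x).
  by rewrite dot_rotx mulr0 subr0.
by rewrite /dot mulr_sumr; apply: eq_bigr => j _; rewrite D; ring.
Qed.

(** The derivative along the [i]-th rotation of a function with gradient
    [G]. *)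
Definition rot_comp (G : S -> V) (i : 'I_3) (x : S) : R := dot (G x) (rot i (val x)).

Lemma bmeas_rot i j : bmeas (fun x : S => rot i (val x) 0 j).
Proof. exact/(bmeas_C1 (h := fun v => rot i v 0 j))/polyfun_C1/polyfun_rot. Qed.

Lemma L2_rot_comp (G : S -> V) i : (forall j, L2 (fun x => G x 0 j)) -> L2 (rot_comp G i).
Proof.
move=> G2; apply: L2_sum => j; apply: L2M => //; exact: bmeas_rot.
Qed.

(** Test the weak gradient against the field [P (e_i x v)], whose divergence is
    [R_i P]. *)
Lemma weak_gradient_rot_grad f G : L2 f -> weak_gradient f G ->
  rot_grad (@ktest R) f (rot_comp G).
Proof.
move=> f2 [G2 tG wG]; have G2' j : L2 (fun x => G x 0 j) by exact/L2_Lfun.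
split=> [i|i P kP]; first exact: L2_rot_comp.
have pP := ktest_polyfun kP; have CP := polyfun_C1 pP.
pose X v := \row_j (P v * rot i v 0 j).
have XE v : X v = P v *: rot i v by apply/rowP => j; rewrite !mxE.
have sX : smooth X.
  apply: (@polyfun_smooth _ (fun j v => P v * rot i v 0 j)) => j.
  exact: (polyfunM pP (polyfun_rot _ i j)).
have tX : tangent (fun x : S => X (val x)).
  by move=> x; rewrite XE dotZl dot_rotx mulr0.
have := wG X sX tX.
rewrite (_ : (fun x => _) = (fun x : S => (rot_comp G i x * P (val x))%:E)); last first.
  by apply/funext => x; rewrite XE /rot_comp dotC dotZl dotC mulrC.
rewrite [in X in _ = (- X)%E](_ : (fun x => _) = (fun x : S => (f x * Rd i P (val x))%:E)); last first.
  by apply/funext => x; rewrite div_rotation_field.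
rewrite !IE.
- by rewrite -EFinN => -[].
- by apply: L1M; [exact: L2_L1|exact: bmeas_Rd].
- by apply: L1M; [exact/L2_L1/L2_rot_comp|exact: bmeas_C1].
Qed.

Lemma rot_comp_energy G x : dot (G x) (val x) = 0 ->
  \sum_(i < 3) rot_comp G i x ^+ 2 = dot (G x) (G x).
Proof. by move=> h; rewrite /rot_comp sum_dot_rot_sqr h dotxx; ring. Qed.

(** At a point of the sphere the three rotation fields form a tight frame of
    the tangent plane, with frame constant 1; this is the synthesis map, and
    [rot_comp] is the analysis map. *)
Definition rot_field (H : 'I_3 -> S -> R) (x : S) : V :=
  \sum_(i < 3) H i x *: rot i (val x).

Lemma smooth_diff X v : smooth X -> differentiable X v.
Proof. by move=> /(_ 1%N) []. Qed.

Lemma smooth_coord X j : smooth X -> C1 (fun v => X v 0 j).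
Proof.
move=> sX; apply: (@C1_intro _ _ (fun u v => ('D_u X v) 0 j)) => [v|u v|u].
- apply: (@differentiable_comp _ _ _ _ X (fun w : V => w 0 j)).
    exact: smooth_diff.
  exact: differentiable_coord.
- by rewrite derive_mx ?mxE//; exact/diff_derivable/smooth_diff.
- have [_ /(_ u) cD] := sX 1%N => v.
  apply: (@continuous_comp _ _ _ (fun v => 'D_u X v) (fun w : V => w 0 j)).
    exact: cD.
  exact: coord_continuous.
Qed.

Lemma C1_sum n (F : 'I_n -> V -> R) : (forall i, C1 (F i)) ->
  C1 (fun v => \sum_(i < n) F i v).
Proof.
elim: n F => [F _|n IH F CF].
  by under eq_fun do rewrite big_ord0; exact: C1_cst.
by under eq_fun do rewrite big_ord_recr/=; apply: C1D => //; exact: IH.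
Qed.

Lemma smooth_rot_dot X i : smooth X -> C1 (fun v => dot (rot i v) (X v)).
Proof.
move=> sX; apply: C1_sum => j; apply: C1M; last exact: smooth_coord.
exact/polyfun_C1/polyfun_rot.
Qed.

Lemma Rd_rot_dot X i v : smooth X ->
  Rd i (fun v => dot (rot i v) (X v)) v =
  dot (rot i (rot i v)) (X v) + dot (rot i v) ('D_(rot i v) X v).
Proof.
move=> sX.
have Cr j : C1 (fun v : V => rot i v 0 j) by exact/polyfun_C1/polyfun_rot.
have CX j := smooth_coord j sX.
have DX u j : 'D_u (fun v => X v 0 j) v = ('D_u X v) 0 j.
  by rewrite derive_mx ?mxE//; exact/diff_derivable/smooth_diff.
have CM j := C1M (Cr j) (CX j).
rewrite (_ : (fun v => _) = (fun v => rot i v 0 0 * X v 0 0 + rot i v 0 1 * X v 0 1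
  + rot i v 0 2 * X v 0 2)); last by apply/funext => w; rewrite dotE.
rewrite (RdD i v (C1D (CM 0) (CM 1)) (CM 2)) (RdD i v (CM 0) (CM 1)).
rewrite !(RdM i v (Cr _) (CX _)) /Rd !derive_rot !DX !dotE.
by ring.
Qed.

(** The divergence of a tangent field is the sum of the rotational derivatives
    of its components in the frame of rotations: the terms where the frame is
    differentiated add up to [-2 (X . v) = 0], and the others add up to the
    trace of the differential on the tangent plane. *)
Lemma div_tangent X v : smooth X -> dot (X v) v = 0 -> dot v v = 1 ->
  \sum_(i < 3) Rd i (fun v => dot (rot i v) (X v)) v = div_S2 X v.
Proof.
move=> sX tX v1; rewrite (eq_bigr _ (fun i _ => Rd_rot_dot i v sX)).
rewrite big_split/=.
have -> : \sum_(i < 3) dot (rot i (rot i v)) (X v) = 0.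
  rewrite (_ : \sum_(i < 3) _ = - 2 * dot (X v) v); first by rewrite tX mulr0.
  rewrite sum3 !dotE !rot0E !rot1E !rot2E ?vec3E ?rot0E ?rot1E ?rot2E ?vec3E.
  by ring.
rewrite add0r /div_S2.
have DE u : 'D_u X v = u 0 0 *: 'D_(delta_mx 0 0) X v +
    u 0 1 *: 'D_(delta_mx 0 1) X v + u 0 2 *: 'D_(delta_mx 0 2) X v.
  rewrite !deriveE; try exact: smooth_diff.
  rewrite -!linearZ -!linearD/=; congr ('d X v _).
  by apply/rowP; elim/ord3P; rewrite !mxE/=; ring.
rewrite !sum3 (DE v) (DE (rot 0 v)) (DE (rot 1 v)) (DE (rot 2 v)).
move: ('D_(delta_mx 0 0) X v) ('D_(delta_mx 0 1) X v) ('D_(delta_mx 0 2) X v).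
move=> d0 d1 d2; move: v1; rewrite !dotE rot0E rot1E rot2E !vec3E => v1.
have E (c : R) (w : V) j : (c *: w) 0 j = c * w 0 j by rewrite mxE.
have F (w z : V) j : (w + z) 0 j = w 0 j + z 0 j by rewrite mxE.
rewrite !F !E -[d0 0 0 + _ + _ in RHS]mul1r -v1; ring.
Qed.

Lemma bmeas_rot_dot (X : V -> V) i : smooth X ->
  bmeas (fun x : S => dot (rot i (val x)) (X (val x))).
Proof. by move=> sX; exact: (bmeas_C1 (smooth_rot_dot i sX)). Qed.

(** Test the rotational gradient against the components of the vector field in
    the frame of rotations. *)
Lemma rot_grad_weak_gradient f H : L2 f -> rot_grad (@C1 R) f H ->
  weak_gradient f (rot_field H).
Proof.
move=> f2 [H2 wH].
have FE x : rot_field H x =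
    H 0 x *: rot 0 (val x) + H 1 x *: rot 1 (val x) + H 2 x *: rot 2 (val x).
  rewrite /rot_field !big_ord_recl big_ord0 addr0 addrA.
  by congr (_ + H _ x *: rot _ _ + H _ x *: rot _ _); exact/val_inj.
have dE x (w : V) : dot (rot_field H x) w =
    \sum_(i < 3) H i x * dot (rot i (val x)) w.
  by rewrite FE !dotDl !dotZl sum3.
split.
- move=> j; apply/L2_Lfun.
  rewrite (_ : (fun x => _) =
    (fun x : S => \sum_(i < 3) H i x * rot i (val x) 0 j)).
    by apply: L2_sum => i; apply: L2M => //; exact: bmeas_rot.
  apply/funext => x; rewrite FE sum3.
  have E (c : R) (w : V) : (c *: w) 0 j = c * w 0 j by rewrite mxE.
  have F (w z : V) : (w + z) 0 j = w 0 j + z 0 j by rewrite mxE.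
  by rewrite !F !E.
- by move=> x; rewrite dE big1// => i _; rewrite dot_rotx mulr0.
move=> X sX tX.
have b i := bmeas_rot_dot i sX.
have CP i := smooth_rot_dot i sX.
have bR i := bmeas_Rd i (CP i).
have LH i : L1 (fun x => H i x * dot (rot i (val x)) (X (val x))).
  by apply: L1M => //; exact: L2_L1.
have Lf i : L1 (fun x : S => f x * Rd i (fun v => dot (rot i v) (X v)) (val x)).
  by apply: L1M => //; exact: L2_L1.
rewrite (_ : (fun x => _) = (fun x : S =>
    (\sum_(i < 3) H i x * dot (rot i (val x)) (X (val x)))%:E)); last first.
  by apply/funext => x; rewrite dE.
rewrite [in X in _ = (- X)%E](_ : (fun x => _) = (fun x : S =>
    (\sum_(i < 3) f x * Rd i (fun v => dot (rot i v) (X v)) (val x))%:E)); last first.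
  by apply/funext => x; rewrite -mulr_sumr div_tangent ?dotxx.
rewrite !IE; [|exact: L1_sum|exact: L1_sum].
rewrite -EFinN; congr EFin; rewrite !I_sum// -sumrN; apply: eq_bigr => i _.
exact: (wH i _ (CP i)).
Qed.

End weak_gradients.

(** * The kernel of the ensemble *)

Section spherical_kernel_modulus.
Context (R : realType).
Local Notation S := (S2 R).
Implicit Types (x y : S) (z w : R[i]).

Definition sqmod z : R := complex.Re z ^+ 2 + complex.Im z ^+ 2.

Lemma sqmod_ge0 z : 0 <= sqmod z.
Proof. by rewrite addr_ge0 ?sqr_ge0. Qed.

Lemma mul_conj z w : (1 + z * w^*%C) * (1 + w * z^*%C) =
  (sqmod (1 + z * w^*%C))%:C%C.
Proof.
case: z w => [a b] [c e]; rewrite /sqmod; simpc => /=.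
by apply/eqP; rewrite eq_complex/=; apply/andP; split; apply/eqP; ring.
Qed.

Lemma powR_half_sqr (a : R) n : 0 <= a ->
  (a `^ ((n.+1%:R - 1) / 2)) * (a `^ ((n.+1%:R - 1) / 2)) = a ^+ n.
Proof.
move=> a0; rewrite -expr2 -powR_mulrn ?powR_ge0// -powRrM.
rewrite divfK// -[n.+1]addn1 natrD addrK powR_mulrn//.
Qed.

Lemma spherical_kernel_mul n x y :
  let z := stereo x in let w := stereo y in
  spherical_kernel n.+1 x y * spherical_kernel n.+1 y x =
  (n.+1%:R ^+ 2 *
   (sqmod (1 + z * w^*%C) / ((1 + sqmod z) * (1 + sqmod w))) ^+ n)%:C%C.
Proof.
rewrite /spherical_kernel; move: (stereo x) (stereo y) => z w /=.
rewrite -/(sqmod z) -/(sqmod w).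
set c := (_ / 2).
set a := (1 + sqmod z) `^ c; set b := (1 + sqmod w) `^ c.
have aa : a * a = (1 + sqmod z) ^+ n.
  by rewrite powR_half_sqr// addr_ge0// sqmod_ge0.
have bb : b * b = (1 + sqmod w) ^+ n.
  by rewrite powR_half_sqr// addr_ge0// sqmod_ge0.
rewrite expr_div_n exprMn -aa -bb.
have -> : (n.+1%:R ^+ 2 * (sqmod (1 + z * w^*%C) ^+ n / (a * a * (b * b))))%:C%C =
  n.+1%:R ^+ 2 * ((1 + z * w^*%C) ^+ n * (1 + w * z^*%C) ^+ n /
    (a%:C * a%:C * (b%:C * b%:C))%C).
  rewrite -exprMn mul_conj (rmorphM (real_complex R)) rmorphXn/=.
  rewrite (rmorphM (real_complex R)) rmorphXn/= (fmorphV (real_complex R)).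
  by rewrite !(rmorphM (real_complex R)) rmorph_nat.
by rewrite !invfM; ring.
Qed.

Lemma spherical_kernel_diag n x : spherical_kernel n.+1 x x = n.+1%:R.
Proof.
rewrite /spherical_kernel; set z := stereo x => /=.
rewrite -/(sqmod z); set c := (_ / 2).
have s0 : 0 < 1 + sqmod z by rewrite ltr_wpDr ?sqmod_ge0.
have -> : 1 + z * z^*%C = (1 + sqmod z)%:C%C.
  rewrite /sqmod; case: (z) => a b; simpc => /=.
  by apply/eqP; rewrite eq_complex/=; apply/andP; split; apply/eqP; ring.
rewrite -rmorphM/= powR_half_sqr ?ltW// rmorphXn/=.
by rewrite mulfK// expf_neq0// fmorph_eq0 gt_eqF.
Qed.

(** The chordal distance in stereographic coordinates:
    [1 + |z|^2 = 2 / (1 - x_3)]. *)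
Lemma stereo_cos2_half x y : val x 0 2 != 1 -> val y 0 2 != 1 ->
  let z := stereo x in let w := stereo y in
  sqmod (1 + z * w^*%C) / ((1 + sqmod z) * (1 + sqmod w)) =
  cos2_half (val x) (val y).
Proof.
move=> x1 y1 z w.
have := dotxx x; have := dotxx y; rewrite /z /w /cos2_half /stereo /sqmod !dotE; simpc => /=.
move: (val x 0 2) (val y 0 2) x1 y1 => x2 y2 x1 y1.
move: (val x 0 0) (val x 0 1) (val y 0 0) (val y 0 1) => a b c e yE xE.
have xn : 1 - x2 != 0 by rewrite subr_eq0 eq_sym.
have yn : 1 - y2 != 0 by rewrite subr_eq0 eq_sym.
have -> : 1 + ((a / (1 - x2)) ^+ 2 + (b / (1 - x2)) ^+ 2) = 2 / (1 - x2).
  apply: (mulIf (expf_neq0 2 xn)).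
  have -> : (1 + ((a / (1 - x2)) ^+ 2 + (b / (1 - x2)) ^+ 2)) * (1 - x2) ^+ 2 =
    (1 - x2) ^+ 2 + a ^+ 2 + b ^+ 2 by field.
  have -> : 2 / (1 - x2) * (1 - x2) ^+ 2 = 2 * (1 - x2) by field.
  by nra.
have -> : 1 + ((c / (1 - y2)) ^+ 2 + (e / (1 - y2)) ^+ 2) = 2 / (1 - y2).
  apply: (mulIf (expf_neq0 2 yn)).
  have -> : (1 + ((c / (1 - y2)) ^+ 2 + (e / (1 - y2)) ^+ 2)) * (1 - y2) ^+ 2 =
    (1 - y2) ^+ 2 + c ^+ 2 + e ^+ 2 by field.
  have -> : 2 / (1 - y2) * (1 - y2) ^+ 2 = 2 * (1 - y2) by field.
  by nra.
have x2E : a ^+ 2 + b ^+ 2 = (1 - x2) * (1 + x2) by nra.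
have y2E : c ^+ 2 + e ^+ 2 = (1 - y2) * (1 + y2) by nra.
apply: (mulIf (mulf_neq0 xn yn)).
rewrite [LHS](_ : _ = ((1 - x2) * (1 - y2) * ((1 - x2) * (1 - y2)) +
   2 * ((1 - x2) * (1 - y2)) * (a * c + b * e) +
   (a ^+ 2 + b ^+ 2) * (c ^+ 2 + e ^+ 2)) / 4); last by field; rewrite xn yn.
by rewrite x2E y2E; field.
Qed.

End spherical_kernel_modulus.

(** * Measures on a square *)

Section disjoint_rectangles.
Local Open Scope ereal_scope.
Context d (T : measurableType d) (R : realType).
Variables m1 m2 : {measure set (T * T) -> \bar R}.
Hypothesis m1_fin : m1 setT < +oo.
Hypothesis m12_setT : forall A, measurable A ->
  m1 (A `*` setT) = m2 (A `*` setT).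
Hypothesis m12_disj : forall A B, measurable A -> measurable B ->
  A `&` B = set0 -> m1 (A `*` B) = m2 (A `*` B).

Let m1X A B : measurable A -> measurable B -> m1 (A `*` B) \is a fin_num.
Proof.
move=> mA mB; rewrite ge0_fin_numE//; apply: le_lt_trans m1_fin.
by apply: le_measure => //; rewrite inE; [exact: measurableX|exact: measurableT].
Qed.

Let splitr (m : {measure set (T * T) -> \bar R}) A B C : measurable A ->
  measurable B -> measurable C -> B `&` C = set0 ->
  m (A `*` (B `|` C)) = m (A `*` B) + m (A `*` C).
Proof.
move=> mA mB mC BC.
have -> : A `*` (B `|` C) = (A `*` B) `|` (A `*` C).
  by apply/seteqP; split => -[x y] /=; tauto.
rewrite measureU//; try exact: measurableX.
by rewrite -setXI BC setX0.
Qed.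

Let splitl (m : {measure set (T * T) -> \bar R}) A B C : measurable A ->
  measurable B -> measurable C -> A `&` B = set0 ->
  m ((A `|` B) `*` C) = m (A `*` C) + m (B `*` C).
Proof.
move=> mA mB mC AB.
have -> : (A `|` B) `*` C = (A `*` C) `|` (B `*` C).
  by apply/seteqP; split => -[x y] /=; tauto.
rewrite measureU//; try exact: measurableX.
by rewrite -setXI AB set0X.
Qed.

(** Two finite measures on a square that agree on products of disjoint sets and
    have the same first marginal are equal: subtracting [A x (~ A)] from
    [A x T] gives the value on [A x A], and every rectangle is cut into such
    pieces. *)
Lemma measure_disjoint_rectangles X : measurable X -> m1 X = m2 X.
Proof.
have diag A : measurable A -> m1 (A `*` A) = m2 (A `*` A).
  move=> mA; have mC := measurableC mA.
  have := m12_setT mA; rewrite -(setUv A) !splitr ?setICr//.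
  rewrite (m12_disj mA mC) ?setICr// => /(congr1 (fun x => x - m2 (A `*` ~` A))).
  by rewrite !addeK//; rewrite -(m12_disj mA mC) ?setICr//; exact: m1X.
have rect A B : measurable A -> measurable B -> m1 (A `*` B) = m2 (A `*` B).
  move=> mA mB.
  have mI := measurableI _ _ mA mB.
  have mD := measurableD mB mA; have mD' := measurableD mA mB.
  have dD : (B `&` A) `&` (B `\` A) = set0 by apply/seteqP; split => // x /= [[_ ?] []].
  have dI : (A `&` B) `&` (A `\` B) = set0 by apply/seteqP; split => // x /= [[_ ?] []].
  have mI' := measurableI _ _ mB mA.
  rewrite -(setUIDK B A) !splitr//; congr (_ + _); last first.
    by apply: m12_disj => //; rewrite setDE setICA setICr setI0.
  rewrite -[X in X `*` _](setUIDK A B) !splitl//; congr (_ + _).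
    by rewrite (setIC B A); exact: diag.
  by apply: m12_disj => //; apply/seteqP; split => // x /= [[_ ?] []].
pose G : set (set (T * T)) :=
  [set C | exists A, measurable A /\ exists B, measurable B /\ C = A `*` B].
move=> mX; apply: (measure_unique G (fun=> setT)) => //.
- rewrite measurable_prod_measurableType //; congr (<<s _ >>).
  rewrite predeqE; split => [[A mA [B mB <-]]|[A [mA [B [mB ->]]]]].
    by exists A; split => //; exists B.
  by exists A => //; exists B.
- move=> /= _ _ [X1 [mX1 [X2 [mX2 ->]]]] [Y1 [mY1 [Y2 [mY2 ->]]]].
  rewrite -setXI; exists (X1 `&` Y1); split; first exact: measurableI.
  by exists (X2 `&` Y2); split => //; exact: measurableI.
- by move=> _; exists setT; split => //; exists setT; split => //; rewrite setXTT.
- exact: bigcup_const.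
- by move=> A [A1 [mA1 [A2 [mA2 ->]]]]; exact: rect.
Qed.

End disjoint_rectangles.

Section density.
Local Open Scope ereal_scope.
Context d (T : measurableType d) (R : realType).
Variables (mu : {measure set T -> \bar R}) (w : T -> R).
Hypotheses (mw : measurable_fun setT w) (w0 : forall x, (0 <= w x)%R).

(** The proofs of measurability and positivity are arguments so that the
    measure structure can be inferred from the term. *)
Definition density (_ : measurable_fun setT w) (_ : forall x, (0 <= w x)%R)
  (A : set T) := \int[mu]_(x in A) (w x)%:E.
Local Notation dens := (density mw w0).

Let density0 : dens set0 = 0.
Proof. exact: integral_set0. Qed.

Let density_ge0 A : 0 <= dens A.
Proof. by apply: integral_ge0 => x _; rewrite lee_fin. Qed.

Let density_sigma_additive : semi_sigma_additive dens.
Proof.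
move=> F mF tF mUF; rewrite /density ge0_integral_bigcup//=.
- apply: is_cvg_ereal_nneg_natsum_cond => n _ _.
  by apply: integral_ge0 => x _; rewrite lee_fin.
- exact/measurable_funTS/measurable_EFinP.
- by move=> x _; rewrite lee_fin.
Qed.

HB.instance Definition _ := isMeasure.Build _ T R dens
  density0 density_ge0 density_sigma_additive.

Lemma ge0_integral_density_weight (f : T -> \bar R) :
  measurable_fun setT f -> (forall x, 0 <= f x) ->
  \int[dens]_x f x = \int[mu]_x (f x * (w x)%:E).
Proof.
by move=> mf f0; apply: (ge0_integral_density (phi := id)) => // A mA; rewrite setTI.
Qed.

End density.

(** * Laws of one and of two points *)

Section pair.
Context d d1 d2 (T : measurableType d) (T1 : measurableType d1)
  (T2 : measurableType d2).
Variables (X : {mfun T >-> T1}) (Y : {mfun T >-> T2}).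

Definition pair_fun w := (X w, Y w).

Lemma measurable_pair_fun : measurable_fun setT pair_fun.
Proof. exact: measurable_fun_pair. Qed.

HB.instance Definition _ := isMeasurableFun.Build _ _ _ _ pair_fun
  measurable_pair_fun.
End pair.

Section spherical_ensemble_moments.
Context (R : realType) d (Omega : measurableType d) (P : probability Omega R).
Variables (n : nat) (x : 'I_n.+1 -> {RV P >-> S2 R}).
Hypothesis hx : spherical_ensemble P x.
Local Notation S := (S2 R).
Local Notation N := (n.+1%:R : R).

(** The two-point joint intensity [K(x, x) K(y, y) - |K(x, y)|^2]. *)
Definition pair_density (p : S * S) : R := N ^+ 2 - N * kn n p.1 p.2.

Lemma pair_density_ge0 p : 0 <= pair_density p.
Proof. by rewrite subr_ge0 expr2 ler_wpM2l// kn_le. Qed.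

Lemma measurable_pair_density : measurable_fun setT pair_density.
Proof.
apply: measurable_funB => //; apply: measurable_funM => //.
by have [] := @bker_kn R n.
Qed.

Lemma count_points_indic (A : set S) w :
  count_points x A w = \sum_(i < n.+1) \1_(x i @^-1` A) w.
Proof. by []. Qed.

Lemma measurable_preimage_point i (A : set S) : measurable A ->
  measurable (x i @^-1` A).
Proof. by move=> mA; rewrite -[X in measurable X]setTI; exact: measurable_funPT. Qed.

Lemma one_point_law (A : set S) : measurable A ->
  (\sum_(i < n.+1) P (x i @^-1` A) = N%:E * sigma A)%E.
Proof.
move=> mA; have [_ /(_ 1 isT)[rho [_ _ _ rhoE] rhoK]] := hx.
have rN t : rho t = N.
  apply: (@complexI R).
  rewrite rhoK det_mx11 mxE spherical_kernel_diag.
  by rewrite rmorph_nat.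
have -> : (\sum_(i < n.+1) P (x i @^-1` A))%E = (\int[P]_w (count_points x A w)%:E)%E.
  under [RHS]eq_integral do rewrite count_points_indic -sumEFin.
  rewrite ge0_integral_sum//; last first.
    move=> i; apply/measurable_EFinP; apply: measurable_indic.
    exact: measurable_preimage_point.
  by apply: eq_bigr => i _; rewrite integral_indic ?setIT//; exact: measurable_preimage_point.
have tA : trivIset [set: 'I_1] (fun=> A).
  by apply/trivIsetP => i j _ _; rewrite (ord1 i) (ord1 j) eqxx.
have := rhoE (fun=> A) (fun=> mA) tA; rewrite unlock.
rewrite (_ : (fun w => _) = (fun w => (count_points x A w)%:E)); last first.
  by apply/funext => w; rewrite big_ord1.
move=> -> /=.
rewrite (_ : (fun s => _) = (fun s => (N%:E * (\1_A s)%:E)%E)); last first.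
  by apply/funext => s; rewrite big_ord1 rN.
rewrite ge0_integralZl_EFin//; last exact/measurable_EFinP/measurable_indic.
by rewrite integral_indic// setIT.
Qed.

Lemma det_mx22 (F : comRingType) (M : 'M[F]_2) :
  \det M = M 0 0 * M 1 1 - M 0 1 * M 1 0.
Proof.
rewrite (expand_det_row _ 0) !big_ord_recl big_ord0 addr0 /cofactor !det_mx11.
rewrite !mxE/= expr0 expr1 mul1r mulN1r mulrN.
by congr (M _ _ * M _ _ - M _ _ * M _ _); exact/val_inj.
Qed.

(** The joint intensity and [pair_density] differ only where one of the two
    points is the pole. *)
Lemma two_point_law (A B : set S) : measurable A -> measurable B ->
  A `&` B = set0 ->
  (\sum_(i < n.+1) \sum_(j < n.+1) P (pair_fun (x i) (x j) @^-1` (A `*` B)) =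
   \int[@sigma R \x @sigma R]_(p in A `*` B) (pair_density p)%:E)%E.
Proof.
move=> mA mB AB; have [_ /(_ 2%N isT)[rho [mrho rho0 _ rhoE] rhoK]] := hx.
have mAB : measurable (A `*` B) by exact: measurableX.
have rN (s t : S) : val s 0 2 != 1 -> val t 0 2 != 1 ->
    rho [tuple s; t] = pair_density (s, t).
  move=> s1 t1; apply: (@complexI R); rewrite rhoK det_mx22 !mxE.
  rewrite !(tnth_nth s)/= !spherical_kernel_diag spherical_kernel_mul.
  rewrite stereo_cos2_half// /pair_density /kn /kfun/=.
  rewrite rmorphB/= !rmorphM rmorphXn/= !rmorph_nat.
  by rewrite mulrA.
have mP i j : measurable (pair_fun (x i) (x j) @^-1` (A `*` B)).
  by rewrite -[X in measurable X]setTI; exact: measurable_funPT.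
pose BB (i : 'I_2) := if i == 0 then A else B.
have mBB i : measurable (BB i) by rewrite /BB; case: ifP.
have tBB : trivIset [set: 'I_2] BB.
  apply/trivIsetP => i j _ _; rewrite /BB.
  by case: i => [[|[|//]] ?]; case: j => [[|[|//]] ?] //= _; rewrite setIC.
have -> : (\sum_(i < n.+1) \sum_(j < n.+1)
    P (pair_fun (x i) (x j) @^-1` (A `*` B)) =
    \int[P]_w (count_points x A w * count_points x B w)%:E)%E.
  rewrite (_ : (fun w => _) = (fun w => \sum_(i < n.+1) \sum_(j < n.+1)
      (\1_(pair_fun (x i) (x j) @^-1` (A `*` B)) w)%:E)%E); last first.
    apply/funext => w; under eq_bigr do rewrite sumEFin.
    rewrite sumEFin; congr EFin; rewrite /count_points mulr_suml.
    apply: eq_bigr => i _; rewrite mulr_sumr; apply: eq_bigr => j _.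
    by rewrite !indicE -natrM mulnb; congr ((nat_of_bool _)%:R); exact: (esym (in_setX (x i w, x j w) A B)).
  rewrite ge0_integral_sum//; last 2 first.
    - move=> i; apply: emeasurable_sum => j.
      exact/measurable_EFinP/measurable_indic.
    - by move=> i w _; apply: sume_ge0 => j _; rewrite lee_fin.
  apply: eq_bigr => i _; rewrite ge0_integral_sum//; last first.
    by move=> j; exact/measurable_EFinP/measurable_indic.
  by apply: eq_bigr => j _; rewrite integral_indic// setIT.
have := rhoE BB mBB tBB; rewrite unlock.
rewrite (_ : (fun w => _) =
    (fun w => (count_points x A w * count_points x B w)%:E)); last first.
  by apply/funext => w; rewrite !big_ord_recl big_ord0 mulr1.
move=> -> /=.
pose h (p : S * S) : \bar R := (rho [tuple p.1; p.2] * (\1_A p.1 * \1_B p.2))%:E.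
rewrite (_ : (fun s => _) = fubini_F (@sigma R) h); last first.
  apply/funext => s; apply: eq_integral => t _.
  by rewrite /h !big_ord_recl big_ord0 mulr1.
have mrho' : measurable_fun setT (fun p : S * S => rho [tuple p.1; p.2]).
  apply: measurableT_comp => //; apply: measurable_cons => //.
  by apply: measurable_cons => //; exact: measurable_cst.
have mh : measurable_fun setT h.
  apply/measurable_EFinP; apply: measurable_funM => //; apply: measurable_funM.
    by apply: measurableT_comp => //; exact: measurable_indic.
  by apply: measurableT_comp => //; exact: measurable_indic.
rewrite -fubini_tonelli1//; last by move=> p; rewrite lee_fin !mulr_ge0// rho0.
rewrite [RHS]integral_mkcond epatch_indic.
apply: ge0_ae_eq_integral => //=.
- apply: emeasurable_funM; apply/measurable_EFinP; last exact: measurable_indic.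
  exact: measurable_pair_density.
- by move=> p _; rewrite lee_fin !mulr_ge0// rho0.
- by move=> p _; rewrite mule_ge0// lee_fin ?pair_density_ge0.
pose pole := [set s : S | val s 0 2 = 1].
have mpole : measurable pole.
  have := measurable_coord (R := R) 2 measurableT (measurable_set1 1).
  by rewrite setTI; congr measurable; apply/seteqP; split => s /=.
exists (pole `*` setT `|` setT `*` pole); split.
- by apply: measurableU; exact: measurableX.
- have E0 : @sigma R pole = 0%E by exact: sigma_pole.
  have E1 : (@sigma R \x @sigma R)%E (pole `*` setT) = 0%E.
    by rewrite product_measure1E// [X in (X * _)%E]E0 mul0e.
  have E2 : (@sigma R \x @sigma R)%E (setT `*` pole) = 0%E.
    by rewrite product_measure1E// [X in (_ * X)%E]E0 mule0.
  by apply: (etrans (measureU0 _ _ E2)) => //; exact: measurableX.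
move=> [s t]; apply: contra_notP => /not_orP[/= s1 t1] _.
rewrite /h/= rN; [|by apply/eqP => ?; apply: s1|by apply/eqP => ?; apply: t1].
rewrite EFinM; congr (_ * _)%E; congr EFin; rewrite !indicE -natrM mulnb.
by congr ((nat_of_bool _)%:R); exact: (esym (in_setX (s, t) A B)).
Qed.
End spherical_ensemble_moments.

Section diagonal.
Context d (T : measurableType d).

Definition diagonal (s : T) := (s, s).

Lemma measurable_diagonal : measurable_fun setT diagonal.
Proof. exact: measurable_fun_pair. Qed.

HB.instance Definition _ := isMeasurableFun.Build _ _ _ _ diagonal
  measurable_diagonal.

End diagonal.

Section pair_law.
Context (R : realType) d (Omega : measurableType d) (P : probability Omega R).
Variables (n : nat) (x : 'I_n.+1 -> {RV P >-> S2 R}).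
Hypothesis hx : spherical_ensemble P x.
Local Notation S := (S2 R).
Local Notation N := (n.+1%:R : R).

Lemma sum_ord_cst_ereal m (c : \bar R) : (\sum_(j < m) c = m%:R%:E * c)%E.
Proof. by rewrite mule_natl sumr_const card_ord. Qed.

(** The mean of the number of ordered pairs of points in a set, a point being
    also paired with itself. *)
Definition pair_law : set (S * S) -> \bar R :=
  msum (fun i => msum (fun j =>
    distribution P (pair_fun (x (inord i)) (x (inord j)))) n.+1) n.+1.
HB.instance Definition _ := Measure.on pair_law.

Lemma pair_lawE C :
  (pair_law C = \sum_(i < n.+1) \sum_(j < n.+1) P (pair_fun (x i) (x j) @^-1` C))%E.
Proof.
rewrite /pair_law/= /msum; apply: eq_bigr => i _; apply: eq_bigr => j _.
by rewrite !inord_val.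
Qed.

(** What [pair_law] is: distinct points contribute the two-point intensity, the
    pairs of equal points contribute [N] times the surface measure on the
    diagonal. *)
Definition pair_measure : set (S * S) -> \bar R :=
  measure_add
    (density (@sigma R \x @sigma R)%E (@measurable_pair_density R n) (@pair_density_ge0 R n))
    (mscale (NngNum (ler0n R n.+1)) (distribution (@sigma R) (@diagonal _ S))).
HB.instance Definition _ := Measure.on pair_measure.

Lemma pair_measureE C : (pair_measure C =
  \int[(@sigma R \x @sigma R)%E]_(p in C) (pair_density n p)%:E +
  N%:E * sigma [set s | C (s, s)])%E.
Proof. by rewrite /pair_measure measure_addE. Qed.

Lemma integral_pair_density_setT (A : set S) : measurable A ->
  (\int[(@sigma R \x @sigma R)%E]_(p in A `*` setT) (pair_density n p)%:E =
   (N ^+ 2 - N)%:E * sigma A)%E.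
Proof.
move=> mA.
have mw := (@measurable_pair_density R n).
rewrite integral_mkcond epatch_indic.
rewrite (eq_integral (fun p : S * S => (pair_density n p * \1_A p.1)%:E)); last first.
  move=> p _ /=; rewrite EFinM; congr (_ * _)%E; congr EFin.
  by rewrite !indicE (in_setX p) in_setT andbT.
rewrite fubini_tonelli1; last 2 first.
- apply/measurable_EFinP; apply: measurable_funM => //.
  by apply: measurableT_comp => //; exact: measurable_indic.
- by move=> p; rewrite lee_fin mulr_ge0// pair_density_ge0.
rewrite (_ : fubini_F _ _ = (fun s => (N ^+ 2 - N)%:E * (\1_A s)%:E)%E).
  rewrite ge0_integralZl_EFin//.
  - by rewrite integral_indic// setIT.
  - exact/measurable_EFinP/measurable_indic.
  - by rewrite subr_ge0 expr2 ler_peMr// ler1n.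
have Lk (s : S) : is_L1 (@sigma R) (kn n s).
  by apply: L1_bmeas; exact: (bker_l s (@bker_kn R n)).
have LB (s : S) : is_L1 (@sigma R) (fun t => N ^+ 2 - N * kn n s t).
  by apply: L1B; [exact: L1_cst|exact: L1Z].
apply/funext => s; rewrite /fubini_F/= -EFinM.
rewrite (_ : (fun t => _) = (fun t => (\1_A s * (N ^+ 2 - N * kn n s t))%:E)); last first.
  by apply/funext => t; rewrite /pair_density mulrC.
rewrite IE; last exact: L1Z.
rewrite IZ// IB; [|exact: L1_cst|exact: L1Z].
by rewrite I_cst IZ// I_kn mulr1 mulrC.
Qed.

(** Both measures have first marginal [N^2] times the surface measure: the
    ensemble has exactly [N] points, and the kernel [kn n] is a probability
    density in each variable. *)
Lemma pair_law_measure C : measurable C -> pair_law C = pair_measure C.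
Proof.
apply: measure_disjoint_rectangles.
- rewrite [ltLHS](pair_lawE setT); apply/lte_sum_pinfty => i _; apply/lte_sum_pinfty => j _.
  by rewrite preimage_setT probability_setT ltry.
- move=> A mA; rewrite [LHS](pair_lawE _) [RHS](pair_measureE _) integral_pair_density_setT//.
  rewrite (_ : [set s | _] = A); last by apply/seteqP; split => s //= [].
  rewrite -ge0_muleDl ?lee_fin ?subr_ge0 ?expr2 ?ler_peMr ?ler1n//.
  rewrite -EFinD subrK EFinM -muleA -(one_point_law hx mA).
  rewrite exchange_big/= -sum_ord_cst_ereal; apply: eq_bigr => j _.
  apply: eq_bigr => i _; congr (P _).
  by apply/seteqP; split => w //= [].
- move=> A B mA mB AB; rewrite [LHS](pair_lawE _) [RHS](pair_measureE _) two_point_law//.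
  rewrite (_ : [set s | _] = set0) ?measure0 ?mule0 ?adde0//.
Qed.

Lemma ge0_pair_formula (g : S * S -> \bar R) : measurable_fun setT g ->
  (forall p, 0 <= g p)%E ->
  (\sum_(i < n.+1) \sum_(j < n.+1) \int[P]_w g (x i w, x j w) =
   \int[(@sigma R \x @sigma R)%E]_p (g p * (pair_density n p)%:E) +
   N%:E * \int[@sigma R]_s g (s, s))%E.
Proof.
move=> mg g0.
transitivity (\int[pair_law]_p g p)%E.
  rewrite /pair_law ge0_integral_measure_sum//; apply: eq_bigr => i _.
  rewrite ge0_integral_measure_sum//; apply: eq_bigr => j _.
  by rewrite ge0_integral_distribution// !inord_val.
transitivity (\int[pair_measure]_p g p)%E.
  by apply: eq_measure_integral => A mA _; exact: pair_law_measure.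
rewrite /pair_measure ge0_integral_measure_add// ge0_integral_density_weight//.
rewrite ge0_integral_mscale// ge0_integral_distribution//.
Qed.

End pair_law.

(** * The variance of a linear statistic *)

Section variance.
Context (R : realType) d (Omega : measurableType d) (P : probability Omega R).
Variables (n : nat) (x : 'I_n.+1 -> {RV P >-> S2 R}).
Hypothesis hx : spherical_ensemble P x.
Local Notation S := (S2 R).
Local Notation N := (n.+1%:R : R).
Local Notation I := (mean (@sigma R)).
Local Notation J := (mean P).
Local Notation L1 := (is_L1 (@sigma R)).
Local Notation L2 := (is_L2 (@sigma R)).

Lemma ge0_point_formula (g : S -> \bar R) : measurable_fun setT g ->
  (forall s, 0 <= g s)%E ->
  (\sum_(i < n.+1) \int[P]_w g (x i w) = N%:E * \int[@sigma R]_s g s)%E.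
Proof.
move=> mg g0.
rewrite -(ge0_integral_mscale (@sigma R) measurableT (NngNum (ler0n R n.+1)) mg)//.
transitivity (\int[msum (fun i => distribution P (x (inord i))) n.+1]_s g s)%E.
  rewrite ge0_integral_measure_sum//; apply: eq_bigr => i _.
  by rewrite ge0_integral_distribution// inord_val.
apply: eq_measure_integral => A mA _.
apply: (etrans _ (one_point_law hx mA)); apply: eq_bigr => i _.
by rewrite inord_val.
Qed.

Lemma L1_ensemble (g : S -> R) i : (forall s, 0 <= g s) -> L1 g ->
  is_L1 P (fun w => g (x i w)).
Proof.
move=> g0 g1; have mg := L1_measurable g1.
have mgi : measurable_fun setT (fun w => g (x i w)) by exact: measurableT_comp.
apply/integrableP; split; first exact/measurable_EFinP.
apply: (@le_lt_trans _ _ (\sum_(i < n.+1) \int[P]_w (g (x i w))%:E)%E).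
  rewrite (bigD1 i)//= -[leLHS]adde0; apply: leeD.
    by rewrite (eq_integral (fun w => (g (x i w))%:E))// => w _ /=; rewrite ger0_norm.
  by apply: sume_ge0 => j _; apply: integral_ge0 => w _; rewrite lee_fin.
rewrite (ge0_point_formula (g := EFin \o g))//; last exact/measurable_EFinP.
by rewrite IE// -EFinM ltry.
Qed.

Lemma sum_mean_ensemble (g : S -> R) : (forall s, 0 <= g s) -> L1 g ->
  \sum_(i < n.+1) J (fun w => g (x i w)) = N * I g.
Proof.
move=> g0 g1; have mg := L1_measurable g1.
have := ge0_point_formula (g := EFin \o g).
rewrite /= IE//; rewrite (eq_bigr (fun i => (J (fun w => g (x i w)))%:E)); last first.
  by move=> i _; rewrite IE//; exact: L1_ensemble.
rewrite sumEFin -EFinM => E; apply: EFin_inj; apply: E => //.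
exact/measurable_EFinP.
Qed.

Lemma L2_ensemble (f : S -> R) i : L2 f -> is_L2 P (fun w => f (x i w)).
Proof.
move=> [mf f2]; split; first exact: measurableT_comp.
by apply: (L1_ensemble (g := fun s => f s ^+ 2)) => // s; exact: sqr_ge0.
Qed.

(** Polarization: [2 f = (f + 1)^2 - f^2 - 1]. *)
Lemma sum_mean_ensemble_L2 (f : S -> R) : L2 f ->
  \sum_(i < n.+1) J (fun w => f (x i w)) = N * I f.
Proof.
move=> f2; have f1 := L2_L1 f2.
have c1 : L2 (fun=> 1) by apply: L2_bmeas; exact: bmeas_cst.
have f2' := L2D f2 c1.
have mean_polar d' (T : measurableType d') (mu : probability T R) (h : T -> R) :
    is_L2 mu h -> mean mu h =
    2^-1 * (mean mu (fun s => (h s + 1) ^+ 2) - mean mu (fun s => h s ^+ 2) - 1).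
  move=> h2; have h1 := L2_L1 h2.
  rewrite (_ : (fun s => (h s + 1) ^+ 2) = fun s => h s ^+ 2 + 2 * h s + 1); last first.
    by apply/funext => s; ring.
  rewrite ID; [|by apply: L1D; [exact: L2_sq|exact: L1Z]|exact: L1_cst].
  rewrite ID; [|exact: L2_sq|exact: L1Z].
  by rewrite IZ// I_cst; field.
under eq_bigr do rewrite (mean_polar _ _ _ _ (L2_ensemble _ f2)).
rewrite -mulr_sumr !sumrB (sum_mean_ensemble (g := fun s => (f s + 1) ^+ 2)).
- rewrite (sum_mean_ensemble (g := fun s => f s ^+ 2)).
  + rewrite sumr_const card_ord (mean_polar _ _ _ _ f2); ring.
  + by move=> s; exact: sqr_ge0.
  + exact: L2_sq.
- by move=> s; exact: sqr_ge0.
- exact: L2_sq.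
Qed.

(** The integrand vanishes on the diagonal, so only the two-point intensity
    contributes. *)
Lemma sum_mean_sqr_diff (f : S -> R) : L2 f ->
  \sum_(i < n.+1) \sum_(j < n.+1) J (fun w => (f (x i w) - f (x j w)) ^+ 2) =
  2 * N ^+ 2 * (I (fun s => f s ^+ 2) - I f ^+ 2) - 2 * N * qform n f.
Proof.
move=> f2; have f1 := L2_L1 f2; have mf := L1_measurable f1.
have fi i := L2_ensemble i f2.
pose g (p : S * S) := (f p.1 - f p.2) ^+ 2.
have mg : measurable_fun setT g.
  by apply: measurable_funX; apply: measurable_funB; exact: measurableT_comp.
have := ge0_pair_formula hx (g := EFin \o g).
rewrite /= [X in (_ + N%:E * X)%E]integral0_eq; last first.
  by move=> s _; rewrite /g/= subrr expr0n.
rewrite mule0 adde0 fubini_tonelli1; last 2 first.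
- apply/measurable_EFinP; apply: measurable_funM => //.
  exact: measurable_pair_density.
- by move=> p; rewrite lee_fin mulr_ge0 ?sqr_ge0// pair_density_ge0.
have L2c c : L2 (fun=> c) by apply: L2_bmeas; exact: bmeas_cst.
have Ls s : L1 (fun t => (f s - f t) ^+ 2) by apply/L2_sq/L2B.
have Lks s : L1 (fun t => kn n s t * (f s - f t) ^+ 2) by exact: kn_sqr_L1.
have IsE s : I (fun t => (f s - f t) ^+ 2) =
    f s ^+ 2 - 2 * f s * I f + I (fun t => f t ^+ 2).
  rewrite (_ : (fun t => _) = fun t => f s ^+ 2 - (2 * f s) * f t + f t ^+ 2); last first.
    by apply/funext => t; ring.
  rewrite ID; [|by apply: L1B; [exact: L1_cst|exact: L1Z]|exact: L2_sq].
  by rewrite IB; [|exact: L1_cst|exact: L1Z]; rewrite I_cst IZ.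
have Lout : L1 (fun s => I (fun t => (f s - f t) ^+ 2)).
  rewrite (_ : (fun s => _) = fun s => f s ^+ 2 - (2 * I f) * f s + I (fun t => f t ^+ 2)).
    by apply: L1D; [apply: L1B; [exact: L2_sq|exact: L1Z]|exact: L1_cst].
  by apply/funext => s; rewrite IsE; ring.
have IoutE : I (fun s => I (fun t => (f s - f t) ^+ 2)) =
    2 * (I (fun t => f t ^+ 2) - I f ^+ 2).
  rewrite (_ : (fun s => _) = fun s => f s ^+ 2 - (2 * I f) * f s + I (fun t => f t ^+ 2)).
    rewrite ID; [|by apply: L1B; [exact: L2_sq|exact: L1Z]|exact: L1_cst].
    by rewrite IB; [|exact: L2_sq|exact: L1Z]; rewrite I_cst IZ//; ring.
  by apply/funext => s; rewrite IsE; ring.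
have -> : (\int[@sigma R]_s fubini_F (@sigma R)
    (fun p => ((g p)%:E * (pair_density n p)%:E)%E) s)%E =
    (\int[@sigma R]_s (N ^+ 2 * I (fun t => (f s - f t) ^+ 2) -
      N * I (fun t => kn n s t * (f s - f t) ^+ 2))%:E)%E.
  apply: eq_integral => s _; rewrite /fubini_F.
  rewrite (_ : (fun t => _) = fun t => (N ^+ 2 * (f s - f t) ^+ 2 -
      N * (kn n s t * (f s - f t) ^+ 2))%:E); last first.
    by apply/funext => t; rewrite -EFinM /g /pair_density/=; congr EFin; ring.
  by rewrite IE; [rewrite IB ?IZ//; exact: L1Z|apply: L1B; exact: L1Z].
have Lq := qform_inner_L1 n f2.
rewrite IE; last by apply: L1B; exact: L1Z.
rewrite IB; [|exact: L1Z|exact: L1Z].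
rewrite !IZ// -qform_double// IoutE.
rewrite (eq_bigr (fun i : 'I_n.+1 =>
  (\sum_(j < n.+1) J (fun w => (f (x i w) - f (x j w)) ^+ 2))%:E)); last first.
  move=> i _; rewrite -sumEFin; apply: eq_bigr => j _; rewrite IE//.
  exact: (L2_sq (L2B (fi i) (fi j))).
rewrite sumEFin => E; apply: EFin_inj.
rewrite E; first by congr EFin; ring.
- exact/measurable_EFinP.
- by move=> p; rewrite lee_fin sqr_ge0.
Qed.

Lemma sum_sqr_diff m (u : 'I_m -> R) :
  \sum_(i < m) \sum_(j < m) (u i - u j) ^+ 2 =
  2 * m%:R * \sum_(i < m) u i ^+ 2 - 2 * (\sum_(i < m) u i) ^+ 2.
Proof.
transitivity (\sum_(i < m) (m%:R * u i ^+ 2 - 2 * (\sum_(j < m) u j) * u i +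
    \sum_(j < m) u j ^+ 2)).
  apply: eq_bigr => i _.
  transitivity (\sum_(j < m) (u i ^+ 2 - 2 * u j * u i + u j ^+ 2)).
    by apply: eq_bigr => j _; ring.
  rewrite big_split/= sumrB sumr_const card_ord -!mulr_suml -!mulr_sumr.
  by rewrite -[_ *+ m]mulr_natl.
rewrite big_split/= sumrB sumr_const card_ord -!mulr_sumr -[_ *+ m]mulr_natl.
ring.
Qed.

Lemma ensemble_variance (f : S -> R) : L2 f ->
  ('V_P[fun w => (\sum_(i < n.+1) f (x i w))%R] = (N * qform n f)%:E)%E.
Proof.
move=> f2; have fi i := L2_ensemble i f2.
have S2 : is_L2 P (fun w => \sum_(i < n.+1) f (x i w)).
  exact: (L2_sum (F := fun i w => f (x i w))).
have Sq : J (fun w => (\sum_(i < n.+1) f (x i w)) ^+ 2) =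
    N ^+ 2 * I f ^+ 2 + N * qform n f.
  rewrite (_ : (fun w => _) = fun w => N * (\sum_(i < n.+1) f (x i w) ^+ 2) -
    2^-1 * \sum_(i < n.+1) \sum_(j < n.+1) (f (x i w) - f (x j w)) ^+ 2).
    rewrite IB; last 2 first.
    - by apply/L1Z/L1_sum => i; exact: L2_sq.
    - by apply/L1Z/L1_sum => i; apply: L1_sum => j; apply/L2_sq/L2B.
    rewrite IZ; last by apply/L1_sum => i; exact: L2_sq.
    rewrite IZ; last by apply/L1_sum => i; apply: L1_sum => j; apply/L2_sq/L2B.
    rewrite (I_sum (F := fun i w => f (x i w) ^+ 2)); last by move=> i; exact: L2_sq.
    rewrite (I_sum (F := fun i w => \sum_(j < n.+1) (f (x i w) - f (x j w)) ^+ 2)); last first.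
      by move=> i; apply: L1_sum => j; exact: L2_sq (L2B (fi i) (fi j)).
    rewrite [X in _ - _ * X = _](eq_bigr (fun i : 'I_n.+1 =>
      \sum_(j < n.+1) J (fun w => (f (x i w) - f (x j w)) ^+ 2))); last first.
      move=> i _; rewrite (I_sum (F := fun j w => (f (x i w) - f (x j w)) ^+ 2))// => j.
      exact: L2_sq (L2B (fi i) (fi j)).
    rewrite (sum_mean_sqr_diff f2) (sum_mean_ensemble (g := fun s => f s ^+ 2)).
    - by field.
    - by move=> s; exact: sqr_ge0.
    - exact: L2_sq.
  by apply/funext => w; rewrite sum_sqr_diff; field.
rewrite varianceE; last exact/L2_Lfun.
have S1 := L2_L1 S2.
rewrite unlock (IE S1) [X in (X - _)%E](IE (L2_sq S2)) Sq.
rewrite (I_sum (F := fun i w => f (x i w))); last by move=> i; exact: L2_L1.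
rewrite (sum_mean_ensemble_L2 f2) -EFin_expe -EFinB; congr EFin; ring.
Qed.

End variance.

(** * The limit of the variance *)

Section limit.
Context (R : realType).
Local Notation S := (S2 R).
Implicit Types (f : S -> R) (G : S -> 'rV[R]_3).

Lemma vanishes_cvg (u : nat -> R) a : vanishes (fun n => u n - a) ->
  u n @[n --> \oo] --> a.
Proof.
move=> u0; apply/cvgrPdist_le => e e0; have [n0 un0] := u0 _ e0.
by exists n0 => // n n0n; rewrite distrC; exact: un0.
Qed.

Lemma weak_gradient_energy f G : is_L2 (@sigma R) f -> weak_gradient f G ->
  (\int[@sigma R]_x (dot (G x) (G x))%:E =
   (\sum_(i < 3) mean (@sigma R) (fun x => rot_comp G i x ^+ 2))%:E)%E.
Proof.
move=> f2 wG; have [H2 _] := weak_gradient_rot_grad f2 wG.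
have [_ tG _] := wG.
rewrite -(I_sum (F := fun i x => rot_comp G i x ^+ 2)); last first.
  by move=> i; exact: L2_sq (H2 i).
rewrite -IE; last by apply: L1_sum => i; exact: L2_sq (H2 i).
by apply: eq_integral => s _; rewrite rot_comp_energy// tG.
Qed.

Lemma qform_cvg_energy f : H1 f ->
  ((n.+1%:R * qform n f)%:E @[n --> \oo] --> dirichlet_energy f) /\
  dirichlet_energy f \is a fin_num.
Proof.
move=> h1; have [/L2_Lfun f2 exG] := h1.
have wG : weak_gradient f (grad f).
  by have [G wG] := exG; exact: (@xgetPex _ _ [set G | weak_gradient f G]).
rewrite /dirichlet_energy; case: ifPn => [_|/asboolPn//].
rewrite (weak_gradient_energy f2 wG); split => //.
apply/cvg_EFin; first exact: nearW.
exact/vanishes_cvg/energy_limit/weak_gradient_rot_grad.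
Qed.

(** Otherwise the sequence is bounded for arbitrarily large indices, and [f] has
    a weak gradient. *)
Lemma qform_dvg f : is_L2 (@sigma R) f -> ~ H1 f ->
  (n.+1%:R * qform n f)%:E @[n --> \oo] --> +oo%E.
Proof.
move=> f2 nH1; apply/cvgeryP/cvgryPge => C.
apply: contrapT => nC.
have [H gH] : exists H, rot_grad (@C1 R) f H.
  apply: (bounded_rot_grad (C := C) f2) => n0.
  apply: contrapT => nn0; apply: nC; exists n0 => // n /= n0n.
  rewrite leNgt; apply/negP => /ltW qC; apply: nn0; exists n => //.
apply: nH1; split; first exact/L2_Lfun.
by exists (rot_field H); exact: rot_grad_weak_gradient gH.
Qed.

End limit.

Theorem theorem2p5 (R : realType)
    (d : nat -> measure_display)
    (Omega : forall N : nat, measurableType (d N))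
    (P : forall N : nat, probability (Omega N) R)
    (x : forall N : nat, 'I_N -> {RV (P N) >-> S2 R})
    (hx : forall N : nat, (0 < N)%N -> spherical_ensemble (P N) (x N))
    (f : S2 R -> R) (hf : f \in Lfun (@sigma R) 2%:E) :
  let V := fun N : nat => 'V_(P N)[fun w => (\sum_(i < N) f (x N i w))%R]%E in
  V @ \oo --> dirichlet_energy f /\ (limn V \is a fin_num <-> H1 f).
Proof.
move=> V; have f2 : is_L2 (@sigma R) f by exact/L2_Lfun.
have VE n : V n.+1 = (n.+1%:R * qform n f)%:E by exact: (ensemble_variance (hx n.+1 (ltn0Sn n)) f2).
have Vcvg (l : \bar R) : (n.+1%:R * qform n f)%:E @[n --> \oo] --> l -> V @ \oo --> l.
  by move=> ql; rewrite -(cvg_shiftS V); under eq_fun do rewrite VE.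
have [h1|nh1] := pselect (H1 f).
  have [+ Dfin] := qform_cvg_energy h1 => /Vcvg VD.
  by split => //; split => // _; rewrite (cvg_lim _ VD).
have VD := Vcvg _ (qform_dvg f2 nh1).
split; first by rewrite /dirichlet_energy; case: ifPn => // /asboolP.
by rewrite (cvg_lim _ VD).
Qed.
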